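(* Let $n \in \mathbb{N}$ with $n \geq 2$, let $W\colon\mathbb{R}\to\mathbb{R}$ satisfy (W1), (W2), (W3), and let $\lambda \in (0,\lambda_n)$. Let $I \subset \mathbb{R}$ be an open bounded interval. Then $G_\varepsilon^{\lambda,n}$ $\Gamma$-converges to $G^{\lambda,n}$ as $\varepsilon \to 0$ in the $L^1(I)$-topology, that is: (Liminf inequality) for every $u \in L^1(I)$ and every $u_\varepsilon \in L^1(I)$ such that $u_\varepsilon \to u$ in $L^1(I)$ as $\varepsilon \to 0$, $$G^{\lambda,n}[u] \leq \liminf_{\varepsilon \to 0} G_\varepsilon^{\lambda,n}[u_\varepsilon];$$ (Limsup inequality) for every $u \in L^1(I)$ there exist $u_\varepsilon \in L^1(I)$ such that $u_\varepsilon \to u$ in $L^1(I)$ as $\varepsilon \to 0$ and $$\limsup_{\varepsilon \to 0} G_\varepsilon^{\lambda,n}[u_\varepsilon] \leq G^{\lambda,n}[u].$$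
   Context: Convention: ''$\varepsilon\to 0$'' means that the statement holds for every sequence $\varepsilon_m > 0$ with $\varepsilon_m \to 0$ as $m\to\infty$ (so $u_\varepsilon$ stands for a sequence indexed by $\varepsilon=\varepsilon_m$). For an open bounded interval $I \subset \mathbb{R}$, $|I|$ is its length, $W^{n,2}(I)$ is the usual Sobolev space of real-valued functions, and $u^{(j)}$ is the $j$-th weak derivative of $u$. $BV(I,\{\pm1\})$ is the space of functions $u \in L^1(I)$ of bounded variation on $I$ taking only the values $\pm 1$ almost everywhere. Every such $u$ is identified with its piecewise constant representative having finitely many points of discontinuity; $S(u)\subset I$ is the set of discontinuity points of this representative, so that $\# S(u) = \frac12 V[u]$, where $V[u]$ is the total variation of $u$ on $I$. The assumptions on $W\colon \mathbb{R}\to\mathbb{R}$ are: (W1) $W$ is continuous and $W \geq 0$; (W2) $W(t) = 0$ if and only if $t = 1$ or $t=-1$; (W3) there exists $L>0$ such that $W(t) \geq L(t-1)^2$ for all $t>0$ and $W(t) \geq L(t+1)^2$ for all $t<0$. The constant $\lambda_n>0$ is the optimal (largest) constant such that $$\lambda_n \int_J (v^{(n-1)})^2 \, dx \leq \frac{1}{|J|^{2n-2}} \int_J W(v)\, dx + |J|^2 \int_J (v^{(n)})^2 \, dx$$ holds for every open bounded interval $J \subset \mathbb{R}$ and every $v \in W^{n,2}(J)$; under (W1)-(W3) such a positive constant exists. For $\varepsilon>0$, the functional $G_\varepsilon^{\lambda,n}\colon L^1(I)\to\mathbb{R}\cup\{+\infty\}$ is defined by $$G_\varepsilon^{\lambda,n}[u]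 := \int_I \frac{1}{\varepsilon} W(u) - \lambda \varepsilon^{2n-3} (u^{(n-1)})^2 + \varepsilon^{2n-1}(u^{(n)})^2 \, dx \quad \text{if } u \in W^{n,2}(I),$$ and $G_\varepsilon^{\lambda,n}[u] := +\infty$ if $u \in L^1(I)\setminus W^{n,2}(I)$. The functional $G^{\lambda,n}$ on $L^1(I)$ is defined by $G^{\lambda,n}[u] := C_W^{\lambda,n}\, \# S(u)$ if $u \in BV(I,\{\pm 1\})$ and $G^{\lambda,n}[u] := +\infty$ if $u \in L^1(I)\setminus BV(I,\{\pm1\})$, where $$C_W^{\lambda,n} := \inf\left\{ \int_{\mathbb{R}} W(f) - \lambda (f^{(n-1)})^2 + (f^{(n)})^2 \, dx : f \in \mathcal{A}^n(\mathbb{R}) \right\},$$ $$\mathcal{A}^n(\mathbb{R}) := \left\{ f \in W^{n,2}_{\mathrm{loc}}(\mathbb{R}) : f(x) = 1 \text{ for } x > T \text{ and } f(x) = -1 \text{ for } x < -T \text{ for some } T > 0\right\}.$$ *)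

(* Defs.v *)
From HB Require Import structures.
From mathcomp Require Import all_boot all_order all_algebra.
From mathcomp Require Import all_classical all_reals all_analysis.

Set Implicit Arguments.
Unset Strict Implicit.
Unset Printing Implicit Defensive.

Import Order.TTheory GRing.Theory Num.Theory.
Import numFieldNormedType.Exports.

Local Open Scope classical_set_scope.
Local Open Scope ring_scope.

(* Elements of L^1, L^2 and of the Sobolev spaces are represented by functions
   R -> R, of which only the values on the open set Omega matter; every notion
   below is invariant under modification of the function on a null set, except
   [admissible], where "f = 1 for x > T" is imposed on the representative. *)

Section function_spaces.
Context {R : realType}.
Implicit Types (Omega : set R) (u g phi : R -> R) (n j : nat).
Local Notation mu := (@lebesgue_measure R).

Definition L1 Omega u : Prop := mu.-integrable Omega (EFin \o u).

Definition L2 Omega u : Prop :=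
  measurable_fun Omega u /\
  mu.-integrable Omega (fun x => (u x ^+ 2)%:E).

Definition L2_loc Omega u : Prop :=
  measurable_fun Omega u /\
  forall K, K `<=` Omega -> compact K ->
    mu.-integrable K (fun x => (u x ^+ 2)%:E).

Definition L1_cvg Omega (v : nat -> R -> R) u : Prop :=
  (\int[mu]_(x in Omega) `|v m x - u x|%:E)%E @[m --> \oo] --> 0%E.

Definition compactly_supported Omega phi : Prop :=
  exists K, [/\ compact K, K `<=` Omega & forall x, ~ K x -> phi x = 0].

(* C_c^oo(Omega) *)
Definition test_function Omega phi : Prop :=
  (forall k x, derivable (derive1n k phi) x 1) /\
  compactly_supported Omega phi.

(* C_c^1(Omega) *)
Definition test_function1 Omega phi : Prop :=
  [/\ forall x, derivable phi x 1, continuous (derive1 phi) &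
      compactly_supported Omega phi].

Definition is_weak_derivative Omega j u g : Prop :=
  [/\ locally_integrable Omega u, locally_integrable Omega g &
      forall phi, test_function Omega phi ->
        Rintegral mu Omega (fun x => u x * derive1n j phi x) =
        (-1) ^+ j * Rintegral mu Omega (fun x => g x * phi x)].

(* A weak derivative is unique up to a null set; one of them is chosen here
   (and the value is meaningless when there is none). *)
Definition weak_derivative Omega j u : R -> R :=
  xget (cst 0) [set g | is_weak_derivative Omega j u g].

(* W^{n,2}(Omega) *)
Definition sobolev n Omega u : Prop :=
  L2 Omega u /\
  forall j, (0 < j <= n)%N ->
    exists2 g, is_weak_derivative Omega j u g & L2 Omega g.

(* W^{n,2}_loc(Omega) *)
Definition sobolev_loc n Omega u : Prop :=
  L2_loc Omega u /\
  forall j, (0 < j <= n)%N ->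
    exists2 g, is_weak_derivative Omega j u g & L2_loc Omega g.

(* Total variation V[u] on Omega of an integrable function. *)
Definition variation Omega u : \bar R :=
  ereal_sup [set r | exists2 phi,
    test_function1 Omega phi /\ (forall x, `|phi x| <= 1) &
    r = (Rintegral mu Omega (fun x => u x * derive1 phi x))%:E].

(* BV(Omega, {+1, -1}) *)
Definition BV_pm1 Omega u : Prop :=
  [/\ L1 Omega u, (variation Omega u < +oo)%E &
      {ae mu, forall x, Omega x -> u x = 1 \/ u x = -1}].

Definition discontinuities Omega u : set R :=
  [set x | Omega x /\ ~ {for x, continuous u}].

(* A {+1, -1}-valued function with finitely many discontinuity points is
   piecewise constant. Right-continuity fixes its values at the jumps; it is
   only there to exclude removable discontinuities, and [jump_set] would be
   the same with left-continuity instead. *)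
Definition is_pc_representative Omega u v : Prop :=
  [/\ forall x, Omega x -> v x = 1 \/ v x = -1,
      {ae mu, forall x, Omega x -> u x = v x},
      finite_set (discontinuities Omega v) &
      forall x, Omega x -> v y @[y --> x^'+] --> v x].

Definition pc_representative Omega u : R -> R :=
  xget (cst 0) [set v | is_pc_representative Omega u v].

(* S(u), for u in BV(Omega, {+1, -1}) *)
Definition jump_set Omega u : set R :=
  discontinuities Omega (pc_representative Omega u).

End function_spaces.

Section functionals.
Context {R : realType}.
Implicit Types (W u f : R -> R) (lambda eps : R) (n : nat) (I : set R).
Local Notation mu := (@lebesgue_measure R).

Definition W1 W : Prop := continuous W /\ forall t, 0 <= W t.

Definition W2 W : Prop := forall t, W t = 0 <-> t = 1 \/ t = -1.

Definition W3 W : Prop := exists2 L : R, 0 < L &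
  (forall t, 0 < t -> L * (t - 1) ^+ 2 <= W t) /\
  (forall t, t < 0 -> L * (t + 1) ^+ 2 <= W t).

Definition interpolation_inequality n W (l : R) : Prop :=
  forall (c d : R) (v : R -> R), c < d -> sobolev n `]c, d[ v ->
  (l%:E * \int[mu]_(x in `]c, d[) (weak_derivative `]c, d[ n.-1 v x ^+ 2)%:E <=
   ((d - c) ^- (2 * n - 2))%:E * \int[mu]_(x in `]c, d[) (W (v x))%:E +
   ((d - c) ^+ 2)%:E *
     \int[mu]_(x in `]c, d[) (weak_derivative `]c, d[ n v x ^+ 2)%:E)%E.

(* The set contains 0, is closed, and is bounded above (take v = x^(n-1) on a
   fixed interval), so this supremum is the largest admissible constant. *)
Definition optimal_constant n W : R :=
  sup [set l | interpolation_inequality n W l].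

Definition G_eps n W lambda I eps u : \bar R :=
  if `[< sobolev n I u >] then
    (\int[mu]_(x in I)
      (eps^-1 * W (u x)
       - lambda * eps ^+ (2 * n - 3) * weak_derivative I n.-1 u x ^+ 2
       + eps ^+ (2 * n - 1) * weak_derivative I n u x ^+ 2)%:E)%E
  else +oo%E.

(* The class A^n(R) *)
Definition admissible n f : Prop :=
  sobolev_loc n setT f /\
  exists2 T : R, 0 < T &
    (forall x, T < x -> f x = 1) /\ (forall x, x < - T -> f x = -1).

(* C_W^{lambda,n} *)
Definition transition_cost n W lambda : \bar R :=
  ereal_inf [set (\int[mu]_x
      (W (f x)
       - lambda * weak_derivative setT n.-1 f x ^+ 2
       + weak_derivative setT n f x ^+ 2)%:E)%E | f in admissible n].

(* [counting] is the number of elements, and +oo for infinite sets. *)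
Definition G_lim n W lambda I u : \bar R :=
  if `[< BV_pm1 I u >] then
    (transition_cost n W lambda * counting (jump_set I u))%E
  else +oo%E.

End functionals.

(* Main.v *)
(* Since lambda < lambda_n, the interpolation inequality on cells of length close
   to 1 makes the energy, rescaled by x = eps t, dominate a multiple of
   int W(v) + (v^(n))^2 on long intervals. Bounded energy thus forces all but
   boundedly many unit cells to have small energy; on such a cell v is close to one
   of the wells with small derivatives up to order n - 1. If the limit u takes both
   values on ]p, q[ then a cell near 1 and a cell near -1 occur there; Hermite
   interpolation to the constants 1 and -1 from these cells produces an admissible profile at an
   arbitrarily small extra cost, while the energy outside is nonnegative. So each
   interval on which u is mixed costs at least C_W. As C_W > 0, u is mixed on at
   most finitely many successive intervals, hence piecewise constant, and the
   number of its jumps is the maximal number of such intervals.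

   For the upper bound, rescaled copies of a nearly optimal profile are inserted
   at the jumps, and a diagonal choice is made. *)

Require Import Defs.
From HB Require Import structures.
From mathcomp Require Import all_boot all_order all_algebra.
From mathcomp Require Import all_classical all_reals all_analysis.
From mathcomp Require Import measurable_realfun zify ring lra.

Set Implicit Arguments.
Unset Strict Implicit.
Unset Printing Implicit Defensive.

Import Order.TTheory GRing.Theory Num.Theory.
Import numFieldNormedType.Exports.

Local Open Scope classical_set_scope.
Local Open Scope ring_scope.

(** * Integrals over compact intervals *)

(** The obstacle is the negative term: the density has no sign, and only its integral over a cell of
    length between 1 and 1 + e is controlled, where e is fixed by the gap between lambda and some l
    > lambda for which the interpolation inequality still holds. Energy may therefore be discarded
    only along whole cells. For this reason a rescaled interval is cut into K equal cells, K being
    the integer part of its length, and a transition is taken from the right end of one cell to the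
    left end of another on the same grid, so that what remains on either side is a union of cells. A
    W^{n,2} function is replaced by a chain [F 0, ..., F n] of successive primitives: restriction,
    scaling, reflection and gluing become pointwise operations, and weak derivatives reappear only
    in the passage to and from the definitions of the statement. For a limit with values 1 and -1,
    how much of ]p, q[ each value occupies is read off the single number [ig u p q], compared with q
    - p. *)

Section interval_integral.
Context {R : realType}.
Implicit Types (f g : R -> R) (x y z c M : R).
Local Notation mu := (@lebesgue_measure R).

(** The interval is closed because continuity up to the endpoints and gluing at them are used later.
    For y < x it is empty and [ig] is 0: this is not an oriented integral. *)
Definition iint f x y : Prop := mu.-integrable `[x, y] (EFin \o f).
Definition ig f x y : R := \int[mu]_(t in `[x, y]) f t.

Lemma iint_open f x y : mu.-integrable `]x, y[ (EFin \o f) -> iint f x y.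
Proof.
move=> /integrableP[mf fi]; apply/integrableP; split.
  apply/measurable_EFinP; apply: (@measurable_fun_itv_cc _ x y false true).
  exact/measurable_EFinP.
by rewrite integral_itv_bndoo//; exact: measurableT_comp.
Qed.

Lemma iintS f x y x' y' : iint f x y -> x <= x' -> y' <= y -> iint f x' y'.
Proof.
move=> fi xx yy; apply: integrableS fi => //.
by apply: subset_itvScc; rewrite bnd_simp.
Qed.

Lemma iint_measurable f x y : iint f x y -> measurable_fun `[x, y] f.
Proof. by move=> /integrableP[/measurable_EFinP]. Qed.

Lemma ig_open f x y : iint f x y -> ig f x y = \int[mu]_(t in `]x, y[) f t.
Proof.
move=> fi; rewrite /ig /Rintegral integral_itv_bndoo//.
apply/measurable_EFinP; apply: measurable_funS (iint_measurable fi) => //.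
exact: subset_itv_oo_cc.
Qed.

Lemma integral_ig f x y : iint f x y ->
  (\int[mu]_(t in `]x, y[) (f t)%:E)%E = (ig f x y)%:E.
Proof.
move=> fi; rewrite ig_open// /Rintegral fineK//.
apply: integrable_fin_num => //; apply: integrableS fi => //.
exact: subset_itv_oo_cc.
Qed.

Lemma igxx f x : ig f x x = 0.
Proof. by rewrite /ig set_itv1 Rintegral_set1. Qed.

Lemma igD f y x z : iint f x z -> x <= y -> y <= z ->
  ig f x z = ig f x y + ig f y z.
Proof.
move=> fi xy yz; rewrite /ig.
have := @Rintegral_itvB R f (BLeft x) (BRight z) y fi.
rewrite !bnd_simp => /(_ xy yz) /eqP; rewrite subr_eq => /eqP ->.
rewrite addrC; congr (_ + _); apply: Rintegral_itv_obnd_cbnd.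
apply: integrableS fi => //.
by move=> t /=; rewrite !in_itv/= => /andP[yt ->]; rewrite (le_trans xy (ltW yt)).
Qed.

Lemma iint_cat f y x z : iint f x y -> iint f y z -> iint f x z.
Proof.
move=> fxy fyz.
have [xy|yx] := leP x y; last by apply: iintS fyz _ _ => //; exact: ltW.
have [yz|zy] := leP y z; last by apply: iintS fxy _ _ => //; exact: ltW.
have E : [set` `[x, z]] = [set` `[x, y]] `|` [set` `]y, z]].
  by rewrite (@itv_bndbnd_setU _ _ _ (BRight y))// bnd_simp.
have my : mu.-integrable `]y, z] (EFin \o f).
  by apply: integrableS fyz => //; exact: subset_itv_oc_cc.
move: fxy my => /integrableP[m1 i1] /integrableP[m2 i2].
apply/integrableP; split.
  by rewrite E; apply/measurable_funU.
rewrite E ge0_integral_setU//=.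
- by rewrite lte_add_pinfty.
- rewrite -E; do 2 apply: measurableT_comp => //; apply/measurable_EFinP.
  by rewrite E; apply/measurable_funU.
- apply/disj_setPS => t /= []; rewrite !in_itv/= => /andP[_ ty] /andP[].
  by rewrite ltNge ty.
Qed.

Lemma igE f g x y : (forall t, x <= t <= y -> f t = g t) -> ig f x y = ig g x y.
Proof.
by move=> fg; apply: eq_Rintegral => t; rewrite inE/= in_itv/= => /fg.
Qed.

Lemma iintE f g x y : (forall t, x <= t <= y -> f t = g t) -> iint f x y ->
  iint g x y.
Proof.
move=> fg; apply: eq_integrable => // t; rewrite inE/= in_itv/= => /fg.
by move=> /= ->.
Qed.

Lemma aeS (P Q : set R) : (forall t, P t -> Q t) ->
  {ae mu, forall t, P t} -> {ae mu, forall t, Q t}.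
Proof.
move=> PQ; apply: filterS => //; exact: (ae_filter_ringOfSetsType mu).
Qed.

Lemma aeI (P Q : set R) : {ae mu, forall t, P t} -> {ae mu, forall t, Q t} ->
  {ae mu, forall t, P t /\ Q t}.
Proof. exact: (@filterI _ _ (ae_filter_ringOfSetsType mu)). Qed.

Lemma iint_ae f g x y : {ae mu, forall t, `]x, y[%classic t -> f t = g t} ->
  measurable_fun `]x, y[ f -> measurable_fun `]x, y[ g -> iint f x y -> iint g x y.
Proof.
move=> fg mf mg fi; apply: iint_open.
have : mu.-integrable `]x, y[ (EFin \o f).
  by apply: integrableS fi => //; exact: subset_itv_oo_cc.
move=> /integrableP[_ fy]; apply/integrableP; split; first exact/measurable_EFinP.
move: fy; rewrite (@ae_eq_integral _ _ _ mu _ (fun t => `|(EFin \o g) t|)%E)//.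
- by apply: measurableT_comp => //; exact/measurable_EFinP.
- by apply: measurableT_comp => //; exact/measurable_EFinP.
- by apply: aeS fg => t /= fg xt; rewrite fg.
Qed.

Lemma ig_ae f g x y : {ae mu, forall t, `]x, y[%classic t -> f t = g t} ->
  measurable_fun `]x, y[ f -> measurable_fun `]x, y[ g -> ig f x y = ig g x y.
Proof.
move=> fg mf mg; rewrite /ig /Rintegral.
rewrite (@integral_itv_bndoo _ x y (EFin \o f)); last exact/measurable_EFinP.
rewrite (@integral_itv_bndoo _ x y (EFin \o g)); last exact/measurable_EFinP.
congr fine; apply: ae_eq_integral => //; [exact/measurable_EFinP..|].
by apply: aeS fg => t /= fg xt; rewrite fg.
Qed.

Lemma iint_bounded f x y M : measurable_fun `[x, y] f ->
  (forall t, x <= t <= y -> `|f t| <= M) -> iint f x y.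
Proof.
move=> mf fM; apply: measurable_bounded_integrable => //.
  rewrite /= lebesgue_measure_itv/=; case: ifPn => // _; by rewrite -EFinB ltry.
exists M; split; first exact: num_real.
by move=> N MN t /= /fM /le_trans; apply; exact: ltW.
Qed.

Lemma cont_iint f x y : {within `[x, y], continuous f} -> iint f x y.
Proof.
move=> cf; apply: continuous_compact_integrable => //; exact: segment_compact.
Qed.

Lemma iint_cst c x y : iint (cst c) x y.
Proof. by apply: cont_iint; apply: continuous_subspaceT; exact: cst_continuous. Qed.

Lemma ig_cst c x y : x <= y -> ig (cst c) x y = c * (y - x).
Proof.
move=> xy; rewrite /ig Rintegral_cst//= lebesgue_measure_itv/= lte_fin.
move: xy; rewrite le_eqVlt => /predU1P[->|->//]; rewrite ltxx subrr//.
Qed.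

Lemma iintD f g x y : iint f x y -> iint g x y -> iint (fun t => f t + g t) x y.
Proof. by move=> fi gi; have := @integrableD _ _ _ mu _ _ _ _ fi gi; exact. Qed.

Lemma iintB f g x y : iint f x y -> iint g x y -> iint (fun t => f t - g t) x y.
Proof. by move=> fi gi; have := @integrableB _ _ _ mu _ _ _ _ fi gi; exact. Qed.

Lemma iintZ c f x y : iint f x y -> iint (fun t => c * f t) x y.
Proof. by move=> fi; have := @integrableZl _ _ _ mu `[x, y] _ c _ fi; exact. Qed.

Lemma iint_norm f x y : iint f x y -> iint (fun t => `|f t|) x y.
Proof. exact: integrable_norm. Qed.

Lemma ig_add f g x y : iint f x y -> iint g x y ->
  ig (fun t => f t + g t) x y = ig f x y + ig g x y.
Proof. by move=> fi gi; rewrite /ig RintegralD. Qed.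

Lemma ig_sub f g x y : iint f x y -> iint g x y ->
  ig (fun t => f t - g t) x y = ig f x y - ig g x y.
Proof. by move=> fi gi; rewrite /ig RintegralB. Qed.

Lemma igZ c f x y : iint f x y -> ig (fun t => c * f t) x y = c * ig f x y.
Proof. by move=> fi; rewrite /ig RintegralZl. Qed.

Lemma le_ig f g x y : iint f x y -> iint g x y ->
  (forall t, x <= t <= y -> f t <= g t) -> ig f x y <= ig g x y.
Proof.
by move=> fi gi fg; apply: le_Rintegral => // t; rewrite /= in_itv/= => /fg.
Qed.

(** Replacing g by max(f, g), which agrees with g almost everywhere, makes the inequality
    pointwise. *)
Lemma le_ig_ae f g x y : iint f x y -> iint g x y ->
  {ae mu, forall t, `]x, y[%classic t -> f t <= g t} -> ig f x y <= ig g x y.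
Proof.
move=> fi gi fg; pose h t := Num.max (f t) (g t).
have mS k : iint k x y -> measurable_fun `]x, y[ k.
  move=> /iint_measurable; apply: measurable_funS => //; exact: subset_itv_oo_cc.
have mh : measurable_fun `]x, y[ h by apply: measurable_maxr; exact: mS.
have hg : {ae mu, forall t, `]x, y[%classic t -> g t = h t}.
  by apply: aeS fg => t /= fg /fg fg'; rewrite /h max_r.
rewrite (ig_ae hg)//; last exact: mS.
apply: le_ig => //; first by apply: (iint_ae hg) => //; exact: mS.
by move=> t _; rewrite /h le_max lexx.
Qed.

Lemma ig_ge0 f x y : (forall t, x <= t <= y -> 0 <= f t) -> 0 <= ig f x y.
Proof. by move=> f0; apply: Rintegral_ge0 => t; rewrite /= in_itv/= => /f0. Qed.

Lemma ig_norm f x y : iint f x y -> `|ig f x y| <= ig (fun t => `|f t|) x y.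
Proof. by move=> fi; apply: le_normr_Rintegral. Qed.

Lemma le_igS f x y x' y' : iint f x y -> x <= x' -> x' <= y' -> y' <= y ->
  (forall t, x <= t <= y -> 0 <= f t) -> ig f x' y' <= ig f x y.
Proof.
move=> fi xx xy yy f0.
rewrite (@igD f x' x y)//; last exact: le_trans xy yy.
rewrite (@igD f y' x' y)//; last exact: iintS fi _ _.
have h1 : 0 <= ig f x x'.
  apply: ig_ge0 => t /andP[xt tx]; apply: f0; rewrite xt (le_trans tx)//.
  exact: le_trans xy yy.
have h2 : 0 <= ig f y' y.
  apply: ig_ge0 => t /andP[xt tx]; apply: f0; rewrite tx andbT (le_trans xx)//.
  exact: le_trans xy xt.
lra.
Qed.

Lemma ig_cont f x y : x <= y -> iint f x y ->
  {within `[x, y], continuous (fun t => ig f x t)}.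
Proof. move=> xy fi; exact: parameterized_integral_continuous. Qed.

Lemma FTC f f' x y : x <= y -> (forall t : R, is_derive t (1 : R) f (f' t)) ->
  continuous f' -> ig f' x y = f y - f x.
Proof.
rewrite le_eqVlt => /predU1P[->|xy] df cf'; first by rewrite igxx subrr.
have cf : continuous f.
  move=> t; apply: differentiable_continuous; apply/derivable1_diffP.
  by have [] := df t.
rewrite /ig /Rintegral (@continuous_FTC2 R f' f x y)//=.
- exact: continuous_subspaceT.
- split => //.
  + exact/cvg_at_right_filter/cf.
  + exact/cvg_at_left_filter/cf.
- by move=> t _; rewrite derive1E; have [_ ->] := df t.
Qed.

(** * Affine change of variables *)

Section affine.
Variables (al be : R) (al0 : al != 0).
Let phi (t : measurableTypeR R) : measurableTypeR R := al * t + be.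

Let mphi : measurable_fun setT phi.
Proof.
apply: continuous_measurable_fun => t; apply: cvgD; last exact: cvg_cst.
by apply: cvgMr; exact: cvg_id.
Qed.

Let nu := mscale (NngNum (normr_ge0 al)) 
  (measure_function_pushforward__canonical__measure_function_Measure mu mphi).

(** The scaled image measure agrees with Lebesgue measure on half-open intervals, which determines
    it. For a negative slope the preimage is half-open on the other side. *)
Let munu A : measurable A -> mu A = nu A.
Proof.
apply: lebesgue_measure_unique => X [[x y]/= _ <-]{X}.
rewrite [in RHS]/mscale /= /pushforward.
have := al0; rewrite neq_lt => /orP[aln|alp].
- have -> : phi @^-1` `]x, y] = `[(y - be) / al, (x - be) / al[%classic.
    apply/seteqP; split => t /=; rewrite /phi !in_itv/=.
      by rewrite ler_ndivrMr// ltr_ndivlMr//; lra.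
    by rewrite ler_ndivrMr// ltr_ndivlMr//; lra.
  rewrite !lebesgue_measure_itv/= !lte_fin.
  have -> : ((y - be) / al < (x - be) / al) = (x < y).
    by rewrite ltr_nM2r ?invr_lt0//; lra.
  case: ifPn => _; last by rewrite mule0.
  by rewrite -!EFinB -EFinM ltr0_norm//; congr EFin; field.
- have -> : phi @^-1` `]x, y] = `](x - be) / al, (y - be) / al]%classic.
    apply/seteqP; split => t /=; rewrite /phi !in_itv/=.
      by rewrite ler_pdivlMr// ltr_pdivrMr//; lra.
    by rewrite ler_pdivlMr// ltr_pdivrMr//; lra.
  rewrite !lebesgue_measure_itv/= !lte_fin.
  have -> : ((x - be) / al < (y - be) / al) = (x < y).
    by rewrite ltr_pM2r ?invr_gt0//; lra.
  case: ifPn => _; last by rewrite mule0.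
  by rewrite -!EFinB -EFinM gtr0_norm//; congr EFin; field; lra.
Qed.

(** [f] is extended by 0 outside [D]; the image-measure formula for nonnegative functions is then
    applied to the positive and the negative part separately. *)
Lemma Rintegral_affine f (D : set R) : measurable D ->
  mu.-integrable D (EFin \o f) ->
  mu.-integrable (phi @^-1` D) (EFin \o (f \o phi)) /\
  \int[mu]_(t in phi @^-1` D) f (phi t) = `|al|^-1 * \int[mu]_(t in D) f t.
Proof.
move=> mD fi; pose h : R -> R := f \_ D.
have mf : measurable_fun D f by apply/measurable_EFinP; case/integrableP : fi.
have mh : measurable_fun setT h by apply/(measurable_restrictT _ _).1.
have mE : measurable (phi @^-1` D) by rewrite -[X in measurable X]setTI; exact: mphi.
have E (k : R -> \bar R) : measurable_fun setT k -> (forall t, 0 <= k t)%E ->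
   (\int[mu]_(t in D) k t = `|al|%:E * \int[mu]_(t in phi @^-1` D) k (phi t))%E.
  move=> mk k0.
  rewrite (@eq_measure_integral _ _ _ _ nu); last by move=> A mA _; apply: munu.
  rewrite ge0_integral_mscale//; last exact: measurable_funTS.
  by rewrite ge0_integral_pushforward//; exact: measurable_funTS.
have a0 : 0 < `|al| by rewrite normr_gt0.
have hf t : (phi @^-1` D) t -> h (phi t) = f (phi t).
  by move=> /= Dt; rewrite /h patchE mem_set.
have mhp : measurable_fun (phi @^-1` D) (h \o phi).
  by apply: measurable_funTS; exact: measurableT_comp.
have ih : mu.-integrable (phi @^-1` D) (EFin \o (h \o phi)).
  apply/integrableP; split; first exact/measurable_EFinP.
  have := E (fun t => `|(h t)%:E|)%E; rewrite /=.
  have -> : (\int[mu]_(x in D) `|h x|%:E = \int[mu]_(x in D) `|f x|%:E)%E.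
    by apply: eq_integral => t Dt; rewrite /h patchE Dt.
  have [_ fy] := integrableP _ _ _ fi; move: fy => /= fy E'.
  move: fy; rewrite E'//; last by do 2 apply: measurableT_comp => //.
  by rewrite !ltey; apply: contra_neq => ->; rewrite gt0_muley// lte_fin.
have ifp : mu.-integrable (phi @^-1` D) (EFin \o (f \o phi)).
  by apply: eq_integrable ih => // t /set_mem /hf /= ->.
split => //.
have -> : \int[mu]_(t in phi @^-1` D) f (phi t) =
    \int[mu]_(t in phi @^-1` D) (h \o phi) t.
  by apply: eq_Rintegral => t /set_mem Dt; rewrite /= hf.
have -> : \int[mu]_(t in D) f t = \int[mu]_(t in D) h t.
  by apply: eq_Rintegral => t Dt; rewrite /h patchE Dt.
have key (p n : \bar R) : p \is a fin_num -> n \is a fin_num ->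
    fine (p - n)%E = `|al|^-1 * fine (`|al|%:E * p - `|al|%:E * n)%E.
  move=> /fineK <- /fineK <-.
  by rewrite -!EFinM -!EFinB /= -mulrBr mulKf// gt_eqF.
have mhE : measurable_fun setT (EFin \o h) by exact/measurable_EFinP.
have hp : (\int[mu]_(t in D) (EFin \o h)^\+ t =
    `|al|%:E * \int[mu]_(t in phi @^-1` D) (EFin \o (h \o phi))^\+ t)%E.
  have -> : ((EFin \o (h \o phi))^\+ = (EFin \o h)^\+ \o phi)%E.
    exact: (funepos_comp (EFin \o h) phi).
  exact: (E _ (measurable_funepos mhE) (funepos_ge0 _)).
have hn : (\int[mu]_(t in D) (EFin \o h)^\- t =
    `|al|%:E * \int[mu]_(t in phi @^-1` D) (EFin \o (h \o phi))^\- t)%E.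
  have -> : ((EFin \o (h \o phi))^\- = (EFin \o h)^\- \o phi)%E.
    exact: (funeneg_comp (EFin \o h) phi).
  exact: (E _ (measurable_funeneg mhE) (funeneg_ge0 _)).
have ED := integralE mu D (EFin \o h); rewrite hp hn in ED.
have EE := integralE mu (phi @^-1` D) (EFin \o (h \o phi)).
rewrite /Rintegral; move: EE ED => /= -> ->.
apply: key.
- exact: integrable_pos_fin_num ih.
- exact: integrable_neg_fin_num ih.
Qed.

End affine.

Lemma ig_affine al be f x y : 0 < al -> iint f (al * x + be) (al * y + be) ->
  iint (fun t => f (al * t + be)) x y /\
  ig (fun t => f (al * t + be)) x y = al^-1 * ig f (al * x + be) (al * y + be).
Proof.
move=> al0 fi; have al1 : al != 0 by rewrite gt_eqF.
have := @Rintegral_affine al be al1 f _ (measurable_itv _) fi.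
have -> : (fun t => al * t + be) @^-1` `[al * x + be, al * y + be] = `[x, y]%classic.
  by apply/seteqP; split => t /=; rewrite !in_itv/= !lerD2r !ler_pM2l.
by rewrite gtr0_norm.
Qed.

Lemma ig_opp f x y : iint f (- y) (- x) ->
  iint (fun t => f (- t)) x y /\ ig (fun t => f (- t)) x y = ig f (- y) (- x).
Proof.
move=> fi; have al1 : (-1 : R) != 0 by rewrite oppr_eq0 oner_eq0.
have := @Rintegral_affine (-1) 0 al1 f _ (measurable_itv _) fi.
have -> : (fun t => -1 * t + 0) @^-1` `[- y, - x] = `[x, y]%classic.
  by apply/seteqP; split => t /=; rewrite !in_itv/=; lra.
have -> : (f \o fun t => -1 * t + 0) = (fun t => f (- t)).
  by apply/funext => t /=; rewrite mulN1r addr0.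
rewrite normrN normr1 invr1 mul1r.
have -> : \int[mu]_(t in `[x, y]) f (-1 * t + 0) = ig (fun t => f (- t)) x y.
  by apply: eq_Rintegral => t _; rewrite mulN1r addr0.
by [].
Qed.

(** Meant for densities that compare only after integration over each cell, not pointwise. *)
Lemma ig_cells (f g : R -> R) (P tau : R) (K : nat) : 0 <= tau ->
  iint f P (P + K%:R * tau) -> iint g P (P + K%:R * tau) ->
  (forall k, (k < K)%N -> ig f (P + k%:R * tau) (P + k.+1%:R * tau) <=
                          ig g (P + k%:R * tau) (P + k.+1%:R * tau)) ->
  ig f P (P + K%:R * tau) <= ig g P (P + K%:R * tau).
Proof.
move=> tau0; elim: K => [|K IH] fi gi fg; first by rewrite mul0r addr0 !igxx.
have h1 : P <= P + K%:R * tau by rewrite lerDl mulr_ge0.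
have h2 : P + K%:R * tau <= P + K.+1%:R * tau.
  by rewrite lerD2l ler_wpM2r// ler_nat.
rewrite (@igD f (P + K%:R * tau))// (@igD g (P + K%:R * tau))//.
apply: lerD; last exact: fg.
apply: IH; [exact: iintS fi _ _|exact: iintS gi _ _|].
by move=> k kK; apply: fg; rewrite ltnS ltnW.
Qed.

End interval_integral.

(** * Smooth bumps and steps *)

Section smooth_step.
Context {R : realType}.
Implicit Types (f g h phi : R -> R) (x y t c : R).
Local Notation mu := (@lebesgue_measure R).

(** The functions t^(-k) exp(-1/t), extended by 0. The derivative of each is a linear combination of
    two others of the family, so one computation of a derivative gives smoothness at 0 as well. *)
Definition flat_exp (k : nat) (t : R) : R :=
  if 0 < t then t^-1 ^+ k * expR (- t^-1) else 0.

Lemma flat_exp_ge0 k t : 0 <= flat_exp k t.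
Proof.
rewrite /flat_exp; case: ifPn => // t0.
by rewrite mulr_ge0 ?expR_ge0// exprn_ge0// invr_ge0 ltW.
Qed.

(* exp (1/t) >= (1/(m t))^m with m = k + 2, from 1 + x <= exp x. *)
Lemma flat_exp_bound k t : `|flat_exp k t| <= k.+2%:R ^+ k.+2 * t ^+ 2.
Proof.
rewrite ger0_norm ?flat_exp_ge0// /flat_exp; case: ifPn => [t0|_]; last first.
  by rewrite mulr_ge0// ?sqr_ge0// exprn_ge0.
have m0 : 0 < k.+2%:R :> R by rewrite ltr0n.
have tV : 0 < t^-1 by rewrite invr_gt0.
have h : (t^-1 / k.+2%:R) ^+ k.+2 <= expR t^-1.
  have -> : expR t^-1 = expR (t^-1 / k.+2%:R) ^+ k.+2.
    by rewrite -expRM_natr; congr expR; rewrite mulfVK// gt_eqF.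
  apply: lerXn2r; rewrite ?nnegrE ?expR_ge0//.
    by apply: divr_ge0; exact: ltW.
  by apply: le_trans (expR_ge1Dx _); rewrite lerDr.
have ep := expR_gt0 t^-1.
rewrite expRN ler_pdivrMr//.
apply: le_trans (ler_wpM2l _ h); last by rewrite mulr_ge0 ?sqr_ge0// exprn_ge0.
set m : R := k.+2%:R.
have mk : m ^+ k.+2 != 0 by rewrite expf_neq0// gt_eqF.
have tn : t != 0 by rewrite gt_eqF.
rewrite expr_div_n [in t^-1 ^+ k.+2]exprS [in t^-1 ^+ k.+1]exprS.
rewrite le_eqVlt; apply/orP; left; apply/eqP; move: (m ^+ k.+2) (t^-1 ^+ k) mk => A B An.
by field; rewrite tn An.
Qed.

Lemma flat_exp_derive k t :
  is_derive t (1 : R) (flat_exp k) (flat_exp k.+2 t - k%:R * flat_exp k.+1 t).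
Proof.
have [t0|t0|->] := ltgtP t 0.
- rewrite /flat_exp !ltNge ltW//= mulr0 subr0.
  apply: (@near_eq_is_derive _ _ _ (cst 0)).
    near=> s; rewrite /flat_exp ltNge ltW//.
    by near: s; exact: lt_nbhsl.
- apply: (@near_eq_is_derive _ _ _ (fun s : R => (s^-1 ^+ k * expR (- s^-1)) : R)).
    near=> s; rewrite /flat_exp ifT//.
    by near: s; exact: lt_nbhsr.
  have tn : t != 0 by rewrite gt_eqF.
  have dV : is_derive t (1 : R) (fun s : R => s^-1) (- t ^- 2).
    by apply: is_derive_eq (is_deriveV (f := id) tn (is_derive_id _ _)) _; rewrite scaler1.
  have dE : is_derive t (1 : R) (fun s : R => expR (- s^-1)) (expR (- t^-1) * t ^- 2).
    apply: (@is_derive1_comp _ expR (fun s => - s^-1)) => //.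
    by apply: is_derive_eq (is_deriveN dV) _; rewrite opprK.
  have dX : is_derive t (1 : R) (fun s : R => s^-1 ^+ k) (k%:R * t^-1 ^+ k.-1 * - t ^- 2).
    rewrite (_ : (fun s : R => s^-1 ^+ k) = (fun s : R => s^-1) ^+ k).
      exact: is_deriveX dV.
    by apply/funext => s; elim: (k) => [|j IH]; rewrite ?expr0// !exprS IH.
  apply: is_derive_eq (is_deriveM dX dE) _; rewrite /flat_exp t0 /=.
  rewrite /GRing.scale/= -!exprVn.
  by case: k {dX} => [|k]; rewrite ?exprS ?fctE/=; field.
- have -> : flat_exp k.+2 0 - k%:R * flat_exp k.+1 0 = 0.
    by rewrite /flat_exp ltxx mulr0 subr0.
  (* By the quadratic bound [flat_exp_bound], the difference quotient at 0 is at most M |h|. *)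
  have hc : h^-1 *: (flat_exp k (h *: (1 : R) + 0) - flat_exp k 0) @[h --> (0 : R)^'] --> (0 : R).
    pose M : R := k.+2%:R ^+ k.+2.
    have hM : M * `|h| @[h --> (0 : R)^'] --> (0 : R).
      rewrite -[X in _ --> X](mulr0 M); apply: cvgMr.
      rewrite -[X in _ --> X](@normr0 R R); apply: cvg_norm.
      exact: cvg_within_filter.
    apply: (@squeeze_cvgr _ _ _ _ (fun h : R => - (M * `|h|)) (fun h : R => M * `|h|)).
    + near=> h; rewrite -ler_norml addr0 {2}/flat_exp ltxx subr0.
      rewrite /GRing.scale/= mulr1 normrM normfV.
      have h0 : 0 < `|h| by rewrite normr_gt0; near: h; exact: nbhs_dnbhs_neq.
      rewrite mulrC ler_pdivrMr// -mulrA -normrM -expr2 [in leRHS]ger0_norm ?sqr_ge0//.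
      exact: flat_exp_bound.
    + rewrite -[X in _ --> X]oppr0; apply: cvgN; exact: hM.
    + exact: hM.
  apply: DeriveDef; first by apply/cvg_ex; exists 0.
  by apply/cvg_lim.
Unshelve. all: by end_near. Qed.

(** A syntactic class closed under differentiation, so that infinite differentiability follows by
    induction without any formula for iterated derivatives. The last constructor admits functions
    known only through their derivative, such as [sstep]. *)
Inductive smooth_class : (R -> R) -> Prop :=
| smooth_flat k : smooth_class (flat_exp k)
| smooth_add f g : smooth_class f -> smooth_class g ->
    smooth_class (fun t => f t + g t)
| smooth_mul f g : smooth_class f -> smooth_class g ->
    smooth_class (fun t => f t * g t)
| smooth_scale c f : smooth_class f -> smooth_class (fun t => c * f t)
| smooth_affine c d f : smooth_class f -> smooth_class (fun t => f (c * t + d))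
| smooth_prim f g : smooth_class g ->
    (forall t : R, is_derive t (1 : R) f (g t)) -> smooth_class f.

Lemma is_derive_affine f x c d l : is_derive (c * x + d) (1 : R) f l ->
  is_derive x (1 : R) (fun t => f (c * t + d)) (c * l).
Proof.
move=> df; rewrite mulrC; apply: (@is_derive1_comp _ f (fun t => c * t + d)) => //.
apply: is_derive_eq (is_deriveD (is_deriveM (is_derive_cst c _ _) (is_derive_id _ _))
  (is_derive_cst d _ _)) _.
by rewrite /GRing.scale/= !mulr1 mulr0 addr0 addr0.
Qed.

Lemma smooth_class_derive f : smooth_class f ->
  exists2 g, smooth_class g & forall t : R, is_derive t (1 : R) f (g t).
Proof.
elim=> {f}.
- move=> k; exists (fun t => flat_exp k.+2 t + - k%:R * flat_exp k.+1 t).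
    by apply: smooth_add; [|apply: smooth_scale]; exact: smooth_flat.
  by move=> t; apply: is_derive_eq (flat_exp_derive k t) _; rewrite mulNr.
- move=> f g _ [f' sf' df] _ [g' sg' dg]; exists (fun t => f' t + g' t).
    exact: smooth_add.
  by move=> t; exact: is_deriveD.
- move=> f g sf [f' sf' df] sg [g' sg' dg]; exists (fun t => f t * g' t + g t * f' t).
    by apply: smooth_add; exact: smooth_mul.
  by move=> t; exact: is_deriveM.
- move=> c f sf [f' sf' df]; exists (fun t => c * f' t).
    exact: smooth_scale.
  move=> t; apply: is_derive_eq (is_deriveM (is_derive_cst c _ _) (df t)) _.
  by rewrite /GRing.scale/= mulr0 addr0.
- move=> c d f sf [f' sf' df]; exists (fun t => c * f' (c * t + d)).
    by apply: smooth_scale; apply: smooth_affine.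
  by move=> t; exact: is_derive_affine.
- by move=> f g sg _ df; exists g.
Qed.

Lemma is_derive_derive1 f g : (forall t : R, is_derive t (1 : R) f (g t)) ->
  derive1 f = g.
Proof. by move=> df; apply/funext => t; rewrite derive1E; have [_ ->] := df t. Qed.

Lemma is_derive_continuous f g : (forall t : R, is_derive t (1 : R) f (g t)) ->
  continuous f.
Proof.
move=> df t; apply: differentiable_continuous; apply/derivable1_diffP.
by have [] := df t.
Qed.

Lemma smooth_class_continuous f : smooth_class f -> continuous f.
Proof. by move=> /smooth_class_derive[g _ df]; exact: is_derive_continuous df. Qed.

Lemma smooth_class_derivable f k t : smooth_class f -> derivable (derive1n k f) t 1.
Proof.
move=> sf; suff : smooth_class (derive1n k f).
  by move=> /smooth_class_derive[g _ dg]; have [] := dg t.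
elim: k => [//|k]; rewrite derive1nS => /smooth_class_derive[g sg dg].
by rewrite (is_derive_derive1 dg).
Qed.

Definition bump0 t : R := flat_exp 0 t * flat_exp 0 (-1 * t + 1).

Lemma smooth_bump0 : smooth_class bump0.
Proof.
apply: smooth_mul; first exact: smooth_flat.
by apply: smooth_affine; exact: smooth_flat.
Qed.

Lemma bump0_ge0 t : 0 <= bump0 t.
Proof. by rewrite mulr_ge0 ?flat_exp_ge0. Qed.

Lemma bump0_out t : (t <= 0) || (1 <= t) -> bump0 t = 0.
Proof.
rewrite /bump0 /flat_exp; case: ltP => /= [t0 t1|_ _]; last by rewrite mul0r.
by rewrite [in X in _ * X]ifF ?mulr0//; apply/negbTE; rewrite -leNgt; lra.
Qed.

Lemma bump0_half : 0 < bump0 2^-1.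
Proof.
rewrite /bump0 /flat_exp [in X in _ * X]ifT; last by lra.
by rewrite ifT ?invr_gt0// !expr0 !mul1r mulr_gt0 ?expR_gt0.
Qed.

Lemma iint_cont f x y : continuous f -> iint f x y.
Proof. by move=> cf; apply: cont_iint; exact: continuous_subspaceT. Qed.

Lemma ig_gt0 f x y t : continuous f -> (forall s, 0 <= f s) -> x < t < y ->
  0 < f t -> 0 < ig f x y.
Proof.
move=> cf f0 /andP[xt ty] ft.
have ft2 : 0 < f t / 2 by lra.
have /cvgrPdist_lt/(_ _ ft2)[r /= r0 hr] := cf t.
pose d := Num.min (r / 2) (Num.min (t - x) (y - t)).
have d0 : 0 < d by rewrite !lt_min !subr_gt0 xt ty divr_gt0.
have [dr dx dy] : [/\ d <= r / 2, d <= t - x & d <= y - t].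
  by rewrite /d; split; rewrite !ge_min lexx ?orbT.
apply: (@lt_le_trans _ _ (ig f (t - d) (t + d))); last first.
  apply: le_igS => //; [exact: iint_cont|lra|lra|lra].
apply: (@lt_le_trans _ _ (ig (cst (f t / 2)) (t - d) (t + d))).
  rewrite ig_cst; [|lra]; apply: mulr_gt0; lra.
apply: le_ig; [exact: iint_cst|exact: iint_cont|] => s /andP[s1 s2] /=.
have : `|f t - f s| < f t / 2.
  by apply: hr => /=; rewrite ltr_norml; lra.
rewrite ltr_norml; lra.
Qed.

Lemma bump_mass_gt0 : 0 < ig bump0 0 1.
Proof.
apply: (ig_gt0 (t := 2^-1)) => //.
- exact: smooth_class_continuous smooth_bump0.
- exact: bump0_ge0.
- lra.
- exact: bump0_half.
Qed.

Definition bump t : R := (ig bump0 0 1)^-1 * bump0 t.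

Lemma smooth_bump : smooth_class bump.
Proof. by apply: smooth_scale; exact: smooth_bump0. Qed.

Lemma cont_bump : continuous bump.
Proof. exact: smooth_class_continuous smooth_bump. Qed.

Lemma bump_ge0 t : 0 <= bump t.
Proof. by rewrite mulr_ge0 ?bump0_ge0// invr_ge0 ltW// bump_mass_gt0. Qed.

Lemma bump_out t : (t <= 0) || (1 <= t) -> bump t = 0.
Proof. by move=> /bump0_out; rewrite /bump => ->; rewrite mulr0. Qed.

Lemma bump_mass : ig bump 0 1 = 1.
Proof.
rewrite /bump igZ ?mulVf//; first by rewrite gt_eqF// bump_mass_gt0.
by apply: iint_cont; exact: smooth_class_continuous smooth_bump0.
Qed.

Lemma bump_bounded : exists2 M : R, 0 < M & forall t, bump t <= M.
Proof.
have [c _ hc] := @EVT_max R bump 0 1 ler01 (continuous_subspaceT cont_bump).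
exists (bump c + 1) => [|t]; first by have := bump_ge0 c; lra.
have [t01|] := boolP (t \in `[0, 1]); first by have := hc _ t01; lra.
rewrite in_itv/= negb_and -!ltNge => ht; rewrite bump_out.
  by have := bump_ge0 c; lra.
by move/orP : ht => [/ltW ->//|/ltW ->]; rewrite orbT.
Qed.

Definition sstep t : R := ig bump 0 t.

(** Since [ig bump 0 t] integrates over the empty set for t < 0, differentiating at t requires a
    base point strictly to the left of t. *)
Lemma sstepE a t : a <= 0 -> a <= t -> sstep t = ig bump a t.
Proof.
move=> a0 at0; have [t0|t0] := leP 0 t.
  rewrite (igD (iint_cont _ _ cont_bump) a0 t0) [X in _ = X + _](_ : _ = 0) ?add0r//.
  rewrite (@igE _ _ (cst 0)) ?ig_cst ?mul0r// => s /andP[_ s0].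
  by rewrite bump_out// s0.
rewrite (@igE _ _ (cst 0) a) ?ig_cst ?mul0r//; last first.
  by move=> s /andP[_ s0]; rewrite bump_out// (le_trans s0 (ltW t0)).
by rewrite /sstep /ig set_itv_ge ?Rintegral_set0// -leNgt bnd_simp.
Qed.

Lemma sstep_derive t : is_derive t (1 : R) sstep (bump t).
Proof.
pose a := Num.min 0 t - 1.
have [a0 at0] : a < 0 /\ a < t.
  by rewrite /a /Num.min; case: ifPn => [|/negbTE/negP]; rewrite ?ltNge ?negbK => ?; lra.
apply: (@near_eq_is_derive _ _ _ (fun s => ig bump a s)).
  near=> s; rewrite (@sstepE a)//; first exact: ltW.
  by apply: ltW; near: s; exact: lt_nbhsr.
have tt1 : t < t + 1 by rewrite ltrDl.
have ib : iint bump a (t + 1) by apply: iint_cont; exact: cont_bump.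
have cb : {for t, continuous bump} by exact: cont_bump.
have [d1 d2] := continuous_FTC1_closed tt1 ib at0 cb.
by apply: DeriveDef; [exact: d1|rewrite -derive1E; exact: d2].
Unshelve. all: by end_near. Qed.

Lemma smooth_sstep : smooth_class sstep.
Proof. exact: smooth_prim smooth_bump sstep_derive. Qed.

Lemma sstep0 t : t <= 0 -> sstep t = 0.
Proof.
move=> t0; rewrite (@sstepE (t - 1)); [|lra|lra].
rewrite (@igE _ _ (cst 0)) ?ig_cst ?mul0r//; first lra.
by move=> s /andP[_ st]; rewrite bump_out// (le_trans st t0).
Qed.

Lemma sstep1 t : 1 <= t -> sstep t = 1.
Proof.
move=> t1; rewrite /sstep (igD (iint_cont _ _ cont_bump) ler01 t1) bump_mass.
rewrite (@igE _ _ (cst 0)) ?ig_cst ?mul0r ?addr0//.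
by move=> s /andP[s1 _]; rewrite bump_out// s1 orbT.
Qed.

Lemma sstep_ndecr s t : s <= t -> sstep s <= sstep t.
Proof.
move=> st; pose a := Num.min 0 s.
have [a0 as0] : a <= 0 /\ a <= s by rewrite /a !ge_min !lexx orbT.
rewrite (@sstepE a s)// (@sstepE a t)//; last exact: le_trans st.
rewrite (igD (iint_cont _ _ cont_bump) as0 st) lerDl.
by apply: ig_ge0 => *; exact: bump_ge0.
Qed.

Lemma sstep01 t : 0 <= sstep t <= 1.
Proof.
apply/andP; split.
  have [t0|t0] := leP t 0; first by rewrite sstep0.
  by rewrite -(sstep0 (lexx 0)) sstep_ndecr// ltW.
have [t1|t1] := leP 1 t; first by rewrite sstep1.
by rewrite -(sstep1 (lexx 1)) sstep_ndecr// ltW.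
Qed.

End smooth_step.

(** * Mollification and weak derivatives *)

Section weak_calculus.
Context {R : realType}.
Implicit Types (f g h phi : R -> R) (x y t c d M e : R) (n : nat).
Local Notation mu := (@lebesgue_measure R).

Lemma within_cont_bounded f x y : {within `[x, y], continuous f} ->
  exists2 M, 0 <= M & forall t, x <= t <= y -> `|f t| <= M.
Proof.
move=> cf.
have /compact_bounded[M [_ hM]] := continuous_compact cf (@segment_compact _ x y).
exists (`|M| + 1); first by rewrite addr_ge0.
move=> t xty; apply: (hM (`|M| + 1)).
  by rewrite (le_lt_trans (ler_norm M))// ltrDl.
by exists t => //=; rewrite in_itv.
Qed.

Lemma cont_bounded f x y : continuous f ->
  exists2 M, 0 <= M & forall t, x <= t <= y -> `|f t| <= M.
Proof. by move=> cf; apply: within_cont_bounded; exact: continuous_subspaceT. Qed.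

Lemma iintM_bounded f g x y M : iint f x y -> measurable_fun `[x, y] g ->
  (forall t, x <= t <= y -> `|g t| <= M) -> iint (fun t => f t * g t) x y.
Proof.
move=> fi mg gM.
have bg : [bounded g t | t in `[x, y]%classic].
  exists M; split; first exact: num_real.
  by move=> N MN t /=; rewrite in_itv/= => /gM /le_trans; apply; exact: ltW.
exact: (integrableMl _ fi mg bg).
Qed.

Lemma iintM_within f g x y : iint f x y -> {within `[x, y], continuous g} ->
  iint (fun t => f t * g t) x y.
Proof.
move=> fi cg; have [M _ hM] := within_cont_bounded cg.
by apply: iintM_bounded fi _ hM; exact: iint_measurable (cont_iint cg).
Qed.

Lemma iintM_cont f g x y : iint f x y -> continuous g ->
  iint (fun t => f t * g t) x y.
Proof. by move=> fi cg; apply: iintM_within => //; exact: continuous_subspaceT. Qed.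

Lemma ig_le_bound f g x y M : iint f x y -> iint (fun t => f t * g t) x y ->
  (forall t, x <= t <= y -> `|g t| <= M) ->
  `|ig (fun t => f t * g t) x y| <= M * ig (fun t => `|f t|) x y.
Proof.
move=> fi fgi gM; apply: le_trans (ig_norm fgi) _.
rewrite -igZ; last exact: iint_norm.
apply: le_ig; [exact: iint_norm|apply: iintZ; exact: iint_norm|].
by move=> t xty; rewrite normrM mulrC ler_wpM2r// gM.
Qed.

(** A one-sided approximate identity, of mass 1 on [x, x + 1/(n+1)], and below it its primitive, a
    smooth step from 0 to 1 on the same window. Kernels and differences of ramps are the only
    concrete test functions in the proof. *)
Definition kern n x t : R := n.+1%:R * bump (n.+1%:R * t + - (n.+1%:R * x)).
Definition ramp n x t : R := sstep (n.+1%:R * t + - (n.+1%:R * x)).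

Lemma smooth_kern n x : smooth_class (kern n x).
Proof. by apply: smooth_scale; apply: smooth_affine; exact: smooth_bump. Qed.

Lemma smooth_ramp n x : smooth_class (ramp n x).
Proof. by apply: smooth_affine; exact: smooth_sstep. Qed.

Lemma ramp_derive n x t : is_derive t (1 : R) (ramp n x) (kern n x t).
Proof. by apply: is_derive_affine; exact: sstep_derive. Qed.

Lemma cont_kern n x : continuous (kern n x).
Proof. exact: smooth_class_continuous (smooth_kern n x). Qed.

Lemma cont_ramp n x : continuous (ramp n x).
Proof. exact: smooth_class_continuous (smooth_ramp n x). Qed.

Lemma kern_ge0 n x t : 0 <= kern n x t.
Proof. by rewrite mulr_ge0// bump_ge0. Qed.

Let ltV n : 0 < n.+1%:R^-1 :> R. Proof. by rewrite invr_gt0 ltr0n. Qed.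

Lemma kern_out n x t : (t <= x) || (x + n.+1%:R^-1 <= t) -> kern n x t = 0.
Proof.
move=> h; rewrite /kern bump_out ?mulr0// -mulrBr.
case/orP : h => h; apply/orP; [left|right].
  by rewrite pmulr_rle0 ?ltr0n// subr_le0.
by rewrite -ler_pdivrMl ?ltr0n// mulr1 lerBrDl.
Qed.

Lemma ramp0 n x t : t <= x -> ramp n x t = 0.
Proof.
by move=> h; apply: sstep0; rewrite -mulrBr pmulr_rle0 ?ltr0n// subr_le0.
Qed.

Lemma ramp1 n x t : x + n.+1%:R^-1 <= t -> ramp n x t = 1.
Proof.
by move=> h; apply: sstep1; rewrite -mulrBr -ler_pdivrMl ?ltr0n// mulr1 lerBrDl.
Qed.

Lemma ramp01 n x t : 0 <= ramp n x t <= 1.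
Proof. exact: sstep01. Qed.

Lemma kern_mass n x : ig (kern n x) x (x + n.+1%:R^-1) = 1.
Proof.
rewrite (FTC _ (ramp_derive n x) (@cont_kern n x)) ?lerDl ?ltW//.
by rewrite ramp1// ramp0// subr0.
Qed.

Lemma ig_support f x y x' y' : iint f x y -> x <= x' -> x' <= y' -> y' <= y ->
  (forall t, (x <= t <= x') || (y' <= t <= y) -> f t = 0) ->
  ig f x y = ig f x' y'.
Proof.
move=> fi xx xy yy f0.
rewrite (@igD _ f x' x y)//; last exact: le_trans xy yy.
rewrite (@igD _ f y' x' y)//; last exact: iintS fi _ _.
rewrite (@igE _ f (cst 0) x); last by move=> t h; apply: f0; rewrite h.
rewrite (@igE _ f (cst 0) y'); last by move=> t h; apply: f0; rewrite h orbT.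
by rewrite !ig_cst// !mul0r add0r addr0.
Qed.

(** The form in which Lebesgue points are used: one-sided averages at x converge to [f x]. The first
    conjunct keeps the support of the kernel inside the interval. *)
Definition mollifies f c d x := forall e, 0 < e -> exists N, forall n,
  (N <= n)%N -> x + n.+1%:R^-1 < d /\
    `|ig (fun t => f t * kern n x t) c d - f x| <= e.

Lemma invn_lt e : 0 < e -> exists N, forall n, (N <= n)%N -> n.+1%:R^-1 < e.
Proof.
move=> e0; exists (Num.truncn e^-1) => n hn.
rewrite invf_plt ?posrE ?ltr0n//.
by apply: lt_le_trans (truncnS_gt _) _; rewrite ler_nat ltnS.
Qed.

Lemma lebesgue_pt_mollifies f c d x : c < x < d -> iint f c d ->
  lebesgue_pt f x -> mollifies f c d x.
Proof.
move=> /andP[cx xd] fi lf e e0; have [M M0 hM] := @bump_bounded R.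
(* The kernel is at most k M, with k = n + 1, and the average over the ball of radius 1/k carries
   its length 2/k; the product is 2 M. *)
pose e' := e / (2 * M).
have e'0 : 0 < e' by rewrite divr_gt0// mulr_gt0.
have /= [r r0 hr] : \forall r \near (0 : R)^'+, (davg f x r < e'%:E)%E.
  apply: (lf [set y | (y < e'%:E)%E]); apply: open_nbhs_nbhs; split => /=.
    exact: open_ereal_lt_ereal.
  by rewrite lte_fin.
have m0 : 0 < Num.min r (Num.min (x - c) (d - x)).
  by rewrite !lt_min r0 !subr_gt0 cx xd.
have [N hN] := invn_lt m0; exists N => n /hN; rewrite !lt_min.
set k : R := n.+1%:R; have k0 : 0 < k by rewrite ltr0n.
move=> /and3P[kr kc kd]; have kV : 0 < k^-1 by rewrite invr_gt0.
have xkd : x + k^-1 < d by rewrite -ltrBrDl.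
have ckx : c <= x - k^-1 by rewrite lerBrDr -lerBrDl ltW.
split => //.
pose g t := f t - f x.
have gi : iint g c d by apply: iintB => //; exact: iint_cst.
have Ile : ig (fun t => `|g t|) (x - k^-1) (x + k^-1) <= e' * (2 * k^-1).
  have := hr k^-1; rewrite /= sub0r normrN gtr0_norm// => /(_ kr kV).
  rewrite /davg /iavg ball_itv.
  have gi' : iint (fun t => `|g t|) (x - k^-1) (x + k^-1).
    by apply: iint_norm; apply: iintS gi _ _ => //; exact: ltW.
  have := integral_ig gi'; rewrite /g /= => ->.
  rewrite lebesgue_measure_itv/= lte_fin ifT; last by rewrite ltrD2l gtrN.
  have -> : ((x + k^-1)%:E - (x - k^-1)%:E = (2 * k^-1)%:E)%E.
    by rewrite -EFinB; congr EFin; ring.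
  rewrite inver ifF; last by apply/negbTE; rewrite mulf_neq0 ?gt_eqF.
  rewrite -EFinM lte_fin ltr_pdivrMl; last by rewrite mulr_gt0.
  by move=> /ltW; rewrite mulrC.
have fk : iint (fun t => f t * kern n x t) c d.
  by apply: iintM_cont => //; exact: cont_kern.
have -> : ig (fun t => f t * kern n x t) c d =
          ig (fun t => f t * kern n x t) x (x + k^-1).
  apply: ig_support => //; [exact: ltW|by rewrite lerDl ltW|exact: ltW|].
  move=> t h; rewrite kern_out ?mulr0//.
  by move: h => /orP[/andP[_ ->]//|/andP[-> _]]; rewrite orbT.
have xc : c <= x by exact: ltW.
have xkd' : x + k^-1 <= d by exact: ltW.
have fkx := iintS fk xc xkd'.
have kx : iint (fun t => f x * kern n x t) x (x + k^-1).
  by apply: iintZ; apply: iint_cont; exact: cont_kern.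
rewrite -[X in _ - X]mulr1 -(kern_mass n x) -igZ; last first.
  by apply: iint_cont; exact: cont_kern.
rewrite -ig_sub// (@igE _ _ (fun t => g t * kern n x t)); last first.
  by move=> t _; rewrite /g mulrBl.
have gx := iintS gi xc xkd'.
apply: (@le_trans _ _ (k * M * ig (fun t => `|g t|) x (x + k^-1))).
  apply: ig_le_bound => //; first by apply: iintM_cont => //; exact: cont_kern.
  by move=> t _; rewrite ger0_norm ?kern_ge0// /kern ler_wpM2l// ltW.
apply: (@le_trans _ _ (k * M * (e' * (2 * k^-1)))).
  rewrite ler_wpM2l//; first by rewrite mulr_ge0// ltW.
  apply: le_trans Ile; apply: le_igS => //.
  - by apply: iint_norm; apply: iintS gi _ _ => //; exact: ltW.
  - by rewrite gerBl ltW.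
  - by rewrite lerDl ltW.
suff -> : k * M * (e' * (2 / k)) = e by [].
by rewrite /e'; field; rewrite !gt_eqF.
Qed.

Lemma mollifies_ae f c d : iint f c d ->
  {ae mu, forall x, `]c, d[%classic x -> mollifies f c d x}.
Proof.
move=> fi; pose h : R -> R := f \_ `]c, d[.
have fo : mu.-integrable `]c, d[ (EFin \o f).
  by apply: integrableS fi => //; exact: subset_itv_oo_cc.
have hE t : c < t < d -> h t = f t.
  by move=> ht; rewrite /h patchE mem_set//= in_itv.
have hi : iint h c d.
  apply: iint_open; apply: eq_integrable fo => // t.
  by rewrite inE/= in_itv/= => /hE ->.
have := lebesgue_differentiation (integrable_locally_restrict (measurable_itv _) fo).
apply: aeS => x lx /=; rewrite in_itv/= => cxd.
have := lebesgue_pt_mollifies cxd hi lx => mh e /mh[N hN].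
exists N => n /hN[xd]; rewrite hE// => he; split => //.
rewrite (@igE _ _ (fun t => h t * kern n x t))// => t /andP[ct td].
move/andP : cxd => [cx xd'].
have [->|tc] := eqVneq t c; first by rewrite kern_out ?mulr0// ltW.
have [->|td'] := eqVneq t d; first by rewrite kern_out ?mulr0// (ltW xd) orbT.
by rewrite hE// !lt_neqAle eq_sym tc ct td' td.
Qed.

Lemma ae_ex (P : set R) c d : c < d -> {ae mu, forall x, P x} ->
  exists2 x, c < x < d & P x.
Proof.
move=> cd [N [mN N0 PN]]; apply: contrapT => nP.
have sub : `]c, d[%classic `<=` N.
  move=> x /=; rewrite in_itv/= => cxd; apply: PN => /= Px.
  by apply: nP; exists x.
have := le_measure mu (mem_set (measurable_itv `]c, d[)) (mem_set mN) sub.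
move: N0 => /= ->; rewrite lebesgue_measure_itv/= lte_fin cd -EFinB lee_fin; lra.
Qed.

Lemma small_inv2 e e' : 0 < e -> 0 < e' -> exists2 n : nat, n.+1%:R^-1 < e & n.+1%:R^-1 < e'.
Proof.
move=> e0 e'0; have [N hN] := invn_lt e0; have [N' hN'] := invn_lt e'0.
by exists (maxn N N'); [apply: hN|apply: hN']; rewrite leq_max leqnn ?orbT.
Qed.

(** At almost every x the numbers assumed to vanish converge to [f x]. This is the fundamental lemma
    of the calculus of variations, tested on kernels alone. *)
Lemma weak_zero f c d : iint f c d ->
  (forall n x, c < x -> x + n.+1%:R^-1 < d ->
    ig (fun t => f t * kern n x t) c d = 0) ->
  {ae mu, forall x, `]c, d[%classic x -> f x = 0}.
Proof.
move=> fi f0; apply: aeS (mollifies_ae fi) => x mx xcd.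
have [cx xd] : c < x /\ x < d by move: xcd; rewrite /= in_itv/= => /andP.
apply/eqP; rewrite -normr_eq0; apply/eqP/le_anti; rewrite normr_ge0 andbT.
apply/ler_addgt0Pr => e e0; rewrite add0r.
have [N /(_ N (leqnn N))[hd]] := mx xcd e e0.
by rewrite f0// sub0r normrN.
Qed.

(** The difference of the two ramps is a smoothed indicator of [x, y]: it deviates from it only on
    the two windows of length 1/(n+1), and there by at most 1. *)
Lemma ramp_window h c d n x y : iint h c d -> c < x ->
  x + n.+1%:R^-1 <= y -> y + n.+1%:R^-1 < d ->
  `|ig (fun t => h t * (ramp n x t - ramp n y t)) c d - ig h x y| <=
  ig (fun t => `|h t|) x (x + n.+1%:R^-1) + ig (fun t => `|h t|) y (y + n.+1%:R^-1).
Proof.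
move=> hi cx xky ykd; have k0 := ltV n.
have r1 z t : z + n.+1%:R^-1 <= t -> ramp n z t = 1 by exact: ramp1.
move: (n.+1%:R^-1) k0 r1 xky ykd => k k0 r1 xky ykd.
have r0 z t : t <= z -> ramp n z t = 0 by exact: ramp0.
have r01 z t : 0 <= ramp n z t <= 1 by exact: ramp01.
have [xy yk xk] : [/\ x <= y, y <= y + k & x <= x + k] by split; lra.
have [xyk yd xkd xd] : [/\ x <= y + k, y <= d, x + k <= d & x <= d] by split; lra.
have [cy cyk ykd'] : [/\ c <= y, c <= y + k & y + k <= d] by split; lra.
have cx' : c <= x by exact: ltW.
have crr : continuous (fun t => ramp n x t - ramp n y t).
  by move=> t; apply: cvgB; exact: cont_ramp.
pose hr t := h t * (ramp n x t - ramp n y t).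
have hri : iint hr c d by exact: iintM_cont.
rewrite -/hr (@ig_support _ c d x (y + k))//; last first.
  move=> t /orP[/andP[_ tx]|/andP[yt _]].
    by rewrite /hr !r0 ?subrr ?mulr0// (le_trans tx).
  by rewrite /hr !r1 ?subrr ?mulr0// (le_trans _ yt)// lerD2r.
rewrite (@igD _ hr y x (y + k))//; last exact: iintS hri _ _.
have hxy : iint h x y by exact: iintS hi _ _.
have hrxy : iint hr x y by exact: iintS hri _ _.
rewrite addrAC -ig_sub//; apply: le_trans (ler_normD _ _) _; apply: lerD.
  rewrite (@igD _ _ (x + k) x y)//; last exact: iintB.
  rewrite [X in _ + X](_ : _ = 0) ?addr0; last first.
    rewrite (@igE _ _ (cst 0)) ?ig_cst ?mul0r// => t /andP[t1 t2].
    by rewrite /hr (r1 x t)// (r0 y t)// subr0 mulr1 subrr.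
  rewrite (@igE _ _ (fun t => h t * (ramp n x t - ramp n y t - 1))); last first.
    by move=> t _; rewrite [RHS]mulrBr mulr1.
  rewrite -[X in _ <= X]mul1r; apply: ig_le_bound.
  + exact: iintS hi _ _.
  + apply: iintM_cont; first exact: iintS hi _ _.
    by move=> t; apply: cvgB; [exact: crr|exact: cvg_cst].
  + move=> t /andP[xt tx]; rewrite (r0 y t); last exact: le_trans xky.
    by have := r01 x t; rewrite subr0 ler_norml; lra.
rewrite -[X in _ <= X]mul1r; apply: ig_le_bound.
+ exact: iintS hi _ _.
+ exact: iintS hri _ _.
+ by move=> t _; have := r01 x t; have := r01 y t; rewrite ler_norml; lra.
Qed.

(** A difference of ramps tests [h] against nearly the indicator of [x, y], and its derivative, a
    difference of kernels, tests [g] at x and y. In the limit, g y - g x is the integral of h over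
    [x, y] for almost all x and y. *)
Lemma weak_primitive g h c d : c < d -> iint g c d -> iint h c d ->
  (forall n x y, c < x -> x < y -> y + n.+1%:R^-1 < d ->
    ig (fun t => g t * (kern n x t - kern n y t)) c d =
    - ig (fun t => h t * (ramp n x t - ramp n y t)) c d) ->
  exists k0, {ae mu, forall t, `]c, d[%classic t -> g t = k0 + ig h c t}.
Proof.
move=> cd gi hi gh.
have key x y : c < x -> x < y -> y < d -> mollifies g c d x ->
    mollifies g c d y -> g y - g x = ig h x y.
  move=> cx xy yd mx my.
  apply/eqP; rewrite -subr_eq0 -normr_eq0; apply/eqP/le_anti.
  rewrite normr_ge0 andbT; apply/ler_addgt0Pr => e e0; rewrite add0r.
  (* Four errors: the mollified values of [g] at x and at y, and the two windows of
     [ramp_window]. *)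
  have e4 : 0 < e / 4 by lra.
  have ni : iint (fun t => `|h t|) c d by exact: iint_norm.
  have cc := ig_cont (ltW cd) ni.
  have small z : c < z -> z < d -> exists N, forall n, (N <= n)%N ->
      z + n.+1%:R^-1 <= d -> ig (fun t => `|h t|) z (z + n.+1%:R^-1) <= e / 4.
    move=> cz zd; have zcd : z \in `]c, d[ by rewrite in_itv/= cz zd.
    have [hz _ _] := (continuous_within_itvP (ig (fun t => `|h t|) c) cd).1 cc.
    have /cvgrPdist_le/(_ _ e4)[r /= r0 hr] := hz z zcd.
    have [N hN] := invn_lt r0; exists N => n /hN nr znd.
    have nV := ltV n.
    have := hr (z + n.+1%:R^-1); rewrite /= opprD addrA subrr sub0r normrN.
    rewrite gtr0_norm// => /(_ nr).
    rewrite (@igD _ _ z c (z + n.+1%:R^-1)); last 3 first.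
    + exact: iintS ni _ _.
    + exact: ltW.
    + by rewrite lerDl ltW.
    by rewrite opprD addrA subrr sub0r normrN => /(le_trans (ler_norm _)).
  have [N1 h1] := mx _ e4; have [N2 h2] := my _ e4.
  have [N3 h3] := small x cx (lt_trans xy yd).
  have [N4 h4] := small y (lt_trans cx xy) yd.
  have yx0 : 0 < y - x by lra.
  have [N5 h5] := invn_lt yx0.
  pose n := maxn N1 (maxn N2 (maxn N3 (maxn N4 N5))).
  have [n1 [n2 [n3 [n4 n5]]]] : (N1 <= n /\ N2 <= n /\ N3 <= n /\ N4 <= n /\ N5 <= n)%N.
    by rewrite /n !leq_max !leqnn ?orbT.
  have [xd' {}h1] := h1 n n1; have [yd' {}h2] := h2 n n2.
  have {}h3 := h3 n n3 (ltW xd'); have {}h4 := h4 n n4 (ltW yd').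
  have {}h5 := h5 n n5; have nV := ltV n.
  set k := n.+1%:R^-1 in xd' yd' h3 h4 h5 nV.
  have gk z : iint (fun t => g t * kern n z t) c d.
    by apply: iintM_cont => //; exact: cont_kern.
  have crr : continuous (fun t => ramp n x t - ramp n y t).
    by move=> t; apply: cvgB; exact: cont_ramp.
  have hr : iint (fun t => h t * (ramp n x t - ramp n y t)) c d.
    exact: iintM_cont.
  have := gh n x y cx xy yd'.
  rewrite (@igE _ _ (fun t => g t * kern n x t - g t * kern n y t)); last first.
    by move=> t _; rewrite mulrBr.
  rewrite ig_sub// => E.
  have E2 : `|ig (fun t => h t * (ramp n x t - ramp n y t)) c d - ig h x y|
      <= e / 4 + e / 4.
    apply: le_trans (ramp_window (n := n) hi cx _ yd') (lerD h3 h4).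
    by rewrite -lerBrDl ltW.
  move: h1 h2 E2; move: E.
  set A := ig _ c d; set B := ig _ c d; set C := ig _ c d; set D := ig h x y.
  by move=> E; rewrite !ler_norml => /andP[? ?] /andP[? ?] /andP[? ?]; apply/andP; split; lra.
have [x0 /andP[cx0 x0d] m0] := ae_ex cd (mollifies_ae gi).
have {}m0 := m0 ltac:(by rewrite /= in_itv/= cx0 x0d).
exists (g x0 - ig h c x0).
apply: aeS (mollifies_ae gi) => x mx xcd; have {}mx := mx xcd.
have [cx xd] : c < x /\ x < d by move: xcd; rewrite /= in_itv/= => /andP.
have [xx|xx|->] := ltgtP x x0; last by rewrite subrK.
- have := key x x0 cx xx x0d mx m0.
  rewrite (@igD _ h x c x0); [lra|by apply: iintS hi _ _; lra|exact: ltW|exact: ltW].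
- have := key x0 x cx0 xx xd m0 mx.
  rewrite (@igD _ h x0 c x); [lra|by apply: iintS hi _ _; lra|exact: ltW|exact: ltW].
Qed.

(* The defect of the integration by parts formula on [x, y] is additive and
   bounded by C (y - x) \int_x^y |h|, so it vanishes by repeated bisection. *)
Lemma integration_by_parts_primitive (H h psi psi' : R -> R) c d : c <= d -> iint h c d ->
  (forall x y, c <= x -> x <= y -> y <= d -> H y - H x = ig h x y) ->
  (forall t : R, is_derive t (1 : R) psi (psi' t)) -> continuous psi' ->
  ig (fun t => H t * psi' t) c d =
  H d * psi d - H c * psi c - ig (fun t => h t * psi t) c d.
Proof.
move=> cd hi Hh dpsi cpsi'.
have cpsi : continuous psi by exact: is_derive_continuous dpsi.
have Hi : iint H c d.
  apply: (@iintE _ (fun t => H c + ig h c t)).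
    by move=> t /andP[ct td]; rewrite -(Hh c t)//; lra.
  apply: iintD; first exact: iint_cst.
  by apply: cont_iint; exact: ig_cont.
have [M M0 hM] := @cont_bounded psi' c d cpsi'.
pose A x y := ig (fun t => `|h t|) x y.
pose D x y := H y * psi y - H x * psi x - ig (fun t => H t * psi' t) x y
              - ig (fun t => h t * psi t) x y.
have ni : iint (fun t => `|h t|) c d by exact: iint_norm.
have Hpi : iint (fun t => H t * psi' t) c d by exact: iintM_cont.
have hpi : iint (fun t => h t * psi t) c d by exact: iintM_cont.
have Dadd x y z : c <= x -> x <= y -> y <= z -> z <= d -> D x z = D x y + D y z.
  move=> cx xy yz zd; rewrite /D.
  rewrite (@igD _ (fun t => H t * psi' t) y x z)//; last exact: iintS Hpi _ _.
  rewrite (@igD _ (fun t => h t * psi t) y x z)//; last exact: iintS hpi _ _.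
  lra.
have Aadd x y z : c <= x -> x <= y -> y <= z -> z <= d -> A x z = A x y + A y z.
  by move=> cx xy yz zd; rewrite /A (@igD _ _ y x z)//; exact: iintS ni _ _.
have A0 x y : 0 <= A x y by apply: ig_ge0.
have Dle x y : c <= x -> x <= y -> y <= d -> `|D x y| <= 2 * M * (y - x) * A x y.
  move=> cx xy yd.
  have hxy : iint h x y by exact: iintS hi _ _.
  have Hxy : iint H x y by exact: iintS Hi _ _.
  have i1 : iint (fun t => h t * (psi y - psi t)) x y.
    by apply: iintM_cont => // t; apply: cvgB; [exact: cvg_cst|exact: cpsi].
  have i2 : iint (fun t => psi' t * (H t - H x)) x y.
    apply: (@iintE _ (fun t => H t * psi' t - H x * psi' t)).
      by move=> t _; rewrite mulrC mulrBr mulrC [in X in _ - X]mulrC.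
    apply: iintB; first exact: iintM_cont.
    by apply: iintZ; exact: iint_cont.
  have -> : D x y = ig (fun t => h t * (psi y - psi t)) x y
                    - ig (fun t => psi' t * (H t - H x)) x y.
    rewrite (@igE _ (fun t => h t * (psi y - psi t))
      (fun t => psi y * h t - h t * psi t)); last first.
      by move=> t _; rewrite mulrBr [in X in X - _]mulrC.
    rewrite (@igE _ (fun t => psi' t * (H t - H x))
      (fun t => H t * psi' t - H x * psi' t)); last first.
      by move=> t _; rewrite mulrC mulrBl.
    rewrite !ig_sub//;
      [|exact: iintM_cont|by apply: iintZ; exact: iint_cont|exact: iintZ|exact: iintM_cont].
    rewrite !igZ//; last exact: iint_cont.
    by rewrite -Hh// (FTC xy dpsi cpsi') /D; lra.
  have b1 : `|ig (fun t => h t * (psi y - psi t)) x y| <= M * (y - x) * A x y.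
    apply: ig_le_bound => // t /andP[xt ty].
    rewrite -(FTC ty dpsi cpsi').
    apply: (@le_trans _ _ (M * (y - t))); last by rewrite ler_wpM2l//; lra.
    rewrite -ig_cst//; apply: le_trans (ig_norm _) _; first exact: iint_cont.
    apply: le_ig; [by apply: iint_norm; exact: iint_cont|exact: iint_cst|].
    by move=> s /andP[ts sy]; apply: hM; rewrite (le_trans cx) ?(le_trans xt)//= (le_trans sy).
  have b2 : `|ig (fun t => psi' t * (H t - H x)) x y| <= A x y * (M * (y - x)).
    have cp : iint psi' x y by exact: iint_cont.
    apply: (@le_trans _ _ (A x y * ig (fun t => `|psi' t|) x y)).
      apply: ig_le_bound => // t /andP[xt ty].
      rewrite Hh ?(le_trans ty)//; apply: le_trans (ig_norm _) _.
        exact: iintS hxy _ _.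
      by apply: le_igS => //; exact: iintS ni _ _.
    rewrite ler_wpM2l// -ig_cst//.
    apply: le_ig; [exact: iint_norm|exact: iint_cst|].
    by move=> s /andP[ts sy]; apply: hM; rewrite (le_trans cx)//= (le_trans sy).
  apply: le_trans (ler_normB _ _) _; lra.
have Dk k x y : c <= x -> x <= y -> y <= d ->
    `|D x y| <= 2 * M * (y - x) * A x y / 2 ^+ k.
  elim: k x y => [|k IH] x y cx xy yd; first by rewrite expr0 divr1 Dle.
  pose m := (x + y) / 2.
  have [xm my] : x <= m /\ m <= y by rewrite /m; split; lra.
  have h1 := IH x m cx xm (le_trans my yd).
  have h2 := IH m y (le_trans cx xm) my yd.
  rewrite (Dadd x m y)// (Aadd x m y)//; apply: le_trans (ler_normD _ _) _.
  apply: le_trans (lerD h1 h2) _; rewrite exprS.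
  have p0 : (2 : R) ^+ k != 0 by rewrite expf_neq0.
  rewrite -mulrDl invfM mulrA ler_wpM2r ?invr_ge0 ?exprn_ge0//.
  have -> : m - x = (y - x) / 2 by rewrite /m; lra.
  have -> : y - m = (y - x) / 2 by rewrite /m; lra.
  lra.
have D0 : D c d = 0.
  apply/eqP; rewrite -normr_eq0; apply/eqP/le_anti; rewrite normr_ge0 andbT.
  set B := 2 * M * (d - c) * A c d.
  have B0 : 0 <= B by rewrite /B !mulr_ge0// subr_ge0.
  apply/ler_addgt0Pr => e e0; rewrite add0r.
  have [N hN] := invn_lt (e := e / (B + 1)) ltac:(by rewrite divr_gt0//; lra).
  apply: le_trans (Dk N c d (lexx c) cd (lexx d)) _; rewrite -/B.
  have p0 : 0 < (2 : R) ^+ N by rewrite exprn_gt0.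
  rewrite ler_pdivrMr//.
  have : (N.+1%:R : R) <= 2 ^+ N by rewrite -natrX ler_nat ltn_expl.
  have := hN N (leqnn _).
  rewrite ltr_pdivlMr; last by lra.
  rewrite ltr_pdivrMl ?ltr0n// => h1 h2.
  have : N.+1%:R * e <= 2 ^+ N * e by rewrite ler_wpM2r// ltW.
  lra.
by move: D0; rewrite /D; lra.
Qed.

End weak_calculus.

(** * Sobolev functions as chains of primitives *)

Section primitive_chains.
Context {R : realType}.
Implicit Types (u f g h phi : R -> R) (F : nat -> R -> R) (a b x y t c d M e : R).
Implicit Types (n j k : nat).
Local Notation mu := (@lebesgue_measure R).

Lemma iint_le f g x y : measurable_fun `[x, y] f -> iint g x y ->
  (forall t, x <= t <= y -> `|f t| <= g t) -> iint f x y.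
Proof.
move=> mf gi fg; apply: le_integrable gi => //; first exact/measurable_EFinP.
move=> t /=; rewrite in_itv/= => /fg ftg; rewrite lee_fin.
by rewrite (le_trans ftg)// ler_norm.
Qed.

Lemma iint_sqr f x y : measurable_fun `[x, y] f ->
  iint (fun t => f t ^+ 2) x y -> iint f x y.
Proof.
move=> mf f2; apply: (iint_le mf (g := fun t => 1 + f t ^+ 2)).
  by apply: iintD => //; exact: iint_cst.
move=> t _; rewrite -[f t ^+ 2]real_normK ?num_real//.
by have := sqr_ge0 (`|f t| - 1); nra.
Qed.

Lemma L2_iint a b f : L2 `]a, b[ f ->
  [/\ measurable_fun `[a, b] f, iint (fun t => f t ^+ 2) a b & iint f a b].
Proof.
move=> [mf f2].
have mf' : measurable_fun `[a, b] f by exact: (@measurable_fun_itv_cc _ a b false true).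
have fi : iint (fun t => f t ^+ 2) a b by exact: iint_open.
by split => //; exact: iint_sqr.
Qed.

(* [F 0, ..., F n] are successive derivatives on [c, d] in integrated form:
   this encodes the continuous representative of a W^{n,2} function. *)
Definition chain n c d F : Prop :=
  [/\ forall j x y, (j < n)%N -> c <= x -> x <= y -> y <= d ->
        F j y - F j x = ig (F j.+1) x y,
      measurable_fun `[c, d] (F n) &
      iint (fun t => F n t ^+ 2) c d].

Lemma chain_sub n c d F c' d' : chain n c d F -> c <= c' -> d' <= d ->
  chain n c' d' F.
Proof.
move=> [h1 h2 h3] cc dd; split.
- by move=> j x y jn cx xy yd; apply: h1 => //; [exact: le_trans cx|exact: le_trans dd].
- by apply: measurable_funS h2 => //; apply: subset_itvScc; rewrite bnd_simp.
- exact: iintS h3 _ _.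
Qed.

(** Descending induction from order n, where square integrability on a bounded interval gives
    integrability; each lower order is a constant plus a continuous primitive. *)
Lemma chain_iint n c d F j : chain n c d F -> c <= d -> (j <= n)%N -> iint (F j) c d.
Proof.
move=> [h1 h2 h3] cd; move: j.
suff H k : (k <= n)%N -> iint (F (n - k)%N) c d.
  by move=> j jn; rewrite -(subKn jn); apply: H; exact: leq_subr.
elim: k => [_|k IH kn]; first by rewrite subn0; exact: iint_sqr.
have Ek : (n - k)%N = (n - k.+1).+1 by rewrite subnSK.
have := IH (ltnW kn); rewrite Ek => hi.
apply: (@iintE _ (fun t => F (n - k.+1)%N c + ig (F (n - k.+1).+1) c t)).
  have jn : (n - k.+1 < n)%N by rewrite -Ek leq_subr.
  by move=> t /andP[ct td]; rewrite -(h1 _ c t jn (lexx c) ct td) addrC subrK.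
apply: iintD; first exact: iint_cst.
by apply: cont_iint; exact: ig_cont.
Qed.

Lemma chain_cont n c d F j : chain n c d F -> c <= d -> (j < n)%N ->
  {within `[c, d], continuous (F j)}.
Proof.
move=> ch cd jn; have [h1 _ _] := ch.
have hc := ig_cont cd (chain_iint ch cd jn).
have : {within `[c, d], continuous (fun t => F j c + ig (F j.+1) c t)}.
  by move=> t; apply: cvgD; [exact: cvg_cst|exact: hc].
apply: subspace_eq_continuous => t; rewrite inE/= in_itv/= => /andP[ct td].
by rewrite /from_subspace -(h1 j c t jn (lexx c) ct td) addrC subrK.
Qed.

Lemma chain_iint_sqr n c d F j : chain n c d F -> c <= d -> (j <= n)%N ->
  iint (fun t => F j t ^+ 2) c d.
Proof.
move=> ch cd; rewrite leq_eqVlt => /predU1P[->|jn]; first by case: ch.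
have cj := chain_cont ch cd jn.
apply: (@iintE _ (fun t => F j t * F j t)) => [t _|]; first by rewrite expr2.
by apply: iintM_within => //; exact: cont_iint.
Qed.

Lemma eq_chain n c d F G : (forall j t, (j <= n)%N -> c <= t <= d -> F j t = G j t) ->
  chain n c d F -> chain n c d G.
Proof.
move=> FG [h1 h2 h3]; split.
- move=> j x y jn cx xy yd.
  rewrite -!FG ?(ltnW jn)//; [|by rewrite cx (le_trans xy)|by rewrite yd (le_trans cx)].
  rewrite h1//; apply: igE => t /andP[xt ty]; apply: FG => //.
  by rewrite (le_trans cx)// (le_trans ty).
- apply: eq_measurable_fun h2 => t; rewrite inE/= in_itv/= => ctd.
  exact: FG.
- by apply: iintE h3 => t ctd; rewrite FG.
Qed.

Lemma derive1n_is_derive phi k t : (forall k x, derivable (derive1n k phi) x 1) ->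
  is_derive t (1 : R) (derive1n k phi) (derive1n k.+1 phi t).
Proof.
by move=> dphi; apply: DeriveDef; [exact: dphi|rewrite derive1nS derive1E].
Qed.

Lemma derive1nSr phi k : derive1n k.+1 phi = derive1n k (derive1 phi).
Proof. by rewrite /derive1n iterSr. Qed.

Lemma derive1n_continuous phi k : (forall k x, derivable (derive1n k phi) x 1) ->
  continuous (derive1n k phi).
Proof.
move=> dphi; apply: (@is_derive_continuous _ _ (derive1n k.+1 phi)) => t.
exact: derive1n_is_derive.
Qed.

Lemma test_function_derive Omega phi : test_function Omega phi ->
  test_function Omega (derive1 phi).
Proof.
move=> [dphi [K [cK KO K0]]]; split.
  by move=> k x; rewrite -derive1nSr.
exists K; split => // x nKx.
have /(_ x nKx) nbK : open (~` K).
  by apply: closed_openC; apply: compact_closed => //; exact: Rhausdorff.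
rewrite derive1E (@near_eq_derive _ _ _ _ (cst 0)); first by rewrite derive_cst.
near=> y; apply: K0; near: y; exact: nbK.
Unshelve. all: by end_near. Qed.

Lemma test_function_derive1n Omega phi k : test_function Omega phi ->
  test_function Omega (derive1n k phi).
Proof. by move=> tphi; elim: k => [//|k IH]; rewrite derive1nS; exact: test_function_derive. Qed.

Lemma test_function_out c d phi t : test_function `]c, d[ phi ->
  (t <= c) || (d <= t) -> phi t = 0.
Proof.
move=> [_ [K [_ KO K0]]] h; apply: K0 => /KO /=; rewrite in_itv/=; lra.
Qed.

Lemma test_functionS (O1 O2 : set R) phi : O1 `<=` O2 -> test_function O1 phi ->
  test_function O2 phi.
Proof.
move=> O12 [dphi [K [cK KO K0]]]; split => //; exists K; split => //.
exact: subset_trans O12.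
Qed.

Lemma compact_itv (K : set R) : compact K -> exists2 M, 0 < M & K `<=` `]- M, M[.
Proof.
move=> /compact_bounded[M [_ hM]]; exists (`|M| + 2).
  by rewrite ltr_wpDl.
move=> t Kt; have : `|t| <= `|M| + 1.
  by apply: hM => //; rewrite (le_lt_trans (ler_norm M))// ltrDl.
by rewrite /= in_itv/= ler_norml; lra.
Qed.

Lemma test_functionT phi : test_function setT phi ->
  exists2 M, 0 < M & test_function `]- M, M[ phi.
Proof.
move=> [dphi [K [cK KO K0]]]; have [M M0 KM] := compact_itv cK.
by exists M => //; split => //; exists K.
Qed.

Lemma kern_test n x c d : c < x -> x + n.+1%:R^-1 < d -> test_function `]c, d[ (kern n x).
Proof.
move=> cx xd; split.
  by move=> k t; apply: smooth_class_derivable; exact: smooth_kern.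
exists `[x, x + n.+1%:R^-1]%classic; split; first exact: segment_compact.
  move=> t /=; rewrite !in_itv/= => /andP[xt tx].
  by rewrite (lt_le_trans cx xt) (le_lt_trans tx xd).
move=> t nt; apply: kern_out; move: nt; rewrite /= in_itv/= => /negP.
by rewrite negb_and -!ltNge => /orP[/ltW ->//|/ltW ->]; rewrite orbT.
Qed.

Lemma ramp_test n x y c d : c < x -> x < y -> y + n.+1%:R^-1 < d ->
  test_function `]c, d[ (fun t => ramp n x t - ramp n y t) /\
  derive1 (fun t => ramp n x t - ramp n y t) = (fun t => kern n x t - kern n y t).
Proof.
move=> cx xy yd; split; last first.
  by apply: is_derive_derive1 => t; apply: is_deriveB; exact: ramp_derive.
split.
  move=> k t; apply: smooth_class_derivable.
  have -> : (fun t => ramp n x t - ramp n y t) = (fun t => ramp n x t + -1 * ramp n y t).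
    by apply/funext => s; rewrite mulN1r.
  by apply: smooth_add; [|apply: smooth_scale]; exact: smooth_ramp.
exists `[x, y + n.+1%:R^-1]%classic; split; first exact: segment_compact.
  move=> t /=; rewrite !in_itv/= => /andP[xt ty].
  by rewrite (lt_le_trans cx xt) (le_lt_trans ty yd).
move=> t nt; move: nt; rewrite /= in_itv/= => /negP.
rewrite negb_and -!ltNge => /orP[tx|yt].
  by rewrite !ramp0 ?subrr// ltW// (lt_trans tx).
by rewrite !ramp1 ?subrr// ?(ltW yt)// (le_trans _ (ltW yt))// lerD2r ltW.
Qed.

Lemma Rintegral_supp (D : set R) f c d : `[c, d]%classic `<=` D ->
  (forall t, D t -> (t <= c) || (d <= t) -> f t = 0) -> \int[mu]_(t in D) f t = ig f c d.
Proof.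
move=> cD f0; rewrite /ig Rintegral_mkcond [RHS]Rintegral_mkcond.
apply: eq_Rintegral => t _; rewrite !patchE.
case: ifPn => [/set_mem Dt|nD]; case: ifPn => [/set_mem//|nt].
- transitivity (0 : R) => //; apply: f0 => //; move: nt; rewrite notin_setE /= in_itv/= => /negP.
  by rewrite negb_and -!ltNge => /orP[/ltW ->//|/ltW ->]; rewrite orbT.
- by move=> /cD /mem_set; rewrite (negbTE nD).
- by [].
Qed.

Lemma loc_integrable_iint Omega f c d : locally_integrable Omega f ->
  `[c, d]%classic `<=` Omega -> iint f c d.
Proof.
move=> [mf oO fK] cO; apply/integrableP; split.
  by apply/measurable_EFinP; apply: measurable_funS mf => //; exact: open_measurable.
by apply: fK => //; exact: segment_compact.
Qed.

(** On a compact subinterval both functions are integrable and the kernels are test functions, so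
    [weak_zero] applies to the difference. Bounded open intervals and the whole line are both
    exhausted by such subintervals. *)
Lemma weak_unique_sub Omega j u g h c d : `[c, d]%classic `<=` Omega ->
  is_weak_derivative Omega j u g -> is_weak_derivative Omega j u h ->
  {ae mu, forall t, `]c, d[%classic t -> g t = h t}.
Proof.
move=> cO [_ lg wg] [_ lh wh].
have gi := loc_integrable_iint lg cO; have hi := loc_integrable_iint lh cO.
have : {ae mu, forall t, `]c, d[%classic t -> (fun t => g t - h t) t = 0}.
  apply: weak_zero; first exact: iintB.
  move=> n x cx xd; have tk := kern_test cx xd.
  have tO : test_function Omega (kern n x).
    by apply: test_functionS tk => t ct; apply: cO; exact: subset_itv_oo_cc ct.
  have ck : continuous (kern n x) by exact: cont_kern.
  rewrite (@igE _ _ (fun t => g t * kern n x t - h t * kern n x t)); last first.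
    by move=> t _; rewrite mulrBl.
  rewrite ig_sub; [|exact: iintM_cont|exact: iintM_cont].
  have E f : \int[mu]_(t in Omega) (f t * kern n x t) = ig (fun t => f t * kern n x t) c d.
    apply: Rintegral_supp => // t _ tc.
    by rewrite (test_function_out tk)// mulr0.
  have := wg _ tO; rewrite wh// !E => /(mulfI _); rewrite signr_eq0 => /(_ erefl) ->.
  by rewrite subrr.
by apply: aeS => t gh /gh /eqP; rewrite subr_eq0 => /eqP.
Qed.

Lemma weak_unique_itv a b j u g h : is_weak_derivative `]a, b[ j u g ->
  is_weak_derivative `]a, b[ j u h ->
  {ae mu, forall t, `]a, b[%classic t -> g t = h t}.
Proof.
move=> wg wh.
have H k : {ae mu, forall t, `]a + k.+1%:R^-1, b - k.+1%:R^-1[%classic t -> g t = h t}.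
  apply: (weak_unique_sub _ wg wh) => t /=; rewrite !in_itv/= => /andP[h1 h2].
  have q0 : 0 < k.+1%:R^-1 :> R by [].
  by rewrite (lt_le_trans _ h1) ?ltrDl// (le_lt_trans h2)// gtrBl.
have := ae_foralln H; apply: aeS => t gh; rewrite /= in_itv/= => /andP[at0 tb].
have [k k1 k2] := @small_inv2 R (t - a) (b - t) ltac:(lra) ltac:(lra).
by apply: (gh k); rewrite /= in_itv/= -ltrBrDl k1 ltrBrDl -ltrBrDr.
Qed.

Lemma weak_unique_setT j u g h : is_weak_derivative setT j u g ->
  is_weak_derivative setT j u h -> {ae mu, forall t, g t = h t}.
Proof.
move=> wg wh.
have H k : {ae mu, forall t, `]- k%:R, k%:R[%classic t -> g t = h t}.
  by apply: (weak_unique_sub _ wg wh) => t.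
have := ae_foralln H; apply: aeS => t gh.
apply: (gh (Num.truncn `|t|).+1); rewrite /= in_itv/= -ltr_norml.
exact: truncnS_gt.
Qed.

(** Descending induction on the order: a chain whose [F 0] represents the weak derivative of order n
    - m is lengthened by one primitive. Order k tested with phi' and order k + 1 tested with phi
    show that the integral of g_k phi' is the opposite of that of g_(k+1) phi; with phi a difference
    of ramps this is the hypothesis of [weak_primitive]. *)
Lemma sobolev_chain n a b u : a < b -> sobolev n `]a, b[ u ->
  exists F, chain n a b F /\ {ae mu, forall t, `]a, b[%classic t -> u t = F 0%N t}.
Proof.
move=> ab [Lu wu].
have lu : locally_integrable `]a, b[ u.
  apply: open_integrable_locally; first exact: itv_open.
  by have [_ _] := L2_iint Lu; apply: integrableS => //; exact: subset_itv_oo_cc.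
have [g hg] : exists g : nat -> R -> R, forall j, (j <= n)%N ->
    is_weak_derivative `]a, b[ j u (g j) /\ L2 `]a, b[ (g j).
  have H j : exists g, (j <= n)%N -> is_weak_derivative `]a, b[ j u g /\ L2 `]a, b[ g.
    case: j => [|j].
      by exists u => _; split => //; split => // phi _; rewrite expr0 mul1r.
    have [jn|] := boolP (j.+1 <= n)%N; last by exists u.
    by have [g g1 g2] := wu j.+1 jn; exists g.
  by have [g hg] := choice H; exists g.
have gi j : (j <= n)%N -> iint (g j) a b by move=> /hg[_ /L2_iint[]].
suff H m : (m <= n)%N -> exists F, chain m a b F /\
    {ae mu, forall t, `]a, b[%classic t -> g (n - m)%N t = F 0%N t}.
  have [F [ch ae0]] := H n (leqnn n); exists F; split => //.
  (* [g 0] is known only as a weak derivative of order 0 of [u]; uniqueness identifies the two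
     almost everywhere. *)
  have [w0 _] := hg 0%N (leq0n n).
  have wu0 : is_weak_derivative `]a, b[ 0 u u.
    by split => // phi _; rewrite expr0 mul1r.
  apply: aeS (aeI ae0 (weak_unique_itv w0 wu0)); rewrite subnn => t [h1 h2] tab.
  by rewrite -h1// h2.
elim: m => [_|m IH mn].
  have [_ /L2_iint[m1 m2 m3]] := hg n (leqnn n).
  exists (fun=> g n); split; last by rewrite subn0; exact: aeW.
  by split.
have [F [ch aeF]] := IH (ltnW mn).
set k := (n - m.+1)%N.
have Ek : (n - m)%N = k.+1 by rewrite /k subnSK.
have kn : (k < n)%N by rewrite -Ek leq_subr.
have Fi : iint (F 0%N) a b by apply: chain_iint ch (ltW ab) _.
have [wk _] := hg k (ltnW kn); have [wk1 _] := hg k.+1 kn.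
have [k0 hk0] : exists k0 : R, {ae mu, forall t, `]a, b[%classic t -> g k t = k0 + ig (F 0%N) a t}.
  apply: weak_primitive => //; first exact: gi (ltnW kn).
  move=> i x y ax xy yb; have [tphi dphi] := ramp_test ax xy yb.
  pose phi t := ramp i x t - ramp i y t.
  have -> : ig (fun t => g k t * (kern i x t - kern i y t)) a b =
      ig (fun t => g k t * derive1 phi t) a b by rewrite /phi dphi.
  have [_ _ /(_ _ (test_function_derive tphi)) h1] := wk.
  have [_ _ /(_ _ tphi) h2] := wk1.
  have E f psi : iint f a b -> test_function `]a, b[ psi ->
      \int[mu]_(t in `]a, b[) (f t * psi t) = ig (fun t => f t * psi t) a b.
    move=> fi [dpsi _]; rewrite ig_open//; apply: iintM_cont => //.
    exact: (derive1n_continuous (k := 0) dpsi).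
  move: h2; rewrite derive1nSr h1 exprS mulN1r mulNr -mulrN => /(mulfI _).
  rewrite signr_eq0 => /(_ erefl); rewrite !E//; last 3 first.
  - exact: gi.
  - exact: gi (ltnW kn).
  - exact: test_function_derive.
  move=> ->; congr (- _); apply: ig_ae.
  - by rewrite -Ek; apply: aeS aeF => t h /h ->.
  - apply: measurable_funS (iint_measurable (_ : iint (fun t => g k.+1 t * phi t) a b)) => //.
      exact: subset_itv_oo_cc.
    apply: iintM_cont; first exact: gi.
    by case: tphi => d _; exact: (derive1n_continuous (k := 0) d).
  - apply: measurable_funS (iint_measurable (_ : iint (fun t => F 0%N t * phi t) a b)) => //.
      exact: subset_itv_oo_cc.
    apply: iintM_cont => //.
    by case: tphi => d _; exact: (derive1n_continuous (k := 0) d).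
exists (fun j => if j is i.+1 then F i else fun t => k0 + ig (F 0%N) a t); split => //.
have [c1 c2 c3] := ch; split => //.
move=> [|j] x y jm ax xy yb; last exact: c1.
rewrite (@igD _ _ x a y)//; [lra|exact: iintS Fi _ _].
Qed.

Lemma chain_test n a b F phi j : a <= b -> chain n a b F -> (j <= n)%N ->
  test_function `]a, b[ phi ->
  ig (fun t => F 0%N t * derive1n j phi t) a b = (-1) ^+ j * ig (fun t => F j t * phi t) a b.
Proof.
move=> ab ch; elim: j phi => [|j IH] phi jn tphi; first by rewrite expr0 mul1r.
rewrite derive1nSr (IH _ (ltnW jn) (test_function_derive tphi)).
rewrite exprS mulN1r mulNr -mulrN; congr (_ * _).
have [c1 _ _] := ch; have [dphi _] := tphi.
have h1 : iint (F j.+1) a b by exact: chain_iint ch ab _.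
have h2 x y : a <= x -> x <= y -> y <= b -> F j y - F j x = ig (F j.+1) x y.
  exact: c1.
have h3 (t : R) : is_derive t (1 : R) phi (derive1 phi t).
  exact: (@derive1n_is_derive phi 0 t dphi).
have h4 : continuous (derive1 phi) by exact: (derive1n_continuous (k := 1) dphi).
rewrite (integration_by_parts_primitive ab h1 h2 h3 h4).
rewrite (test_function_out (t := a) tphi) ?lexx//.
by rewrite (test_function_out (t := b) tphi) ?lexx ?orbT// !mulr0 subrr sub0r.
Qed.

Lemma chain_L2 n a b F j : a < b -> chain n a b F -> (j <= n)%N -> L2 `]a, b[ (F j).
Proof.
move=> ab ch jn; split.
  apply: measurable_funS (iint_measurable (chain_iint ch (ltW ab) jn)) => //.
  exact: subset_itv_oo_cc.
apply: integrableS (chain_iint_sqr ch (ltW ab) jn) => //.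
exact: subset_itv_oo_cc.
Qed.

Lemma L2_loc_integrable a b f : L2 `]a, b[ f -> locally_integrable `]a, b[ f.
Proof.
move=> /L2_iint[_ _ fi]; apply: open_integrable_locally; first exact: itv_open.
by apply: integrableS fi => //; exact: subset_itv_oo_cc.
Qed.

Lemma chain_weak_derivative n a b F u j : a < b -> chain n a b F ->
  L2 `]a, b[ u -> {ae mu, forall t, `]a, b[%classic t -> u t = F 0%N t} ->
  (j <= n)%N -> is_weak_derivative `]a, b[ j u (F j).
Proof.
move=> ab ch Lu uF jn; split; first exact: L2_loc_integrable.
  by apply: L2_loc_integrable; exact: chain_L2 ch jn.
move=> phi tphi; have [mu' _ ui] := L2_iint Lu.
have [dphi _] := tphi; have cphi k := derive1n_continuous (k := k) dphi.
have Fj k : (k <= n)%N -> iint (F k) a b by exact: chain_iint ch (ltW ab).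
rewrite -ig_open; last exact: iintM_cont.
rewrite -ig_open; last by apply: iintM_cont; [exact: Fj|exact: (cphi 0%N)].
rewrite -(chain_test (ltW ab) ch jn tphi); apply: ig_ae.
- by apply: aeS uF => t h /h ->.
- apply: measurable_funS (iint_measurable (_ : iint (fun t => u t * derive1n j phi t) a b)) => //.
    exact: subset_itv_oo_cc.
  exact: iintM_cont.
- apply: measurable_funS
    (iint_measurable (_ : iint (fun t => F 0%N t * derive1n j phi t) a b)) => //.
    exact: subset_itv_oo_cc.
  by apply: iintM_cont => //; exact: Fj.
Qed.

Lemma chain_sobolev n a b F u : a < b -> chain n a b F ->
  L2 `]a, b[ u -> {ae mu, forall t, `]a, b[%classic t -> u t = F 0%N t} ->
  sobolev n `]a, b[ u.
Proof.
move=> ab ch Lu uF; split => // j /andP[_ jn]; exists (F j).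
  exact: chain_weak_derivative ch Lu uF jn.
exact: chain_L2 ch jn.
Qed.

Lemma weak_derivativeP Omega j u g : is_weak_derivative Omega j u g ->
  is_weak_derivative Omega j u (weak_derivative Omega j u).
Proof.
move=> wg; rewrite /weak_derivative.
by apply: (@xgetPex _ _ [set h | is_weak_derivative Omega j u h]); exists g.
Qed.

Lemma chain_weak_derivative_ae n a b F u j : a < b -> chain n a b F ->
  L2 `]a, b[ u -> {ae mu, forall t, `]a, b[%classic t -> u t = F 0%N t} ->
  (j <= n)%N ->
  measurable_fun `]a, b[ (weak_derivative `]a, b[ j u) /\
  {ae mu, forall t, `]a, b[%classic t -> weak_derivative `]a, b[ j u t = F j t}.
Proof.
move=> ab ch Lu uF jn.
have wF := chain_weak_derivative ab ch Lu uF jn.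
have wW := weak_derivativeP wF; split; first by case: wW => _ [].
exact: weak_unique_itv wW wF.
Qed.

End primitive_chains.

(** * Hermite interpolation between prescribed derivatives at 0 and zero at 1 *)

Section hermite.
Context {R : realType}.
Implicit Types (p q : {poly R}) (n i j k : nat) (A : nat -> R) (s t : R).

(* The j-th element is (t^j / j!) (1 - t^n)^n: its derivatives of order < n are
   those of t^j / j! at t = 0, and vanish at t = 1. *)
Definition hermite_basis n j : {poly R} :=
  (j`!%:R)^-1 *: ('X^j * (1 - 'X^n) ^+ n).

Definition hermite n A : {poly R} := \sum_(j < n) A j *: hermite_basis n j.

Lemma coef_1subXn_exp n k m : (m < n)%N ->
  ((1 - 'X^n) ^+ k : {poly R})`_m = (m == 0)%:R.
Proof.
move=> mn; have [r ->] : exists r : {poly R}, (1 - 'X^n) ^+ k = 1 + 'X^n * r.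
  elim: k => [|k [r IH]]; first by exists 0; rewrite mulr0 addr0 expr0.
  by exists (r - (1 + 'X^n * r)); rewrite exprS IH; ring.
by rewrite coefD coefXnM mn addr0 coef1.
Qed.

Lemma hermite_basis0 n i j : (i < n)%N ->
  (derivn i (hermite_basis n j)).[0] = (i == j)%:R.
Proof.
move=> ilt; rewrite horner_coef0 coef_derivn addn0 coefZ coefXnM ffactnn.
case: ltngtP => [ij|ji|->].
- by rewrite mulr0 mul0rn.
- rewrite coef_1subXn_exp; last exact: leq_ltn_trans (leq_subr _ _) ilt.
  by rewrite subn_eq0 leqNgt ji/= mulr0 mul0rn.
- rewrite subnn coef_1subXn_exp ?(leq_ltn_trans _ ilt)// mulr1 -[X in X = _]mulr_natr.
  by rewrite mulVf// pnatr_eq0 -lt0n fact_gt0.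
Qed.

Lemma derivn_root k p i : (i < k)%N -> (derivn i (('X - 1%:P) ^+ k * p)).[1] = 0.
Proof.
elim: i k p => [|i IH] k p ik.
  by rewrite derivn0 hornerM horner_exp hornerXsubC subrr expr0n gtn_eqF// mul0r.
case: k ik => // k ik; rewrite derivSn derivM deriv_exp derivB derivX derivC subr0 mul1r /=.
have -> : ('X - 1%:P) ^+ k *+ k.+1 * p + ('X - 1%:P) ^+ k.+1 * p^`() =
          ('X - 1%:P) ^+ k * (p *+ k.+1 + ('X - 1%:P) * p^`()).
  by rewrite exprS mulrDr mulrnAl mulrnAr mulrA [_ ^+ k * ('X - _)]mulrC.
exact: IH.
Qed.

(** 1 - X^n vanishes at 1, so its n-th power makes 1 a root of multiplicity at least n. *)
Lemma hermite_basis1 n i j : (i < n)%N -> (derivn i (hermite_basis n j)).[1] = 0.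
Proof.
move=> ilt; have [r ->] : exists r, hermite_basis n j = ('X - 1%:P) ^+ n * r.
  exists ((j`!%:R)^-1 *: ('X^j * (- \sum_(l < n) 'X^l) ^+ n)).
  rewrite -scalerAr /hermite_basis; congr (_ *: _); rewrite mulrCA -exprMn; congr (_ * _ ^+ _).
  have := subrX1 ('X : {poly R}) n; rewrite polyC1 => e.
  by rewrite mulrN -e opprB.
exact: derivn_root.
Qed.

Lemma horner_derivn_hermite n A i t :
  (derivn i (hermite n A)).[t] =
  \sum_(j < n) A j * (derivn i (hermite_basis n j)).[t].
Proof.
rewrite /hermite raddf_sum horner_sum; apply: eq_bigr => j _.
by rewrite /= derivnZ hornerZ.
Qed.

Lemma hermite0 n A i : (i < n)%N -> (derivn i (hermite n A)).[0] = A i.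
Proof.
move=> ilt; rewrite horner_derivn_hermite (bigD1 (Ordinal ilt))//=.
rewrite hermite_basis0// eqxx mulr1 big1 ?addr0// => j ji.
rewrite hermite_basis0// [i == j]negbTE ?mulr0//.
by move: ji; apply: contra => /eqP ij; apply/eqP/val_inj.
Qed.

Lemma hermite1 n A i : (i < n)%N -> (derivn i (hermite n A)).[1] = 0.
Proof.
by move=> ilt; rewrite horner_derivn_hermite big1// => j _; rewrite hermite_basis1 ?mulr0.
Qed.

Lemma continuous_horner p : continuous (horner p).
Proof. exact: is_derive_continuous (is_derive_poly p). Qed.

Lemma hermite_bound n i : exists2 B : R, 0 < B & forall A (sg : R), 0 <= sg ->
  (forall j, (j < n)%N -> `|A j| <= sg) ->
  forall t, 0 <= t <= 1 -> `|(derivn i (hermite n A)).[t]| <= sg * B.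
Proof.
have [b hb] : exists b : nat -> R, forall j, 0 <= b j /\
    forall t, 0 <= t <= 1 -> `|(derivn i (hermite_basis n j)).[t]| <= b j.
  have H j : exists b : R, 0 <= b /\
      forall t, 0 <= t <= 1 -> `|(derivn i (hermite_basis n j)).[t]| <= b.
    have [M M0 hM] := @cont_bounded R (horner (derivn i (hermite_basis n j))) 0 1
      (@continuous_horner _).
    by exists M.
  by have [b hb] := choice H; exists b.
(* The summand 1 makes the constant positive, since it serves as a denominator in
   [hermite_small]. *)
exists (1 + \sum_(j < n) b j).
  by rewrite ltr_pwDl// sumr_ge0// => j _; have [] := hb j.
move=> A sg sg0 hA t t01; rewrite horner_derivn_hermite.
apply: le_trans (ler_norm_sum _ _ _) _.
apply: (@le_trans _ _ (\sum_(j < n) sg * b j)).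
  apply: ler_sum => j _; rewrite normrM; have [b0 hbj] := hb j.
  by apply: ler_pM => //; [exact: hA|exact: hbj].
by rewrite -mulr_sumr ler_wpM2l// lerDr.
Qed.

(** The interpolant depends linearly on its data, hence is uniformly small together with its
    derivative of order n; continuity of W at its zero s does the rest. *)
Lemma hermite_small (W : R -> R) n s (kap : R) : continuous W -> W s = 0 -> 0 < kap ->
  exists2 sg : R, 0 < sg & forall A, (forall j, (j < n)%N -> `|A j| <= sg) ->
  forall t, 0 <= t <= 1 ->
    W (s + (hermite n A).[t]) + (derivn n (hermite n A)).[t] ^+ 2 <= kap.
Proof.
move=> cW Ws k0; have k2 : 0 < kap / 2 by lra.
have [B0 B0p h0] := hermite_bound n 0; have [Bn Bnp hn] := hermite_bound n n.
have /cvgrPdist_le/(_ _ k2)[r /= r0 hr] := cW s.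
(* With e <= 1, a derivative of size at most e has square at most e <= kap / 2. *)
pose e := Num.min 1 (kap / 2).
have e0 : 0 < e by rewrite /e lt_min ltr01.
have [e1 ek] : e <= 1 /\ e <= kap / 2 by rewrite /e !ge_min !lexx orbT.
exists (Num.min (r / 2 / B0) (e / Bn)).
  by rewrite lt_min !divr_gt0.
set sg := Num.min _ _; move=> A hA t t01.
have sg0 : 0 <= sg by rewrite le_min !divr_ge0// ltW// divr_gt0.
have b0 := h0 A sg sg0 hA t t01; have bn := hn A sg sg0 hA t t01.
have s0 : sg * B0 <= r / 2.
  by rewrite -ler_pdivlMr// /sg ge_min lexx.
have sn : sg * Bn <= e.
  by rewrite -ler_pdivlMr// /sg ge_min lexx orbT.
have hW : W (s + (hermite n A).[t]) <= kap / 2.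
  have := hr (s + (hermite n A).[t]); rewrite /= opprD addrA subrr sub0r normrN Ws sub0r normrN.
  move=> H; apply: le_trans (ler_norm _) (H _).
  by apply: le_lt_trans b0 _; apply: le_lt_trans s0 _; lra.
have hd : (derivn n (hermite n A)).[t] ^+ 2 <= kap / 2.
  rewrite -[(derivn n (hermite n A)).[t] ^+ 2]real_normK ?num_real//.
  have n0 := normr_ge0 (derivn n (hermite n A)).[t].
  have n1 := le_trans bn sn.
  move: (`|(derivn n (hermite n A)).[t]|) n0 n1 => z z0 z1.
  by apply: le_trans ek; nra.
by lra.
Qed.

End hermite.

(** * Scaling, reflection and gluing of chains; chains on the whole line *)

Section chain_operations.
Context {R : realType}.
Implicit Types (u f g h : R -> R) (F G : nat -> R -> R) (p : {poly R}).
Implicit Types (a b x y t c d M e : R) (n j k : nat).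
Local Notation mu := (@lebesgue_measure R).

Lemma chain_affine n al be c d F : 0 < al -> c <= d ->
  chain n (al * c + be) (al * d + be) F ->
  chain n c d (fun j t => al ^+ j * F j (al * t + be)).
Proof.
move=> al0 cd ch.
have mono x y : x <= y -> al * x + be <= al * y + be by move=> xy; rewrite lerD2r ler_pM2l.
have Fi j : (j <= n)%N -> iint (F j) (al * c + be) (al * d + be).
  by apply: chain_iint => //; exact: mono.
have [h1 h2 h3] := ch; split.
- move=> j x y jn cx xy yd.
  have fi : iint (F j.+1) (al * x + be) (al * y + be).
    by apply: iintS (Fi j.+1 jn) _ _; exact: mono.
  have [fi' fe] := ig_affine al0 fi.
  rewrite igZ// fe -mulrBr h1//; [|exact: mono|exact: mono|exact: mono].
  by rewrite exprS; field; rewrite gt_eqF.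
- have [fi _] := ig_affine al0 (Fi n (leqnn n)).
  by apply: (@iint_measurable _ _ c d); exact: iintZ.
- have [fi _] := ig_affine al0 h3.
  apply: (@iintE _ (fun t => (al ^+ n) ^+ 2 * F n (al * t + be) ^+ 2)).
    by move=> t _; rewrite exprMn.
  exact: iintZ.
Qed.

Lemma chain_opp n c d F : c <= d -> chain n (- d) (- c) F ->
  chain n c d (fun j t => (-1) ^+ j * F j (- t)).
Proof.
move=> cd ch; have cd' : - d <= - c by rewrite lerN2.
have Fi j : (j <= n)%N -> iint (F j) (- d) (- c) by exact: chain_iint.
have [h1 h2 h3] := ch; split.
- move=> j x y jn cx xy yd.
  have fi : iint (F j.+1) (- y) (- x).
    by apply: iintS (Fi j.+1 jn) _ _; rewrite lerN2.
  have [fi' fe] := ig_opp fi.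
  rewrite igZ// fe -mulrBr -h1// ?lerN2// exprS; ring.
- have [fi _] := ig_opp (Fi n (leqnn n)).
  by apply: (@iint_measurable _ _ c d); exact: iintZ.
- have [fi _] := ig_opp h3.
  apply: (@iintE _ (fun t => F n (- t) ^+ 2)) => // t _.
  by rewrite exprMn sqrr_sign mul1r.
Qed.

Lemma igE_oo f g x y : (forall t, x < t < y -> f t = g t) -> iint f x y ->
  iint g x y /\ ig f x y = ig g x y.
Proof.
move=> fg fi.
have fo : mu.-integrable `]x, y[ (EFin \o f).
  by apply: integrableS fi => //; exact: subset_itv_oo_cc.
have gi : iint g x y.
  apply: iint_open; apply: eq_integrable fo => // t.
  by rewrite inE/= in_itv/= => /fg ->.
split => //; rewrite !ig_open//; apply: eq_Rintegral => t.
by rewrite inE/= in_itv/= => /fg.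
Qed.

Definition glue (m : R) F G j t := if t <= m then F j t else G j t.

(** Only orders below n have to match at m: the top order enters through integrals alone, which do
    not see the value chosen at the single point m. *)
Lemma chain_glue n c m d F G : c <= m -> m <= d -> chain n c m F -> chain n m d G ->
  (forall j, (j < n)%N -> F j m = G j m) -> chain n c d (glue m F G).
Proof.
move=> cm md cF cG FG.
have cF' : chain n c m (glue m F G).
  by apply: eq_chain cF => j t _ /andP[_ tm]; rewrite /glue tm.
have eG j t : m < t -> G j t = glue m F G j t.
  by move=> mt; rewrite /glue leNgt mt.
have gm j : (j < n)%N -> glue m F G j m = G j m by move=> jn; rewrite /glue lexx FG.
have [g1 g2 g3] := cG.
have cG' : chain n m d (glue m F G).
  split.
  + move=> j x y jn mx xy yd.
    have e z : m <= z -> glue m F G j z = G j z.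
      by rewrite le_eqVlt => /predU1P[<-|mz]; [exact: gm|rewrite -eG].
    rewrite !e ?(le_trans mx)// g1//.
    have Gi : iint (G j.+1) x y by apply: iintS (chain_iint cG md jn) _ _.
    have [] := @igE_oo (G j.+1) (glue m F G j.+1) x y _ Gi => //.
    by move=> t /andP[xt _]; rewrite eG// (le_lt_trans mx).
  + have Gi := chain_iint cG md (leqnn n).
    have [|gi _] := @igE_oo (G n) (glue m F G n) m d _ Gi.
      by move=> t /andP[mt _]; rewrite eG.
    exact: iint_measurable gi.
  + have [] // := @igE_oo _ (fun t => glue m F G n t ^+ 2) m d _ g3.
    by move=> t /andP[mt _]; rewrite eG.
have [f1 f2 f3] := cF'; have [g1' g2' g3'] := cG'.
have Fi j : (j <= n)%N -> iint (glue m F G j) c d.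
  by move=> jn; apply: (iint_cat (y := m)); [exact: chain_iint cF' cm _|exact: chain_iint cG' md _].
split.
- move=> j x y jn cx xy yd.
  have [xm|mx] := leP x m; have [my|ym] := leP m y.
  + rewrite (@igD _ (glue m F G j.+1) m x y)//; last exact: iintS (Fi _ jn) _ _.
    by rewrite -f1// -g1'//; lra.
  + by apply: f1 => //; exact: ltW.
  + by apply: g1' => //; exact: ltW.
  + by move: (lt_le_trans mx xy); rewrite ltNge (ltW ym).
- exact: iint_measurable (Fi n (leqnn n)).
- exact: iint_cat f3 g3'.
Qed.

Lemma chain_poly n p c d : chain n c d (fun j t => (derivn j p).[t]).
Proof.
split.
- move=> j x y _ _ xy _; rewrite (FTC (f := horner (derivn j p)) xy)//.
  exact: continuous_horner.
- exact: iint_measurable (iint_cont c d (@continuous_horner _ (derivn n p))).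
- apply: (@iintE _ (horner (derivn n p ^+ 2))) => [t _|]; first by rewrite horner_exp.
  by apply: iint_cont; exact: continuous_horner.
Qed.

Definition const_chain (s : R) (j : nat) (t : R) : R := if j is 0%N then s else 0.

Lemma chain_const n s c d : chain n c d (const_chain s).
Proof.
apply: eq_chain (chain_poly n s%:P c d) => j t _ _.
case: j => [|j]; first by rewrite derivn0 hornerC.
by rewrite derivnC /= horner0.
Qed.

Lemma horner_derivn_addC s p j t :
  (derivn j (s%:P + p)).[t] = const_chain s j t + (derivn j p).[t].
Proof.
rewrite derivnD hornerD; congr (_ + _).
case: j => [|j]; first by rewrite derivn0 hornerC.
by rewrite derivnC /= horner0.
Qed.

(** The counterpart of W^{n,2}_loc(R): one family of functions that is a chain on every bounded
    interval. *)
Definition gchain n F := forall c d, c < d -> chain n c d F.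

Lemma gchain_measurable n F j : gchain n F -> (j <= n)%N -> measurable_fun setT (F j).
Proof.
move=> gF jn.
have -> : [set: R] = \bigcup_k [set` `[- k.+1%:R, k.+1%:R]].
  apply/esym; rewrite -subTset => t _; exists (Num.truncn `|t|) => //=.
  by rewrite in_itv/= -ler_norml ltW// truncnS_gt.
apply/measurable_fun_bigcup => // k.
have k0 : (0 : R) < k.+1%:R by [].
by apply: iint_measurable; apply: (chain_iint (gF _ _ _)) => //; lra.
Qed.

Lemma gchain_locally_integrable n F j : gchain n F -> (j <= n)%N ->
  locally_integrable setT (F j).
Proof.
move=> gF jn; split; [exact: gchain_measurable gF jn|exact: openT|] => K _ cK.
have [M M0 KM] := compact_itv cK.
have MM : - M < M by lra.
have /integrableP[_] : mu.-integrable K (EFin \o F j); last by [].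
apply: integrableS (chain_iint (gF _ _ MM) (ltW MM) jn) => //.
  exact: compact_measurable.
by apply: subset_trans KM _; exact: subset_itv_oo_cc.
Qed.

Lemma gchain_L2_loc n F j : gchain n F -> (j <= n)%N -> L2_loc setT (F j).
Proof.
move=> gF jn; split => [|K _ cK]; first exact: gchain_measurable gF jn.
have [M M0 KM] := compact_itv cK.
have MM : - M < M by lra.
apply: integrableS (chain_iint_sqr (gF _ _ MM) (ltW MM) jn) => //.
  exact: compact_measurable.
by apply: subset_trans KM _; exact: subset_itv_oo_cc.
Qed.

Lemma gchain_weak_derivative n F u j : gchain n F -> locally_integrable setT u ->
  {ae mu, forall t, u t = F 0%N t} ->
  (j <= n)%N -> is_weak_derivative setT j u (F j).
Proof.
move=> gF lu uF jn; split => //; first exact: gchain_locally_integrable jn.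
move=> phi /test_functionT[M M0 tphi]; have MM : - M < M by lra.
have tphi' := test_function_derive1n j tphi.
have out f psi : test_function `]- M, M[ psi ->
    \int[mu]_(t in setT) (f t * psi t) = ig (fun t => f t * psi t) (- M) M.
  move=> tpsi; apply: Rintegral_supp => // t _ h.
  by rewrite (test_function_out tpsi)// mulr0.
rewrite !out// -(chain_test (ltW MM) (gF _ _ MM) jn tphi).
have ui : iint u (- M) M by exact: loc_integrable_iint lu _.
have cphi : continuous (derive1n j phi) by case: tphi => d _; exact: derive1n_continuous.
apply: ig_ae.
- by apply: aeS uF => t -> _.
- apply: measurable_funS (iint_measurable (iintM_cont ui cphi)) => //.
  exact: subset_itv_oo_cc.
- have Fi := chain_iint (gF _ _ MM) (ltW MM) (leq0n n).
  apply: measurable_funS (iint_measurable (iintM_cont Fi cphi)) => //.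
  exact: subset_itv_oo_cc.
Qed.

Lemma gchain_sobolev_loc n F : gchain n F -> sobolev_loc n setT (F 0%N).
Proof.
move=> gF; split; first exact: gchain_L2_loc gF _.
move=> j /andP[_ jn]; exists (F j); last exact: gchain_L2_loc gF jn.
apply: (gchain_weak_derivative gF _ _ jn); last exact: aeW.
exact: gchain_locally_integrable gF _.
Qed.

Lemma L2_loc_L2 f c d : L2_loc setT f -> L2 `]c, d[ f.
Proof.
move=> [mf fK]; split; first exact: measurable_funTS.
have := fK `[c, d]%classic (@subsetT _ _) (@segment_compact _ _ _).
by apply: integrableS => //; exact: subset_itv_oo_cc.
Qed.

Lemma L2_loc_locally_integrable f : L2_loc setT f -> locally_integrable setT f.
Proof.
move=> Lf; split; [by case: Lf|exact: openT|] => K _ cK.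
have [M M0 KM] := compact_itv cK.
have /L2_iint[_ _ fi] := L2_loc_L2 (- M) M Lf.
have /integrableP[_] : mu.-integrable K (EFin \o f); last by [].
apply: integrableS fi => //; first exact: compact_measurable.
by apply: subset_trans KM _; exact: subset_itv_oo_cc.
Qed.

Lemma sobolev_loc_restrict n f c d : sobolev_loc n setT f -> sobolev n `]c, d[ f.
Proof.
move=> [Lf wf]; split; first exact: L2_loc_L2.
move=> j /wf[g [lf lg wg] Lg]; exists g; last exact: L2_loc_L2.
have fi : iint f c d by exact: loc_integrable_iint lf _.
have gi : iint g c d by exact: loc_integrable_iint lg _.
have fo h : iint h c d -> locally_integrable `]c, d[ h.
  move=> hi; apply: open_integrable_locally; first exact: itv_open.
  by apply: integrableS hi => //; exact: subset_itv_oo_cc.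
split; [exact: fo|exact: fo|] => phi tphi.
have out h psi : iint h c d -> test_function `]c, d[ psi ->
    \int[mu]_(t in `]c, d[) (h t * psi t) = \int[mu]_(t in setT) (h t * psi t).
  move=> hi tpsi; rewrite -ig_open; last first.
    by apply: iintM_cont => //; case: tpsi => dpsi _; exact: (derive1n_continuous (k := 0) dpsi).
  symmetry; apply: Rintegral_supp => // t _ h'.
  by rewrite (test_function_out tpsi)// mulr0.
rewrite !out//; last exact: test_function_derive1n.
by apply: wg; apply: test_functionS tphi.
Qed.

End chain_operations.

(** * Energies and transition profiles *)

Section energy.
Context {R : realType} (n : nat) (W : R -> R) (lam : R).
Hypothesis hn : (2 <= n)%N.
Hypothesis cW : continuous W.
Implicit Types (u f g h : R -> R) (F G : nat -> R -> R).
Implicit Types (a b x y t c d M e eps l : R) (j k : nat).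
Local Notation mu := (@lebesgue_measure R).

Definition dens F t : R := W (F 0%N t) - lam * F n.-1 t ^+ 2 + F n t ^+ 2.
(** The energy density without its negative term, which is what a bound on the energy controls. *)
Definition coer F t : R := W (F 0%N t) + F n t ^+ 2.
Definition dens_eps eps F t : R :=
  eps^-1 * W (F 0%N t) - lam * eps ^+ (2 * n - 3) * F n.-1 t ^+ 2
  + eps ^+ (2 * n - 1) * F n t ^+ 2.

Let n0 : (0 < n)%N. Proof. exact: leq_trans hn. Qed.
Let n1 : (n.-1 < n)%N. Proof. by rewrite prednK. Qed.

Lemma chain_iint_W c d F : chain n c d F -> c <= d -> iint (fun t => W (F 0%N t)) c d.
Proof.
move=> ch cd; have cF := chain_cont ch cd n0; apply: cont_iint => t.
by apply: cvg_comp (cF t) _; exact: cW.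
Qed.

Lemma chain_iint_pred c d F : chain n c d F -> c <= d -> iint (fun t => F n.-1 t ^+ 2) c d.
Proof. by move=> ch cd; apply: chain_iint_sqr ch cd _; exact: ltnW. Qed.

Lemma chain_iint_top c d F : chain n c d F -> iint (fun t => F n t ^+ 2) c d.
Proof. by case. Qed.

Lemma iint_dens c d F : chain n c d F -> c <= d -> iint (dens F) c d.
Proof.
move=> ch cd; apply: iintD; last exact: chain_iint_top.
apply: iintB; first exact: chain_iint_W.
by apply: iintZ; exact: chain_iint_pred.
Qed.

Lemma iint_coer c d F : chain n c d F -> c <= d -> iint (coer F) c d.
Proof. by move=> ch cd; apply: iintD; [exact: chain_iint_W|exact: chain_iint_top]. Qed.

Lemma ig_dens c d F : chain n c d F -> c <= d ->
  ig (dens F) c d = ig (fun t => W (F 0%N t)) c d - lam * ig (fun t => F n.-1 t ^+ 2) c d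
                    + ig (fun t => F n t ^+ 2) c d.
Proof.
move=> ch cd; have i1 := chain_iint_W ch cd; have i2 := chain_iint_pred ch cd.
have i3 := chain_iint_top ch; have i4 : iint (fun t => lam * F n.-1 t ^+ 2) c d by exact: iintZ.
by rewrite /dens ig_add ?ig_sub ?igZ//; exact: iintB.
Qed.

Lemma ig_coer c d F : chain n c d F -> c <= d ->
  ig (coer F) c d = ig (fun t => W (F 0%N t)) c d + ig (fun t => F n t ^+ 2) c d.
Proof.
by move=> ch cd; rewrite /coer ig_add//; [exact: chain_iint_W|exact: chain_iint_top].
Qed.

Lemma integral_ae_ig f g c d : measurable_fun `]c, d[ f ->
  {ae mu, forall t, `]c, d[%classic t -> f t = g t} -> iint g c d ->
  (\int[mu]_(x in `]c, d[) (f x)%:E = (ig g c d)%:E)%E.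
Proof.
move=> mf fg gi; rewrite -integral_ig//; apply: ae_eq_integral => //.
- exact/measurable_EFinP.
- apply/measurable_EFinP; apply: measurable_funS (iint_measurable gi) => //.
  exact: subset_itv_oo_cc.
- by apply: aeS fg => t h /h /= ->.
Qed.

Lemma interpolation_chain l c d F : interpolation_inequality n W l -> c < d ->
  chain n c d F ->
  l * ig (fun t => F n.-1 t ^+ 2) c d <=
  (d - c) ^- (2 * n - 2) * ig (fun t => W (F 0%N t)) c d
  + (d - c) ^+ 2 * ig (fun t => F n t ^+ 2) c d.
Proof.
move=> hl cd ch; have cd' := ltW cd.
have L0 : L2 `]c, d[ (F 0%N) by exact: chain_L2 ch _.
have ae0 : {ae mu, forall t, `]c, d[%classic t -> F 0%N t = F 0%N t} by exact: aeW.
have sF := chain_sobolev cd ch L0 ae0.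
have [m1 e1] := chain_weak_derivative_ae cd ch L0 ae0 (ltnW n1).
have [m2 e2] := chain_weak_derivative_ae cd ch L0 ae0 (leqnn n).
have := hl c d (F 0%N) cd sF.
rewrite (@integral_ae_ig (fun t => weak_derivative `]c, d[ n.-1 (F 0%N) t ^+ 2)
  (fun t => F n.-1 t ^+ 2)); last 3 first.
- exact: measurable_funX.
- by apply: aeS e1 => t h /h ->.
- exact: chain_iint_pred.
rewrite (@integral_ae_ig (fun t => weak_derivative `]c, d[ n (F 0%N) t ^+ 2)
  (fun t => F n t ^+ 2)); last 3 first.
- exact: measurable_funX.
- by apply: aeS e2 => t h /h ->.
- exact: chain_iint_top.
by rewrite (integral_ig (chain_iint_W ch cd')) -!EFinM -EFinD lee_fin.
Qed.

Lemma G_eps_chain eps a b u F : a < b -> chain n a b F -> L2 `]a, b[ u ->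
  {ae mu, forall t, `]a, b[%classic t -> u t = F 0%N t} ->
  G_eps n W lam `]a, b[ eps u = (ig (dens_eps eps F) a b)%:E.
Proof.
move=> ab ch Lu uF; have ab' := ltW ab.
have su := chain_sobolev ab ch Lu uF.
rewrite /G_eps asboolT//.
have [m1 e1] := chain_weak_derivative_ae ab ch Lu uF (ltnW n1).
have [m2 e2] := chain_weak_derivative_ae ab ch Lu uF (leqnn n).
apply: integral_ae_ig.
- have [mu' _] := Lu; apply: measurable_funD; last first.
    by apply: measurable_funM => //; exact: measurable_funX.
  apply: measurable_funB; apply: measurable_funM => //; last exact: measurable_funX.
  by apply: measurableT_comp => //; exact: continuous_measurable_fun.
- by apply: aeS (aeI uF (aeI e1 e2)) => t [h0 [h1 h2]] tab; rewrite h0// h1// h2.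
- apply: iintD; last by apply: iintZ; exact: chain_iint_top.
  by apply: iintB; apply: iintZ; [exact: chain_iint_W|exact: chain_iint_pred].
Qed.

(** The blow-up t -> F(eps t) with its derivatives; the summand 0 matches the affine change of
    variables with zero offset. *)
Definition scaled eps F j t : R := eps ^+ j * F j (eps * t + 0).

Lemma dens_scaled eps F t : eps != 0 ->
  dens (scaled eps F) t = eps * dens_eps eps F (eps * t + 0).
Proof.
move=> e0; rewrite /dens /dens_eps /scaled expr0 mul1r !exprMn -!exprM.
(* Writing n as [m.+2] resolves the truncated subtractions: 2 (n - 1) and 2 n exceed the exponents 2
   n - 3 and 2 n - 1 by one, which is the Jacobian factor eps. *)
case: n hn => [//|[//|m]] _ /=.
have -> : (m.+1 * 2 = (2 * m.+2 - 3).+1)%N by lia.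
have -> : (m.+2 * 2 = (2 * m.+2 - 1).+1)%N by lia.
by rewrite !exprS; field.
Qed.

Lemma iint_dens_eps eps c d F : chain n c d F -> c <= d -> iint (dens_eps eps F) c d.
Proof.
move=> ch cd; apply: iintD; last by apply: iintZ; exact: chain_iint_top.
by apply: iintB; apply: iintZ; [exact: chain_iint_W|exact: chain_iint_pred].
Qed.

Lemma ig_dens_scaled eps c d F : 0 < eps -> c <= d -> chain n c d F ->
  chain n (c / eps) (d / eps) (scaled eps F) /\
  ig (dens (scaled eps F)) (c / eps) (d / eps) = ig (dens_eps eps F) c d.
Proof.
move=> e0 cd ch.
have E x : eps * (x / eps) + 0 = x by rewrite addr0 mulrC divfK// gt_eqF.
have cd' : c / eps <= d / eps by rewrite ler_pM2r// invr_gt0.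
split; first by apply: chain_affine => //; rewrite !E.
have di : iint (dens_eps eps F) (eps * (c / eps) + 0) (eps * (d / eps) + 0).
  by rewrite !E; exact: iint_dens_eps.
have [di' de] := ig_affine e0 di.
rewrite (@igE _ _ (fun t => eps * dens_eps eps F (eps * t + 0))); last first.
  by move=> t _; rewrite dens_scaled// gt_eqF.
by rewrite igZ// de !E mulVKf// gt_eqF.
Qed.

(** Admissible functions in chain form. All orders, the top one included, are those of a constant at
    every point beyond T, so the energy is exactly the integral over [-T, T]. *)
Definition profile T F : Prop :=
  [/\ 0 < T, gchain n F, forall j t, (j <= n)%N -> T <= t -> F j t = const_chain 1 j t &
      forall j t, (j <= n)%N -> t <= - T -> F j t = const_chain (-1) j t].

Definition cost_of f : \bar R :=
  (\int[mu]_x (W (f x) - lam * weak_derivative setT n.-1 f x ^+ 2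
       + weak_derivative setT n f x ^+ 2)%:E)%E.

Hypothesis W1 : W 1 = 0.
Hypothesis WN1 : W (-1) = 0.

Lemma dens_const F s t : F 0%N t = s -> W s = 0 ->
  (forall j, (0 < j <= n)%N -> F j t = 0) -> dens F t = 0.
Proof.
move=> F0 Ws Fj; rewrite /dens F0 Ws (Fj n.-1) ?(Fj n) ?expr0n ?mulr0 ?subr0 ?addr0//.
  by rewrite n0 leqnn.
by rewrite ltn_predRL hn leq_pred.
Qed.

Lemma profile_cost T F f : profile T F -> locally_integrable setT f ->
  {ae mu, forall t, f t = F 0%N t} -> cost_of f = (ig (dens F) (- T) T)%:E.
Proof.
move=> [T0 gF FT FNT] lf fF.
have TT : - T < T by lra.
have w1 := weak_unique_setT (weak_derivativeP (gchain_weak_derivative gF lf fF (ltnW n1)))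
  (gchain_weak_derivative gF lf fF (ltnW n1)).
have w2 := weak_unique_setT (weak_derivativeP (gchain_weak_derivative gF lf fF (leqnn n)))
  (gchain_weak_derivative gF lf fF (leqnn n)).
have [_ lw1 _] := weak_derivativeP (gchain_weak_derivative gF lf fF (ltnW n1)).
have [_ lw2 _] := weak_derivativeP (gchain_weak_derivative gF lf fF (leqnn n)).
have mW : measurable_fun setT W by exact: continuous_measurable_fun.
have mF j : (j <= n)%N -> measurable_fun setT (F j) by exact: gchain_measurable.
rewrite /cost_of (@ae_eq_integral _ _ _ mu _ (EFin \o dens F))//; last 3 first.
- apply/measurable_EFinP; apply: measurable_funD.
    apply: measurable_funB; first by apply: measurableT_comp => //; case: lf.
    by apply: measurable_funM => //; apply: measurable_funX; case: lw1.
  by apply: measurable_funX; case: lw2.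
- apply/measurable_EFinP; apply: measurable_funD.
    apply: measurable_funB; first by apply: measurableT_comp => //; exact: mF.
    by apply: measurable_funM => //; apply: measurable_funX; apply: mF; exact: ltnW.
  by apply: measurable_funX; exact: mF.
- by apply: aeS (aeI fF (aeI w1 w2)) => t [h0 [h1 h2]] _; rewrite /dens /= h0 h1 h2.
have di := iint_dens (gF _ _ TT) (ltW TT).
rewrite -(integral_ig di) integral_mkcond [RHS]integral_mkcond.
apply: eq_integral => t _; rewrite patchE in_setT patchE; case: ifPn => //.
rewrite notin_setE /= in_itv/= => /negP; rewrite negb_and -!leNgt => /orP[tT|Tt].
- rewrite (@dens_const F (-1))//; first by rewrite FNT.
  by move=> [//|j] /andP[_ jn]; rewrite FNT.
- rewrite (@dens_const F 1)//; first by rewrite FT.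
  by move=> [//|j] /andP[_ jn]; rewrite FT.
Qed.

Lemma profile_admissible T F : profile T F ->
  admissible n (F 0%N) /\ cost_of (F 0%N) = (ig (dens F) (- T) T)%:E.
Proof.
move=> pF; have [T0 gF FT FNT] := pF; split.
  split; first exact: gchain_sobolev_loc.
  exists T => //; split => t tT.
    by rewrite FT//; exact: ltW.
  by rewrite FNT//; exact: ltW.
apply: profile_cost => //; last exact: aeW.
exact: gchain_locally_integrable gF _.
Qed.

Lemma transition_costE : transition_cost n W lam = ereal_inf [set cost_of f | f in admissible n].
Proof. by []. Qed.

Lemma profile_transition_cost T F : profile T F ->
  (transition_cost n W lam <= (ig (dens F) (- T) T)%:E)%E.
Proof.
move=> /profile_admissible[aF <-]; rewrite transition_costE.
by apply: ereal_inf_lbound; exists (F 0%N).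
Qed.

Lemma within_cont_ae_const f c d s : c < d -> {within `[c, d], continuous f} ->
  {ae mu, forall t, `]c, d[%classic t -> f t = s} -> forall t, c <= t <= d -> f t = s.
Proof.
move=> cd cf fs t /andP[ct td]; apply/eqP; rewrite -subr_eq0 -normr_eq0.
apply/eqP/le_anti; rewrite normr_ge0 andbT; apply/ler_addgt0Pr => e e0; rewrite add0r.
have tcd : t \in `[c, d]%classic by rewrite inE /= in_itv/= ct td.
have cft : f x @[x --> within `[c, d]%classic (nbhs t)] --> f t.
  by move/subspace_continuousP : cf => /(_ t); apply; rewrite /= in_itv/= ct td.
have /cvgrPdist_le/(_ _ e0) := cft; rewrite near_withinE => -[r /= r0 hr].
have [x /andP[x1 x2] hx] : exists2 x, Num.max c (t - r) < x < Num.min d (t + r) &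
    (`]c, d[%classic x -> f x = s).
  apply: ae_ex fs; rewrite lt_min !gt_max cd /=; lra.
move: x1 x2; rewrite gt_max lt_min => /andP[cx rx] /andP[xd xr].
rewrite -(hx _); last by rewrite /= in_itv/= cx xd.
apply: hr => /=; first by rewrite ltr_norml; lra.
by rewrite in_itv/= !ltW.
Qed.

(** A constant integrates to 0 against the derivative of a test function, so [F j] with 0 < j
    vanishes almost everywhere; continuity, available for j < n, makes this pointwise. *)
Lemma chain_locally_const c d F s : c < d -> chain n c d F ->
  (forall t, c <= t <= d -> F 0%N t = s) ->
  forall j t, (j < n)%N -> c <= t <= d -> F j t = const_chain s j t.
Proof.
move=> cd ch F0 [t _|j t jn]; first exact: F0.
have cF := chain_cont ch (ltW cd) jn.
apply: within_cont_ae_const => //.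
have Fi : iint (F j.+1) c d by exact: chain_iint ch (ltW cd) (ltnW jn).
apply: weak_zero => // k x cx xd /=; have tk := kern_test cx xd.
have := chain_test (ltW cd) ch (ltnW jn) tk.
have [dk _] := tk; have ck i := derive1n_continuous (k := i) dk.
rewrite (@igE _ _ (fun t => s * derive1n j.+1 (kern k x) t)); last first.
  by move=> y ycd; rewrite F0.
rewrite igZ; last exact: iint_cont.
have dk' (y : R) : is_derive y (1 : R) (derive1n j (kern k x)) (derive1n j.+1 (kern k x) y).
  exact: derive1n_is_derive.
rewrite (FTC (ltW cd) dk' (ck _)).
have tkj := test_function_derive1n j tk.
rewrite (test_function_out (t := d) tkj) ?lexx ?orbT//.
rewrite (test_function_out (t := c) tkj) ?lexx// subrr mulr0 => /esym/eqP.
by rewrite mulf_eq0 signr_eq0 /= => /eqP.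
Qed.

(** The chain of [f] on a large bounded interval already has the derivatives of a constant near both
    ends, so constants can be glued to it; the result agrees with [f] almost everywhere and hence
    has the same energy. *)
Lemma admissible_profile f : admissible n f ->
  exists T F, profile T F /\ cost_of f = (ig (dens F) (- T) T)%:E.
Proof.
(* [f] is constant on a neighbourhood of S and of -S, where the gluing takes place. The top
   derivative at these two points is still arbitrary, whence the larger T. *)
move=> [sf [T0 T00 [fT fNT]]]; pose S := T0 + 1; pose T := T0 + 2.
have SS : - (S + 1) < S + 1 by rewrite /S; lra.
have [F [ch fF]] := sobolev_chain SS (sobolev_loc_restrict (- (S + 1)) (S + 1) sf).
have Fp j t : (j < n)%N -> S <= t <= S + 1 -> F j t = const_chain 1 j t.
  have Sl : S < S + 1 by rewrite ltrDl.
  have chS : chain n S (S + 1) F by apply: chain_sub ch _ _ => //; rewrite /S; lra.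
  apply: (chain_locally_const Sl chS) => {}t ht.
  apply: (within_cont_ae_const Sl (chain_cont chS (ltW Sl) n0)) => //.
  apply: aeS fF => x hx; rewrite /= in_itv/= => /andP[Sx xS]; rewrite -hx.
    by rewrite fT//; move: Sx; rewrite /S; lra.
  by move: Sx xS; rewrite /= in_itv/= /S; lra.
have Fn j t : (j < n)%N -> - (S + 1) <= t <= - S -> F j t = const_chain (-1) j t.
  have Sl : - (S + 1) < - S by rewrite ltrN2 ltrDl.
  have chS : chain n (- (S + 1)) (- S) F by apply: chain_sub ch _ _ => //; rewrite /S; lra.
  apply: (chain_locally_const Sl chS) => {}t ht.
  apply: (within_cont_ae_const Sl (chain_cont chS (ltW Sl) n0)) => //.
  apply: aeS fF => x hx; rewrite /= in_itv/= => /andP[Sx xS]; rewrite -hx.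
    by rewrite fNT//; move: xS; rewrite /S; lra.
  by move: Sx xS; rewrite /= in_itv/= /S; lra.
pose F1 := glue S F (const_chain 1); pose F2 := glue (- S) (const_chain (-1)) F1.
have S0 : 0 < S by rewrite /S; lra.
have F1E j t : (j < n)%N -> - (S + 1) <= t <= S + 1 -> F1 j t = F j t.
  move=> jn /andP[t1 t2]; rewrite /F1 /glue; case: leP => // St.
  by rewrite Fp// t2 ltW.
have F2E j t : (j < n)%N -> - (S + 1) <= t <= S + 1 -> F2 j t = F j t.
  move=> jn /andP[t1 t2]; rewrite /F2 /glue; case: leP => St.
    by rewrite Fn// t1 St.
  by rewrite F1E// t1 t2.
have gF : gchain n F2.
  move=> c d cd; pose c' := Num.min c (- S - 1); pose d' := Num.max d (S + 1).
  have [c1 c2] : c' <= c /\ c' <= - S - 1 by rewrite /c' !ge_min !lexx orbT.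
  have [d1 d2] : d <= d' /\ S + 1 <= d' by rewrite /d' !le_max !lexx orbT.
  suff : chain n c' d' F2 by move=> h; apply: chain_sub h _ _.
  apply: chain_glue; [lra|lra|exact: chain_const| |].
  + apply: chain_glue; [lra|lra| |exact: chain_const|].
      by apply: chain_sub ch _ _; lra.
    by move=> j jn; rewrite Fp// lexx lerDl ler01.
  + move=> j jn; rewrite F1E//; last by apply/andP; split; lra.
    by rewrite Fn// lexx lerN2 lerDl ler01.
have T0' : 0 < T by rewrite /T; lra.
have pF : profile T F2.
  split => // j t jn tT.
  - rewrite /F2 /F1 /glue leNgt ifN; last by rewrite negbK; move: tT; rewrite /T /S; lra.
    by rewrite leNgt ifN// negbK; move: tT; rewrite /T /S; lra.
  - rewrite /F2 /glue ifT//; move: tT; rewrite /T /S; lra.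
exists T, F2; split => //; apply: profile_cost => //.
  by apply: L2_loc_locally_integrable; case: sf.
apply: aeS fF => t ht.
have [tin|] := boolP (- (S + 1) < t < S + 1).
  rewrite F2E//; last by case/andP : tin => /ltW -> /ltW ->.
  by apply: ht; rewrite /= in_itv.
rewrite negb_and -!leNgt => /orP[tS|tS].
- rewrite /F2 /glue ifT; last by lra.
  by rewrite fNT//; move: tS; rewrite /S; lra.
- rewrite /F2 /F1 /glue leNgt ifN; last by rewrite negbK; lra.
  rewrite leNgt ifN; last by rewrite negbK; lra.
  by rewrite fT//; move: tS; rewrite /S; lra.
Qed.

End energy.

(** * Coercivity and cells of small energy *)

Section coercivity.
Context {R : realType} (n : nat) (W : R -> R) (lam : R).
Hypothesis hn : (2 <= n)%N.
Hypothesis cW : continuous W.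
Hypothesis W0 : forall t, 0 <= W t.
Hypothesis lam0 : 0 < lam.
Implicit Types (u f g h : R -> R) (F G : nat -> R -> R).
Implicit Types (a b x y t c d M e l s sg eta kap : R) (j k : nat).
Local Notation mu := (@lebesgue_measure R).
Local Notation dens := (dens n W lam).
Local Notation coer := (coer n W).

Let n0 : (0 < n)%N. Proof. exact: leq_trans hn. Qed.
Let n1 : (n.-1 < n)%N. Proof. by rewrite prednK. Qed.

Lemma coer_ge0 F t : 0 <= coer F t.
Proof. by rewrite addr_ge0 ?sqr_ge0. Qed.

(* On a cell of length in [1, 1 + e] the powers of the length in the
   interpolation inequality are absorbed by the gap between lambda and l. *)
Lemma cell_coercive l : lam < l -> interpolation_inequality n W l ->
  exists de e, [/\ 0 < de, 0 < e, e <= 1 & forall c d F, 1 <= d - c -> d - c <= 1 + e ->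
    chain n c d F -> de * ig (coer F) c d <= ig (dens F) c d].
Proof.
move=> laml hl; have l0 : 0 < l by exact: lt_trans lam0 laml.
have lp : 0 < lam by exact: lam0.
(* lam q is the midpoint of lam and l: the cell length may cost the factor q, and half of the gap l
   - lam is left. *)
pose q := (l + lam) / (2 * lam).
have lamn : lam != 0 by rewrite gt_eqF.
have q1 : 1 < q by rewrite /q ltr_pdivlMr; lra.
(* For e <= 1 one has (1 + e)^2 <= 1 + 3 e <= q. *)
pose e := Num.min 1 ((q - 1) / 3).
have e0 : 0 < e by rewrite /e lt_min ltr01 divr_gt0 ?subr_gt0.
have [e1 eq] : e <= 1 /\ e <= (q - 1) / 3 by rewrite /e !ge_min !lexx orbT.
exists ((l - lam) / (2 * l)), e; split => //.
  by apply: divr_gt0; lra.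
move=> c d F h1 h2 ch; have cd : c < d by lra.
have := interpolation_chain hn cW hl cd ch.
rewrite (ig_dens lam hn cW ch (ltW cd)) (ig_coer hn cW ch (ltW cd)).
have A0 : 0 <= ig (fun t => W (F 0%N t)) c d by apply: ig_ge0.
have C0 : 0 <= ig (fun t => F n t ^+ 2) c d by apply: ig_ge0 => t _; exact: sqr_ge0.
move: (ig _ c d) (ig _ c d) (ig _ c d) A0 C0 => C B A A0 B0.
set tau := d - c in h1 h2 *; move: tau h1 h2 => tau h1 h2 hint.
have tq : tau ^+ 2 <= q by nra.
have ti : tau ^- (2 * n - 2) <= 1.
  by rewrite invf_le1 ?exprn_ege1// exprn_gt0//; lra.
have h3 : l * C <= q * (A + B).
  apply: le_trans hint _; rewrite mulrDr; apply: lerD.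
    by apply: (@le_trans _ _ (1 * A)); rewrite ler_wpM2r// ltW.
  by rewrite ler_wpM2r.
have h4 : l * (lam * C) <= (l + lam) / 2 * (A + B).
  have -> : (l + lam) / 2 * (A + B) = lam * (q * (A + B)) by rewrite /q; field.
  by rewrite mulrCA ler_wpM2l// ltW.
rewrite -(ler_pM2l l0).
have -> : l * ((l - lam) / (2 * l) * (A + B)) = (l - lam) / 2 * (A + B).
  by field; rewrite gt_eqF.
move: (lam * C) h4 => X h4; nra.
Qed.

(** With K the integer part of L, L / K < 1 + 1 / K, and K > 1 / e as soon as L >= 1 + 1 / e. *)
Lemma cells_exist e : 0 < e -> exists2 L0, 0 < L0 & forall L, L0 <= L ->
  exists K : nat, [/\ (0 < K)%N, 1 <= L / K%:R & L / K%:R <= 1 + e].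
Proof.
move=> e0; have eV : 0 < e^-1 by rewrite invr_gt0.
exists (1 + e^-1) => [|L hL]; first lra.
have L0 : 0 <= L by lra.
have /andP[k1 k2] := truncn_itv L0.
exists (Num.truncn L); move: k1 k2; set K := Num.truncn L => k1 k2.
have K0 : e^-1 < K%:R by move: k2; rewrite -addn1 natrD; lra.
have Kp : (0 : R) < K%:R by lra.
split; first by rewrite -(ltr_nat R).
  by rewrite ler_pdivlMr// mul1r.
rewrite ler_pdivrMr// mulrDl mul1r.
move: k2; rewrite -addn1 natrD => k2.
have : e * e^-1 < e * K%:R by rewrite ltr_pM2l.
rewrite mulfV ?gt_eqF//; lra.
Qed.

Lemma small_point g c d M : c < d -> iint g c d -> ig g c d < M * (d - c) ->
  exists2 t, c <= t <= d & g t <= M.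
Proof.
move=> cd gi gM; apply: contrapT => nex.
move: gM; apply/negP; rewrite -leNgt -(ig_cst _ (ltW cd)).
apply: le_ig => //; first exact: iint_cst.
move=> t tcd /=; rewrite leNgt; apply/negP => /ltW gt.
by apply: nex; exists t.
Qed.

Lemma chain_mvt c d F j : chain n c d F -> c < d -> (j.+1 < n)%N ->
  exists2 t, c <= t <= d & F j d - F j c = F j.+1 t * (d - c).
Proof.
move=> ch cd jn; have [h1 _ _] := ch; have cd' := ltW cd.
have cF := chain_cont ch cd' jn.
have [ci _ _] := (continuous_within_itvP (F j.+1) cd).1 cF.
have Fi := chain_iint ch cd' (ltnW jn).
have [t tcd ->] : exists2 t, t \in `]c, d[ & F j d - F j c = F j.+1 t * (d - c).
  apply: (MVT cd); last exact: chain_cont ch cd' (ltnW jn).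
  move=> t; rewrite in_itv/= => /andP[ct td].
  have cFt : {for t, continuous (F j.+1)} by apply: ci; rewrite in_itv/= ct td.
  have [d1 d2] := continuous_FTC1_closed td Fi ct cFt.
  have dI : is_derive t (1 : R) (fun y => ig (F j.+1) c y) (F j.+1 t).
    by apply: DeriveDef; [exact: d1|rewrite -derive1E; exact: d2].
  apply: (@near_eq_is_derive _ _ _ (fun y => F j c + ig (F j.+1) c y)); last first.
    by apply: is_derive_eq (is_deriveD (is_derive_cst (F j c) _ _) dI) _; rewrite add0r.
  near=> y; rewrite -(h1 j c y)//; first by rewrite addrC subrK.
  - exact: ltnW.
  - by apply: ltW; near: y; exact: lt_nbhsr.
  - by apply: ltW; near: y; exact: lt_nbhsl.
by exists t => //; move: tcd; rewrite in_itv/= => /andP[/ltW -> /ltW ->].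
Unshelve. all: by end_near. Qed.

Hypothesis W2' : forall t, W t = 0 <-> t = 1 \/ t = -1.
Hypothesis W3' : W3 W.

Lemma quadratic_well : exists2 L, 0 < L & forall t, exists2 s, s = 1 \/ s = -1 &
  L * (t - s) ^+ 2 <= W t.
Proof.
have [L L0 [h1 h2]] := W3'.
have Wz : 0 < W 0.
  rewrite lt_neqAle W0 andbT eq_sym; apply/eqP => /W2'[/eqP|/eqP].
    by rewrite eq_sym oner_eq0.
  by rewrite eq_sym oppr_eq0 oner_eq0.
exists (Num.min L (W 0)) => [|t]; first by rewrite lt_min L0 Wz.
have [t0|t0|->] := ltgtP t 0.
- exists (-1); first by right.
  apply: le_trans (h2 t t0); rewrite opprK ler_wpM2r ?sqr_ge0//.
  by rewrite ge_min lexx.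
- exists 1; first by left.
  apply: le_trans (h1 t t0); rewrite ler_wpM2r ?sqr_ge0//.
  by rewrite ge_min lexx.
- exists 1; first by left.
  by rewrite sub0r sqrrN expr1n mulr1 ge_min lexx orbT.
Qed.

Lemma coer_sub c d F x y : chain n c d F -> c <= x -> x <= y -> y <= d ->
  ig (coer F) x y <= ig (coer F) c d.
Proof.
move=> ch cx xy yd; apply: le_igS => //.
- by apply: (iint_coer hn cW ch); rewrite (le_trans cx) ?(le_trans xy).
- by move=> t _; exact: coer_ge0.
Qed.

Lemma coer_top c d F : chain n c d F -> c <= d ->
  ig (fun t => F n t ^+ 2) c d <= ig (coer F) c d.
Proof.
move=> ch cd; rewrite (ig_coer hn cW ch cd) lerDr; exact: ig_ge0.
Qed.

Lemma coer_W c d F : chain n c d F -> c <= d ->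
  ig (fun t => W (F 0%N t)) c d <= ig (coer F) c d.
Proof.
move=> ch cd; rewrite (ig_coer hn cW ch cd) lerDl; apply: ig_ge0 => t _; exact: sqr_ge0.
Qed.

(** If W exceeded L sg^2 throughout an interval of length e, the energy would be at least L sg^2 e,
    twice the chosen eta. *)
Lemma near_well sg e : 0 < sg -> 0 < e -> exists2 eta, 0 < eta & forall c d F x y,
  chain n c d F -> ig (coer F) c d <= eta -> c <= x -> y <= d -> e <= y - x ->
  exists2 t, x <= t <= y & exists2 s, s = 1 \/ s = -1 & `|F 0%N t - s| <= sg.
Proof.
move=> s0 e0; have [L L0 hL] := quadratic_well.
pose eta := L * sg ^+ 2 * e / 2.
have Ls : 0 < L * sg ^+ 2 by rewrite mulr_gt0 ?exprn_gt0.
exists eta => [|c d F x y ch hc cx yd exy]; first by rewrite divr_gt0 ?mulr_gt0.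
have xy : x < y by lra.
have ch' := chain_sub ch cx yd.
have [|t txy Wt] := small_point (M := L * sg ^+ 2) xy (chain_iint_W hn cW ch' (ltW xy)).
  apply: le_lt_trans (coer_W ch' (ltW xy)) _.
  apply: le_lt_trans (coer_sub ch cx (ltW xy) yd) _.
  apply: le_lt_trans hc _; rewrite /eta; nra.
exists t => //; have [s hs hW] := hL (F 0%N t); exists s => //.
rewrite -(ler_pXn2r (n := 2)) ?nnegrE ?normr_ge0 ?(ltW s0)//.
rewrite real_normK ?num_real// -(ler_pM2l L0); exact: le_trans hW Wt.
Qed.

(* Mean value theorem between two points where the previous derivative is small;
   for j = 1, between two points near the same well, found among three points
   near the wells. *)
Lemma small_derivative_point j sg e : (0 < j)%N -> (j < n)%N -> 0 < sg -> 0 < e ->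
  exists2 eta, 0 < eta & forall c d F x y,
  chain n c d F -> ig (coer F) c d <= eta -> c <= x -> y <= d -> e <= y - x ->
  exists2 t, x <= t <= y & `|F j t| <= sg.
Proof.
elim: j sg e => [//|j IH] sg e _ jn s0 e0.
(* Points are sought in the first, third and fifth of five equal parts, so that any two are at least
   e / 5 apart. If the values of order j there are within sg (e / 5) / 2 of a common number, the
   difference quotient is at most sg. *)
have e5 : 0 < e / 5 by lra.
have se : 0 < sg * (e / 5) / 2 by rewrite divr_gt0 ?mulr_gt0.
have mvt c d F p q : chain n c d F -> c <= p -> q <= d -> e / 5 <= q - p ->
    `|F j q - F j p| <= sg * (e / 5) -> exists2 t, p <= t <= q & `|F j.+1 t| <= sg.
  move=> ch cp qd pq hF; have pq' : p < q by lra.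
  have [t tpq tE] := chain_mvt (chain_sub ch cp qd) pq' jn.
  exists t => //; move: hF; rewrite tE normrM (gtr0_norm (_ : 0 < q - p)); last by lra.
  move=> hF; rewrite -(ler_pM2r e5); apply: le_trans hF.
  by rewrite ler_wpM2l.
case: j IH jn mvt => [_|j IH] jn mvt.
  have [eta eta0 H] := near_well se e5; exists eta => // c d F x y ch hc cx yd exy.
  have [p1 hp1 [s1 hs1 hF1]] := H c d F x (x + e / 5) ch hc cx ltac:(lra) ltac:(lra).
  have [p2 hp2 [s2 hs2 hF2]] :=
    H c d F (x + e / 5 * 2) (x + e / 5 * 3) ch hc ltac:(lra) ltac:(lra) ltac:(lra).
  have [p3 hp3 [s3 hs3 hF3]] :=
    H c d F (x + e / 5 * 4) (x + e) ch hc ltac:(lra) ltac:(lra) ltac:(lra).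
  have fin p q s : x <= p -> q <= y -> e / 5 <= q - p -> `|F 0%N p - s| <= sg * (e / 5) / 2 ->
      `|F 0%N q - s| <= sg * (e / 5) / 2 -> exists2 t, x <= t <= y & `|F 1%N t| <= sg.
    move=> xp qy pq h1 h2.
    have [|t /andP[t1 t2] tF] := mvt c d F p q ch (le_trans cx xp) (le_trans qy yd) pq.
      move: h1 h2; rewrite !ler_norml => /andP[? ?] /andP[? ?]; lra.
    by exists t => //; rewrite (le_trans xp t1) (le_trans t2 qy).
  have [s12|s13|s23] : [\/ s1 = s2, s1 = s3 | s2 = s3].
    by case: hs1 => ->; case: hs2 => ->; case: hs3 => ->;
      [constructor 1|constructor 1|constructor 2|constructor 3
      |constructor 3|constructor 2|constructor 1|constructor 1].
  - by apply: (fin p1 p2 s1); [lra|lra|lra|exact: hF1|rewrite s12; exact: hF2].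
  - by apply: (fin p1 p3 s1); [lra|lra|lra|exact: hF1|rewrite s13; exact: hF3].
  - by apply: (fin p2 p3 s2); [lra|lra|lra|exact: hF2|rewrite s23; exact: hF3].
have [eta eta0 H] := IH _ _ isT (ltnW jn) se e5.
exists eta => // c d F x y ch hc cx yd exy.
have [p1 hp1 hF1] := H c d F x (x + e / 5) ch hc cx ltac:(lra) ltac:(lra).
have [p2 hp2 hF2] := H c d F (x + e / 5 * 2) (x + e / 5 * 3) ch hc ltac:(lra) ltac:(lra) ltac:(lra).
have [||||t /andP[t1 t2] tF] := mvt c d F p1 p2 ch; [lra|lra|lra| |].
  move: hF1 hF2; rewrite !ler_norml => /andP[? ?] /andP[? ?]; lra.
by exists t => //; lra.
Qed.

Lemma chain_osc c d F j p q : chain n c d F -> (j < n)%N -> c <= p <= d -> c <= q <= d ->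
  `|F j q - F j p| <= ig (fun t => `|F j.+1 t|) c d.
Proof.
move=> ch jn; wlog pq : p q / p <= q.
  move=> H hp hq; have [pq|/ltW qp] := leP p q; first exact: H.
  by rewrite distrC; apply: H.
move=> /andP[cp pd] /andP[cq qd]; have [h1 _ _] := ch.
have cd : c <= d by exact: le_trans cq qd.
have Fi := chain_iint ch cd jn.
rewrite h1//; apply: le_trans (ig_norm (iintS Fi cp qd)) _.
by apply: le_igS => //; exact: iint_norm.
Qed.

(** Descending induction from order n to order 1: a derivative that is small at one point and whose
    own derivative has small integral is small on the whole cell. *)
Lemma small_derivative_mass k sg : (k < n)%N -> 0 < sg -> exists2 eta, 0 < eta &
  forall c d F, 1 <= d - c -> d - c <= 2 -> chain n c d F -> ig (coer F) c d <= eta ->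
  ig (fun t => `|F (n - k)%N t|) c d <= sg.
Proof.
elim: k sg => [|k IH] sg kn s0.
  (* From |z| <= sg / 4 + (4 / sg) z^2 on a length at most 2, both terms contribute at most sg /
     2. *)
  exists (sg ^+ 2 / 8) => [|c d F h1 h2 ch hc]; first by rewrite divr_gt0 ?exprn_gt0.
  have cd : c <= d by lra.
  rewrite subn0; apply: (@le_trans _ _ (ig (fun t => cst (sg / 4) t + 4 / sg * F n t ^+ 2) c d)).
    have i1 : iint (fun t => 4 / sg * F n t ^+ 2) c d by apply: iintZ; exact: chain_iint_top.
    apply: le_ig;
      [by apply: iint_norm; exact: chain_iint ch cd _|by apply: iintD => //; exact: iint_cst|].
    move=> t _ /=; rewrite -[F n t ^+ 2]real_normK ?num_real//.
    have := normr_ge0 (F n t); move: (`|F n t|) => z z0.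
    have z4 : 0 <= (z - sg / 4) ^+ 2 by exact: sqr_ge0.
    have [zs|zs] := leP z (sg / 4).
      by apply: le_trans zs _; rewrite lerDl mulr_ge0 ?sqr_ge0// divr_ge0 ?ltW.
    apply: (@le_trans _ _ (4 / sg * z ^+ 2)); last by rewrite lerDr; lra.
    rewrite expr2 mulrA ler_peMl//.
    have -> : 4 / sg * z = z / (sg / 4) by field; rewrite gt_eqF.
    by rewrite ler_pdivlMr ?mul1r ?ltW// divr_gt0.
  have i0 : iint (cst (sg / 4)) c d by exact: iint_cst.
  have i1 := chain_iint_top ch.
  have -> : ig (fun t => cst (sg / 4) t + 4 / sg * F n t ^+ 2) c d =
      sg / 4 * (d - c) + 4 / sg * ig (fun t => F n t ^+ 2) c d.
    by rewrite -igZ// -(ig_cst _ cd); apply: ig_add => //; exact: iintZ.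
  have h3 := le_trans (coer_top ch cd) hc.
  have h4 : 4 / sg * ig (fun t => F n t ^+ 2) c d <= 4 / sg * (sg ^+ 2 / 8).
    by rewrite ler_wpM2l// divr_ge0// ltW.
  have E : 4 / sg * (sg ^+ 2 / 8) = sg / 2 by field; rewrite gt_eqF.
  rewrite E in h4; nra.
have nk : (n - k)%N = (n - k.+1).+1 by rewrite subnSK// ltnW.
have jn : (n - k.+1 < n)%N by rewrite -nk leq_subr.
have j0 : (0 < n - k.+1)%N by rewrite subn_gt0.
have s4 : 0 < sg / 4 by lra.
have [e1 e10 H1] := IH _ (ltnW kn) s4.
have [e2 e20 H2] := small_derivative_point j0 jn s4 ltr01.
exists (Num.min e1 e2) => [|c d F h1 h2 ch]; first by rewrite lt_min e10 e20.
rewrite le_min => /andP[c1 c2]; have cd : c <= d by lra.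
have {}H1 := H1 c d F h1 h2 ch c1.
have [p hp hF] := H2 c d F c d ch c2 (lexx c) (lexx d) h1.
apply: (@le_trans _ _ (ig (cst (sg / 2)) c d)); last by rewrite ig_cst//; nra.
apply: le_ig; [by apply: iint_norm; exact: chain_iint ch cd (ltnW jn)|exact: iint_cst|].
move=> t ht /=; have := chain_osc ch jn hp ht; rewrite -nk => osc.
have := le_trans osc H1; move: hF; rewrite !ler_norml => /andP[? ?] /andP[? ?]; lra.
Qed.

(** Closeness to the constant s of exactly the n values, orders 0 to n - 1, that Hermite
    interpolation prescribes at a point. *)
Definition near_state sg s F t : Prop :=
  `|F 0%N t - s| <= sg /\ forall j, (0 < j)%N -> (j < n)%N -> `|F j t| <= sg.

Lemma small_derivative_sup j sg : (0 < j)%N -> (j < n)%N -> 0 < sg -> exists2 eta, 0 < eta &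
  forall c d F, 1 <= d - c -> d - c <= 2 -> chain n c d F -> ig (coer F) c d <= eta ->
  forall t, c <= t <= d -> `|F j t| <= sg.
Proof.
move=> j0 jn s0; have s2 : 0 < sg / 2 by lra.
have kn : (n - j.+1 < n)%N by rewrite ltn_subrL.
have [e1 e10 H1] := small_derivative_mass kn s2.
have [e2 e20 H2] := small_derivative_point j0 jn s2 ltr01.
exists (Num.min e1 e2) => [|c d F h1 h2 ch]; first by rewrite lt_min e10 e20.
rewrite le_min => /andP[c1 c2] t ht; have cd : c <= d by lra.
have {}H1 := H1 c d F h1 h2 ch c1; rewrite subKn// in H1.
have [p hp hF] := H2 c d F c d ch c2 (lexx c) (lexx d) h1.
have := le_trans (chain_osc ch jn hp ht) H1.
move: hF; rewrite !ler_norml => /andP[? ?] /andP[? ?]; lra.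
Qed.

(** A point near some well exists, and [F 0] oscillates over the cell by at most the integral of |F
    1|, so the same well serves the whole cell. The threshold is a minimum over the finitely many
    orders. *)
Lemma good_cell sg : 0 < sg -> exists2 eta, 0 < eta &
  forall c d F, 1 <= d - c -> d - c <= 2 -> chain n c d F -> ig (coer F) c d <= eta ->
  exists2 s, s = 1 \/ s = -1 & forall t, c <= t <= d -> near_state sg s F t.
Proof.
move=> s0; have s2 : 0 < sg / 2 by lra.
have [e1 e10 H1] := near_well s2 ltr01.
have kn : (n.-1 < n)%N by [].
have [e2 e20 H2] := small_derivative_mass kn s2.
have [eta [eta0 H3]] : exists eta : nat -> R, (forall j, 0 < eta j) /\
   forall j, (0 < j)%N -> (j < n)%N ->
    forall c d F, 1 <= d - c -> d - c <= 2 -> chain n c d F -> ig (coer F) c d <= eta j ->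
    forall t, c <= t <= d -> `|F j t| <= sg.
  have H j : exists e, 0 < e /\ ((0 < j)%N -> (j < n)%N ->
    forall c d F, 1 <= d - c -> d - c <= 2 -> chain n c d F -> ig (coer F) c d <= e ->
    forall t, c <= t <= d -> `|F j t| <= sg).
    have [/andP[j0 jn]|nj] := boolP ((0 < j)%N && (j < n)%N).
      by have [e e0 he] := small_derivative_sup j0 jn s0; exists e.
    by exists 1; split => // j0 jn; rewrite j0 jn in nj.
  have [eta heta] := choice H; exists eta; split => j; by have [] := heta j.
have [m m0 hm] : exists2 m : R, 0 < m & forall j, (j < n)%N -> m <= eta j.
  elim: (n) => [|k [m m0 hm]]; first by exists 1.
  exists (Num.min m (eta k)); first by rewrite lt_min m0 eta0.
  move=> j; rewrite ltnS leq_eqVlt => /predU1P[->|jk]; first by rewrite ge_min lexx orbT.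
  by rewrite ge_min hm.
exists (Num.min e1 (Num.min e2 m)) => [|c d F h1 h2 ch]; first by rewrite !lt_min e10 e20 m0.
rewrite !le_min => /and3P[c1 c2 c3]; have cd : c <= d by lra.
have [p hp [s hs hF]] := H1 c d F c d ch c1 (lexx c) (lexx d) h1.
exists s => // t ht; split; last first.
  by move=> j j0 jn; apply: (H3 j j0 jn c d F) => //; apply: le_trans c3 (hm j jn).
have {}H2 := H2 c d F h1 h2 ch c2.
have nn1 : (n - n.-1)%N = 1%N by rewrite -{1}(prednK n0) subSnn.
rewrite nn1 in H2.
have := le_trans (chain_osc ch n0 hp ht) H2.
move: hF; rewrite !ler_norml => /andP[? ?] /andP[? ?]; lra.
Qed.

End coercivity.

(** * The cost of one transition *)

Section transitions.
Context {R : realType} (n : nat) (W : R -> R) (lam : R).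
Hypothesis hn : (2 <= n)%N.
Hypothesis cW : continuous W.
Hypothesis W0 : forall t, 0 <= W t.
Hypothesis lam0 : 0 < lam.
Hypothesis W2' : forall t, W t = 0 <-> t = 1 \/ t = -1.
Hypothesis W3' : W3 W.
Implicit Types (u f g h : R -> R) (F G U : nat -> R -> R).
Implicit Types (a b x y t c d M l s sg eta kap tau eps : R) (j k K N : nat).
Local Notation mu := (@lebesgue_measure R).
Local Notation dens := (dens n W lam).
Local Notation coer := (coer n W).

Let n0 : (0 < n)%N. Proof. exact: leq_trans hn. Qed.
Let n1 : (n.-1 < n)%N. Proof. by rewrite prednK. Qed.

Let Ws s : s = 1 \/ s = -1 -> W s = 0. Proof. by move/W2'. Qed.

Lemma dens_eq0 F s t : s = 1 \/ s = -1 ->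
  (forall j, (j <= n)%N -> F j t = const_chain s j t) -> dens F t = 0.
Proof.
move=> hs FE; apply: (dens_const lam hn (s := s)) => //; first by rewrite FE.
- exact: Ws.
- by move=> [//|j] /andP[_ jn]; rewrite FE.
Qed.

Lemma extend_right s : exists G : R -> (nat -> R -> R) -> nat -> R -> R, forall m F,
  [/\ forall P M, P <= m -> m + 1 <= M -> chain n P m F -> chain n P M (G m F),
      forall j t, t <= m -> G m F j t = F j t,
      forall j t, m + 1 < t -> G m F j t = const_chain s j t &
      forall t, m < t < m + 1 ->
        dens (G m F) t <= W (s + (hermite n (fun j => F j m - const_chain s j m)).[t - m])
         + (derivn n (hermite n (fun j => F j m - const_chain s j m))).[t - m] ^+ 2].
Proof.
pose A m F j : R := F j m - const_chain s j m.
pose H m F j t : R := (derivn j (s%:P + hermite n (A m F))).[t - m].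
exists (fun m F => glue m F (glue (m + 1) (H m F) (const_chain s))) => m F; split.
- move=> P M Pm mM ch.
  have cH : chain n m (m + 1) (H m F).
    have := @chain_affine R n 1 (- m) m (m + 1)
      (fun j t => (derivn j (s%:P + hermite n (A m F))).[t]) ltr01 _ (chain_poly _ _ _ _).
    move=> H1; apply: eq_chain (H1 _); last by rewrite lerDl.
    by move=> j t _ _; rewrite expr1n !mul1r.
  apply: chain_glue => //; first by apply: le_trans mM; rewrite lerDl.
    apply: chain_glue => //; first by rewrite lerDl.
      exact: chain_const.
    move=> j jn; rewrite /H horner_derivn_addC.
    have -> : m + 1 - m = 1 by rewrite addrAC subrr add0r.
    by rewrite hermite1// addr0; case: (j).
  move=> j jn; rewrite /glue lerDl ler01 /H horner_derivn_addC subrr hermite0//.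
  by rewrite /A; case: (j) => [|i] /=; lra.
- by move=> j t tm; rewrite /glue tm.
- move=> j t mt; rewrite /glue !leNgt mt ifF//=.
  by apply/negbTE; rewrite negbK; apply: lt_trans mt; rewrite ltrDl.
- move=> t /andP[mt tm].
  have GE j : glue m F (glue (m + 1) (H m F) (const_chain s)) j t = H m F j t.
    by rewrite /glue leNgt mt (ltW tm).
  rewrite /dens !GE /H !horner_derivn_addC.
  have -> : const_chain s n (t - m) = 0 by case: (n) n0.
  rewrite add0r /= lerD2r lerBlDr lerDl mulr_ge0 ?sqr_ge0//; exact: ltW.
Qed.

(** The chain of t -> F(-t). All derivatives enter the energy squared, so reflection preserves it,
    and extensions to the left are obtained from [extend_right]. *)
Definition refl_chain F j t : R := (-1) ^+ j * F j (- t).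

Lemma dens_refl F t : dens (refl_chain F) t = dens F (- t).
Proof. by rewrite /dens /refl_chain expr0 mul1r !exprMn !sqrr_sign !mul1r. Qed.

Lemma chain_refl c d F : c <= d -> chain n (- d) (- c) F -> chain n c d (refl_chain F).
Proof. exact: chain_opp. Qed.

Lemma ig_dens_refl c d F : c <= d -> chain n (- d) (- c) F ->
  ig (dens (refl_chain F)) c d = ig (dens F) (- d) (- c).
Proof.
move=> cd ch; have cd' : - d <= - c by rewrite lerN2.
have [_ <-] := ig_opp (iint_dens lam hn cW ch cd').
by apply: igE => t _; exact: dens_refl.
Qed.

Lemma refl_const s j t : refl_chain (const_chain s) j t = const_chain s j t.
Proof. by rewrite /refl_chain; case: j => [|j] /=; rewrite ?expr0 ?mul1r ?mulr0. Qed.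

Lemma ig_dens_const F s c d : s = 1 \/ s = -1 -> c <= d -> chain n c d F ->
  (forall j t, (j <= n)%N -> c < t < d -> F j t = const_chain s j t) ->
  ig (dens F) c d = 0.
Proof.
move=> hs cd ch FE.
have [|_ <-] := @igE_oo R (cst 0) (dens F) c d _ (iint_cst _ _ _).
  by move=> t ht; rewrite (dens_eq0 hs)// => j jn; exact: FE.
by rewrite ig_cst// mul0r.
Qed.

Lemma extend_right_small s kap : s = 1 \/ s = -1 -> 0 < kap ->
  exists2 sg, 0 < sg & forall m F, near_state n sg s F m ->
  exists G, [/\ forall P M, P <= m -> m + 1 <= M -> chain n P m F -> chain n P M G,
      forall j t, t <= m -> G j t = F j t,
      forall j t, m + 1 < t -> G j t = const_chain s j t &
      forall P, P <= m -> chain n P m F -> ig (dens G) m (m + 1) <= kap].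
Proof.
move=> hs k0; have [sg sg0 hsg] := hermite_small n cW (Ws hs) k0.
have [G hG] := extend_right s.
exists sg => // m F [h0 hj]; have [g1 g2 g3 g4] := hG m F.
exists (G m F); split => // P Pm ch.
have mm : m <= m + 1 by rewrite lerDl.
have ch' := chain_sub (g1 P (m + 1) Pm (lexx _) ch) Pm (lexx _).
have di := iint_dens lam hn cW ch' mm.
apply: (@le_trans _ _ (ig (cst kap) m (m + 1))); last by rewrite ig_cst//; lra.
apply: le_ig_ae => //; first exact: iint_cst.
apply: aeW => t; rewrite /= in_itv/= => mtm; apply: le_trans (g4 t mtm) _.
apply: hsg; last by lra.
move=> [|j] jn; first by rewrite /= h0.
by rewrite /= subr0 hj.
Qed.

Lemma profile_refl T F : 0 < T -> gchain n F ->
  (forall j t, (j <= n)%N -> T <= t -> F j t = const_chain (-1) j t) ->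
  (forall j t, (j <= n)%N -> t <= - T -> F j t = const_chain 1 j t) ->
  profile n T (refl_chain F) /\ ig (dens (refl_chain F)) (- T) T = ig (dens F) (- T) T.
Proof.
move=> T0 gF FT FNT; have TT : - T < T by lra.
split; last first.
  rewrite ig_dens_refl ?ltW// ?opprK//; exact: gF.
split => //.
- by move=> c d cd; apply: chain_refl (ltW cd) _; apply: gF; rewrite ltrN2.
- move=> j t jn tT; rewrite -refl_const /refl_chain FNT ?lerN2//.
- move=> j t jn tT; rewrite -refl_const /refl_chain FT// lerNr//.
Qed.

Lemma near_state_refl sg s F m : near_state n sg s F m ->
  near_state n sg s (refl_chain F) (- m).
Proof.
move=> [h0 hj]; split; rewrite /refl_chain opprK; first by rewrite expr0 mul1r.
by move=> j j0 jn; rewrite normrM normrX normrN1 expr1n mul1r hj.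
Qed.

(** [F] is extended to the right of x2 towards -s, reflected, and extended again to the right of -x1
    towards s, each extension costing at most kap / 2. The result goes from -s to s; when s = -1 a
    further reflection turns it into a profile. *)
Lemma connect kap : 0 < kap -> exists2 sg, 0 < sg & forall s F x1 x2,
  s = 1 \/ s = -1 -> x1 <= x2 -> chain n x1 x2 F ->
  near_state n sg s F x1 -> near_state n sg (- s) F x2 ->
  exists T G, profile n T G /\ ig (dens G) (- T) T <= ig (dens F) x1 x2 + kap.
Proof.
move=> k0; have k2 : 0 < kap / 2 by lra.
have [sg1 sg10 E1] := extend_right_small (or_introl erefl) k2.
have [sg2 sg20 E2] := extend_right_small (or_intror erefl) k2.
exists (Num.min sg1 sg2) => [|s F x1 x2 hs x12 ch ns1 ns2].
  by rewrite lt_min sg10 sg20.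
have nearle sg r G m : Num.min sg1 sg2 <= sg -> near_state n (Num.min sg1 sg2) r G m ->
    near_state n sg r G m.
  move=> hsg [h0 hj]; split; first exact: le_trans hsg.
  by move=> j j0 jn; apply: le_trans (hj j j0 jn) hsg.
have ext r m G : r = 1 \/ r = -1 -> near_state n (Num.min sg1 sg2) r G m ->
  exists G', [/\ forall P M, P <= m -> m + 1 <= M -> chain n P m G -> chain n P M G',
      forall j t, t <= m -> G' j t = G j t,
      forall j t, m + 1 < t -> G' j t = const_chain r j t &
      forall P, P <= m -> chain n P m G -> ig (dens G') m (m + 1) <= kap / 2].
  by case=> -> h; [apply: E1|apply: E2]; apply: nearle h; rewrite ge_min lexx ?orbT.
have hsN : - s = 1 \/ - s = -1 by case: hs => ->; rewrite ?opprK; [right|left].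
have [G1 [a1 a2 a3 a4]] := ext (- s) x2 F hsN ns2.
have c1 M : x2 + 1 <= M -> chain n x1 M G1 by move=> hM; exact: a1.
pose G2 := refl_chain G1.
have c2 M : x2 + 1 <= M -> chain n (- M) (- x1) G2.
  move=> hM; apply: chain_refl; first by rewrite lerN2; lra.
  by rewrite !opprK; exact: c1.
have ns1' : near_state n (Num.min sg1 sg2) s G2 (- x1).
  apply: near_state_refl; move: ns1 => [h0 hj]; split; first by rewrite a2.
  by move=> j j0 jn; rewrite a2//; exact: hj.
have [G3 [b1 b2 b3 b4]] := ext s (- x1) G2 hs ns1'.
pose T := `|x1| + `|x2| + 2.
have [X1 X2 X3 X4] : [/\ - T + 2 <= x1, x1 <= T - 2, - T + 2 <= x2 & x2 <= T - 2].
  have := ler_norm x1; have := ler_norm x2; have := ler_norm (- x1); have := ler_norm (- x2).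
  rewrite !normrN /T; have := normr_ge0 x1; have := normr_ge0 x2.
  by move: (`|x1|) (`|x2|) => ? ?; split; lra.
have T0 : 0 < T by rewrite /T; have := normr_ge0 x1; have := normr_ge0 x2; lra.
have g3 : gchain n G3.
  move=> c d cd; pose M := Num.max (x2 + 1) (- c); pose M' := Num.max (- x1 + 1) d.
  have [m1 m2] : x2 + 1 <= M /\ - c <= M by rewrite /M !le_max !lexx orbT.
  have [m3 m4] : - x1 + 1 <= M' /\ d <= M' by rewrite /M' !le_max !lexx orbT.
  have : chain n (- M) M' G3 by apply: b1 => //; [lra|exact: c2].
  by move=> h; apply: chain_sub h _ _; lra.
have right j t : (j <= n)%N -> T <= t -> G3 j t = const_chain s j t.
  by move=> jn tT; apply: b3; lra.
have left j t : (j <= n)%N -> t <= - T -> G3 j t = const_chain (- s) j t.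
  move=> jn tT; rewrite b2; last by lra.
  by rewrite -refl_const /G2 /refl_chain a3//; lra.
have TT : - T < T by lra.
have en : ig (dens G3) (- T) T <= ig (dens F) x1 x2 + kap.
  have di := iint_dens lam hn cW (g3 _ _ TT) (ltW TT).
  (* Five parts, from left to right: the constant -s, the first extension reflected, [F] reflected,
     the second extension, the constant s. *)
  rewrite (@igD _ (dens G3) (- x2 - 1) (- T) T)//; [|lra|lra].
  rewrite (@igD _ (dens G3) (- x2) (- x2 - 1) T)//; [|by apply: iintS di _ _; lra|lra|lra].
  rewrite (@igD _ (dens G3) (- x1) (- x2) T)//; [|by apply: iintS di _ _; lra|by rewrite lerN2|lra].
  rewrite (@igD _ (dens G3) (- x1 + 1) (- x1) T)//;
    [|by apply: iintS di _ _; lra|by rewrite lerDl|lra].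
  have G3c c d : c <= d -> chain n c d G3.
    rewrite le_eqVlt => /predU1P[->|]; last exact: g3.
    by apply: chain_sub (g3 (d - 1) (d + 1) _) _ _; lra.
  have p1 : ig (dens G3) (- T) (- x2 - 1) = 0.
    apply: (ig_dens_const hsN); [lra|by apply: G3c; lra|].
    move=> j t jn ht; rewrite b2; last by lra.
    by rewrite -refl_const /G2 /refl_chain a3//; lra.
  have p5 : ig (dens G3) (- x1 + 1) T = 0.
    apply: (ig_dens_const hs); [lra|by apply: G3c; lra|].
    by move=> j t jn ht; rewrite b3//; lra.
  have e2 t : t <= - x1 -> dens G3 t = dens G2 t.
    by move=> tx; rewrite /dens !b2.
  have e1 t : t <= x2 -> dens G1 t = dens F t.
    by move=> tx; rewrite /dens !a2.
  have p2 : ig (dens G3) (- x2 - 1) (- x2) <= kap / 2.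
    rewrite (@igE _ _ (dens G2)); last by move=> t ht; apply: e2; lra.
    rewrite ig_dens_refl; last 2 first.
    + lra.
    + have := c1 (x2 + 1) (lexx _) => h; apply: chain_sub h _ _; lra.
    have -> : - (- x2 - 1) = x2 + 1 by lra.
    by rewrite opprK; exact: (a4 x1).
  have p3 : ig (dens G3) (- x2) (- x1) = ig (dens F) x1 x2.
    rewrite (@igE _ _ (dens G2)); last by move=> t /andP[_ ht]; apply: e2.
    rewrite ig_dens_refl ?lerN2// ?opprK//; last first.
      by have := c1 (x2 + 1) (lexx _) => h; apply: chain_sub h _ _; lra.
    by apply: igE => t /andP[_ ht]; exact: e1.
  have p4 : ig (dens G3) (- x1) (- x1 + 1) <= kap / 2.
    apply: (b4 (- x2 - 1)); first lra.
    have -> : - x2 - 1 = - (x2 + 1) by lra.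
    by apply: c2; lra.
  rewrite p1 p3 p5; lra.
case: hs right left {ext hsN ns1 ns2 a1 a2 a3 a4 b1 b2 b3 b4 ns1' c1 c2} => -> right left.
- by exists T, G3; split.
- have [pr pe] := profile_refl T0 g3 right ltac:(by move=> j t jn tT; rewrite left// opprK).
  by exists T, (refl_chain G3); split => //; rewrite pe.
Qed.

(** Makes the transition cost finite, so that nearly optimal profiles can be chosen. *)
Lemma profile_exists : exists T G, profile n T G.
Proof.
have [G hG] := extend_right 1.
have [g1 g2 g3 _] := hG 0 (const_chain (-1)).
exists 2, (G 0 (const_chain (-1))); split => //.
- move=> c d cd.
  have := g1 (Num.min c 0) (Num.max d (0 + 1)).
  rewrite ge_min le_max !lexx !orbT => /(_ isT isT (chain_const _ _ _ _)) h.
  by apply: chain_sub h _ _; rewrite ?ge_min ?le_max lexx.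
- by move=> j t _ t2; apply: g3; lra.
- by move=> j t _ t2; apply: g2; lra.
Qed.

Context (de e : R).
Hypothesis de0 : 0 < de.
Hypothesis e0 : 0 < e.
Hypothesis e1 : e <= 1.
Hypothesis cellc : forall c d F, 1 <= d - c -> d - c <= 1 + e ->
  chain n c d F -> de * ig (coer F) c d <= ig (dens F) c d.

Lemma cells_coercive c tau K F : 1 <= tau -> tau <= 1 + e ->
  chain n c (c + K%:R * tau) F ->
  de * ig (coer F) c (c + K%:R * tau) <= ig (dens F) c (c + K%:R * tau).
Proof.
move=> t1 t2 ch; have t0 : 0 <= tau by exact: le_trans t1.
have cd : c <= c + K%:R * tau by rewrite lerDl mulr_ge0.
rewrite -igZ; last exact: (iint_coer hn cW ch cd).
apply: ig_cells => //.
- by apply: iintZ; exact: (iint_coer hn cW ch cd).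
- exact: iint_dens.
move=> k kK.
have h1 : c <= c + k%:R * tau by rewrite lerDl mulr_ge0.
have h2 : c + k.+1%:R * tau <= c + K%:R * tau by rewrite lerD2l ler_wpM2r// ler_nat.
have E : c + k.+1%:R * tau - (c + k%:R * tau) = tau by rewrite -natr1; ring.
have h3 : c + k%:R * tau <= c + k.+1%:R * tau by rewrite -subr_ge0 E.
have ch' := chain_sub ch h1 h2.
by rewrite igZ; [apply: cellc => //; rewrite E|exact: (iint_coer hn cW ch' h3)].
Qed.

Lemma long_coercive : exists2 L0, 0 < L0 & forall c d F, L0 <= d - c -> chain n c d F ->
  de * ig (coer F) c d <= ig (dens F) c d.
Proof.
have [L0 L00 H] := cells_exist e0; exists L0 => // c d F hL ch.
have [K [K0 k1 k2]] := H _ hL.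
have E : d = c + K%:R * ((d - c) / K%:R).
  by rewrite mulrC divfK ?pnatr_eq0 -?lt0n// addrC subrK.
by move: ch; rewrite E; exact: cells_coercive.
Qed.

Lemma dens_pos_cells c tau K F : 1 <= tau -> tau <= 1 + e ->
  chain n c (c + K%:R * tau) F -> 0 <= ig (dens F) c (c + K%:R * tau).
Proof.
move=> t1 t2 ch; apply: le_trans (cells_coercive t1 t2 ch).
apply: mulr_ge0; first exact: ltW.
by apply: ig_ge0 => t _; exact: coer_ge0.
Qed.

(** With energy below de eta every cell would be within 1/2 of a single well, so [G 0] could not
    change sign across a cell; starting from -1 it would stay negative up to the point where it
    equals 1. *)
Lemma cost_positive : exists2 c0, 0 < c0 &
  forall T G, profile n T G -> c0 <= ig (dens G) (- T) T.
Proof.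
have [eta eta0 good] := good_cell hn cW W0 W2' W3' (ltac:(lra) : 0 < (1 / 2 : R)).
have [L0 L00 H] := cells_exist e0.
exists (de * eta); first by rewrite mulr_gt0.
(* The interval is enlarged until it can be cut into cells; the added parts carry no energy. *)
move=> T G [T0 gG GT GNT]; pose T' := Num.max T L0.
have [t1 t2] : T <= T' /\ L0 <= T' by rewrite /T' !le_max !lexx orbT.
have TT : - T' < T' by lra.
have ch := gG _ _ TT.
have di := iint_dens lam hn cW ch (ltW TT).
have Gc c d : c <= d -> chain n c d G.
  rewrite le_eqVlt => /predU1P[->|]; last exact: gG.
  by apply: chain_sub (gG (d - 1) (d + 1) _) _ _; lra.
have -> : ig (dens G) (- T) T = ig (dens G) (- T') T'.
  rewrite (@igD _ _ (- T) (- T') T')//; [|lra|lra].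
  rewrite (@igD _ _ T (- T) T')//; [|by apply: iintS di _ _; lra|lra].
  rewrite (@ig_dens_const G (-1) (- T') (- T)); last 4 first.
  - by right.
  - lra.
  - by apply: Gc; lra.
  - by move=> j t jn ht; apply: GNT => //; lra.
  rewrite (@ig_dens_const G 1 T T')//; last 3 first.
  - by left.
  - exact: Gc.
  - by move=> j t jn ht; apply: GT => //; lra.
  by rewrite add0r addr0.
have [K [K0 k1 k2]] := H (T' - - T') ltac:(lra).
move: k1 k2; set tau := (T' - - T') / K%:R => k1 k2.
have E : T' = - T' + K%:R * tau.
  by rewrite mulrC divfK ?pnatr_eq0 -?lt0n// addrC subrK.
have ch1 : chain n (- T') (- T' + K%:R * tau) G by rewrite -E.
have tau0 : 0 <= tau by lra.
have -> : ig (dens G) (- T') T' = ig (dens G) (- T') (- T' + K%:R * tau) by rewrite -E.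
apply: le_trans (cells_coercive k1 k2 ch1).
rewrite ler_pM2l// leNgt; apply/negP => small.
have neg k : (k <= K)%N -> G 0%N (- T' + k%:R * tau) < 0.
  elim: k => [_|k IH kK]; first by rewrite mul0r addr0 GNT ?lerN2//= ltrN10.
  have h1 : - T' <= - T' + k%:R * tau by rewrite lerDl mulr_ge0.
  have h2 : - T' + k.+1%:R * tau <= - T' + K%:R * tau by rewrite lerD2l ler_wpM2r// ler_nat.
  have Ek : - T' + k.+1%:R * tau - (- T' + k%:R * tau) = tau by rewrite -natr1; ring.
  have h3 : - T' + k%:R * tau <= - T' + k.+1%:R * tau by rewrite -subr_ge0 Ek.
  have [||||s hs near] := good (- T' + k%:R * tau) (- T' + k.+1%:R * tau) G.
  - by rewrite Ek.
  - by rewrite Ek (le_trans k2)// [leRHS](_ : 2 = 1 + 1)// lerD2l.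
  - exact: chain_sub ch1 h1 h2.
  - exact: le_trans (coer_sub hn cW W0 ch1 h1 h3 h2) (ltW small).
  have [l0 _] := near (- T' + k%:R * tau) ltac:(by rewrite lexx h3).
  have [r0 _] := near (- T' + k.+1%:R * tau) ltac:(by rewrite lexx h3).
  have := IH (ltnW kK); move: l0 r0; rewrite !ler_norml.
  move: (G 0%N _) (G 0%N _) => z1 z2.
  by case: hs => ->; lra.
have := neg K (leqnn K); rewrite -E GT//=.
by rewrite ltNge ler01.
Qed.

Lemma transition_cost_gt0 : (0 < transition_cost n W lam)%E.
Proof.
have [c0 c00 hc] := cost_positive.
apply: (@lt_le_trans _ _ c0%:E); first by rewrite lte_fin.
apply/ereal_infP => _ [f af <-].
have W1 : W 1 = 0 by apply: Ws; left.
have WN1 : W (-1) = 0 by apply: Ws; right.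
have [T [F [pF cE]]] := admissible_profile lam hn cW W1 WN1 af.
rewrite -/(cost_of n W lam f) cE.
by rewrite lee_fin; exact: hc pF.
Qed.

(* A cell whose energy is at most eta is near a single well; the number of other
   cells is at most C / eta, so the mass of {w = s}, up to the L^1 distance from F 0
   to w, cannot fit in them. *)
Lemma find_state sg s c tau K F w C eta : 0 < sg -> sg <= 1 / 2 -> s = 1 \/ s = -1 ->
  0 < eta ->
  (forall c d F, 1 <= d - c -> d - c <= 2 -> chain n c d F -> ig (coer F) c d <= eta ->
    exists2 s, s = 1 \/ s = -1 & forall t, c <= t <= d -> near_state n sg s F t) ->
  1 <= tau -> tau <= 1 + e -> chain n c (c + K%:R * tau) F ->
  iint w c (c + K%:R * tau) -> (forall t, w t = 1 \/ w t = -1) ->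
  ig (coer F) c (c + K%:R * tau) <= C ->
  2 / eta * C < ig (fun t => (1 + s * w t) / 2) c (c + K%:R * tau)
                - ig (fun t => `|F 0%N t - w t|) c (c + K%:R * tau) ->
  exists2 k, (k < K)%N & forall t, c + k%:R * tau <= t <= c + k.+1%:R * tau ->
    near_state n sg s F t.
Proof.
move=> sg0 sg1 hs eta0 good t1 t2 ch wi w1 hC hlt.
have t0 : 0 <= tau by exact: le_trans t1.
have cd : c <= c + K%:R * tau by rewrite lerDl mulr_ge0.
apply: contrapT => nex.
have Fi := chain_iint ch cd (leq0n n).
have ai : iint (fun t => (1 + s * w t) / 2) c (c + K%:R * tau).
  apply: (@iintE _ (fun t => 2^-1 * (cst 1 t + s * w t))) => [t _|]; first by rewrite mulrC.
  by apply: iintZ; apply: iintD; [exact: iint_cst|exact: iintZ].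
have bi : iint (fun t => `|F 0%N t - w t|) c (c + K%:R * tau).
  by apply: iint_norm; exact: iintB.
have ci := iint_coer hn cW ch cd.
move: hlt; apply/negP; rewrite -leNgt -ig_sub//.
apply: (@le_trans _ _ (2 / eta * ig (coer F) c (c + K%:R * tau))); last first.
  by rewrite ler_wpM2l// divr_ge0// ltW.
rewrite -igZ//; apply: ig_cells => //; [exact: iintB|exact: iintZ|].
move=> k kK.
have h1 : c <= c + k%:R * tau by rewrite lerDl mulr_ge0.
have h2 : c + k.+1%:R * tau <= c + K%:R * tau by rewrite lerD2l ler_wpM2r// ler_nat.
have Ek : c + k.+1%:R * tau - (c + k%:R * tau) = tau by rewrite -natr1; ring.
have h3 : c + k%:R * tau <= c + k.+1%:R * tau by rewrite -subr_ge0 Ek.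
have ii := iintS (iintB ai bi) h1 h2.
have ci' := iintS ci h1 h2.
have cge : 0 <= ig (coer F) (c + k%:R * tau) (c + k.+1%:R * tau).
  by apply: ig_ge0 => t _; exact: coer_ge0.
rewrite igZ//.
have [hc|hc] := leP (ig (coer F) (c + k%:R * tau) (c + k.+1%:R * tau)) eta.
- have [||s' hs' near] := good _ _ F _ _ (chain_sub ch h1 h2) hc.
  + by rewrite Ek.
  + by rewrite Ek (le_trans t2)// [leRHS](_ : 2 = 1 + 1)// lerD2l.
  have ss' : s' = - s.
    have [ss|ss] : s' = s \/ s' = - s; last by [].
      by case: hs hs' => -> [] ->; rewrite ?opprK; [left|right|right|left].
    by exfalso; apply: nex; exists k => //; rewrite -ss.
  (* Near the well -s, the distance |F 0 - w| exceeds 1 wherever w = s, because sg <= 1/2; the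
     integrand is nowhere positive on this cell. *)
  apply: (@le_trans _ _ 0); last by rewrite mulr_ge0// divr_ge0// ltW.
  apply: (@le_trans _ _ (ig (cst 0) (c + k%:R * tau) (c + k.+1%:R * tau))); last first.
    by rewrite ig_cst// mul0r.
  apply: le_ig => //; first exact: iint_cst.
  move=> t ht /=; have [n0' _] := near t ht; move: n0'; rewrite ss' subr_le0.
  have hw := w1 t; move: (F 0%N t) (w t) hw => z v hv.
  case: hs => ->; case: hv => ->; rewrite ler_norml => /andP[? ?].
  + by rewrite ler0_norm; lra.
  + by rewrite mul1r subrr mul0r.
  + by rewrite mulN1r subrr mul0r.
  + by rewrite ger0_norm; lra.
(* The integrand is at most 1, the cell has length at most 2 and energy above eta: this is the
   origin of 2 / eta. *)
- apply: (@le_trans _ _ (ig (cst 1) (c + k%:R * tau) (c + k.+1%:R * tau))).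
    apply: le_ig => //; first exact: iint_cst.
    move=> t _ /=; have := normr_ge0 (F 0%N t - w t).
    by case: hs => ->; case: (w1 t) => ->; lra.
  rewrite ig_cst// Ek mul1r mulrAC ler_pdivlMr//.
  have eta0' := ltW eta0; have hc' := ltW hc.
  have tau2 : tau <= 2 by rewrite (le_trans t2)// [leRHS](_ : 2 = 1 + 1)// lerD2l.
  exact: ler_pM.
Qed.

(** After rescaling, the sets where u is 1 and where it is -1 have measure of order 1 / eps, whereas
    the cells of large energy cover a bounded length. [find_state] then gives a cell near each well,
    and [connect] joins them. *)
Lemma transition u p q C kap : p < q -> iint u p q -> (forall t, u t = 1 \/ u t = -1) ->
  - (q - p) < ig u p q -> ig u p q < q - p -> 0 < C -> 0 < kap ->
  exists eps0 th, [/\ 0 < eps0, 0 < th & forall eps U, 0 < eps -> eps < eps0 ->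
    chain n p q U -> ig (fun t => `|U 0%N t - u t|) p q <= th ->
    ig (coer (scaled eps U)) (p / eps) (q / eps) <= C ->
    exists T G, profile n T G /\
      ig (dens G) (- T) T <= ig (dens_eps n W lam eps U) p q + kap].
Proof.
move=> pq ui u1 hm hp C0 k0.
have [sg' sg'0 conn] := connect k0.
pose sg := Num.min sg' (1 / 2).
have sg0 : 0 < sg by rewrite /sg lt_min sg'0 /=; lra.
have [sg1 sg2] : sg <= sg' /\ sg <= 1 / 2 by rewrite /sg !ge_min !lexx orbT.
have [eta eta0 good] := good_cell hn cW W0 W2' W3' sg0.
have [L0 L00 H] := cells_exist e0.
(* The sets where u = 1 and u = -1 have measures (q - p + I) / 2 and (q - p - I) / 2; m is the
   smaller one. *)
pose I := ig u p q; pose m := Num.min ((q - p + I) / 2) ((q - p - I) / 2).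
have m0 : 0 < m by rewrite /m lt_min; apply/andP; split; rewrite /I; lra.
have [m1 m2] : m <= (q - p + I) / 2 /\ m <= (q - p - I) / 2 by rewrite /m !ge_min !lexx orbT.
(* The first bound makes the rescaled interval long enough to be cut into cells. The distance to u
   may use m / 2, and the second bound keeps the cells of large energy, 2 C eps / eta in the
   original scale, below the other half. *)
exists (Num.min ((q - p) / L0) (m * eta / (4 * C))), (m / 2).
split; [|lra|].
  by rewrite lt_min !divr_gt0 ?mulr_gt0// subr_gt0.
move=> eps U ep0; rewrite lt_min => /andP[ep1 ep2] ch hth hC.
have pq' := ltW pq.
have [ch' E] := ig_dens_scaled lam hn cW ep0 pq' ch.
have pqe : p / eps < q / eps by rewrite ltr_pM2r ?invr_gt0.
have [K [K0 k1 k2]] := H (q / eps - p / eps) ltac:(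
  by rewrite -mulrBl ler_pdivlMr// mulrC -ler_pdivlMr// ltW).
move: k1 k2; set tau := (q / eps - p / eps) / K%:R => k1 k2.
have EQ : q / eps = p / eps + K%:R * tau.
  by rewrite [K%:R * _]mulrC divfK ?pnatr_eq0 -?lt0n// addrC subrK.
have tau0 : 0 <= tau by lra.
pose w t := u (eps * t + 0).
have EX x : eps * (x / eps) + 0 = x by rewrite addr0 mulrC divfK// gt_eqF.
have ui' : iint u (eps * (p / eps) + 0) (eps * (q / eps) + 0) by rewrite !EX.
have [wi wE] := ig_affine ep0 ui'; rewrite !EX in wE.
have w1 t : w t = 1 \/ w t = -1 by exact: u1.
have di : iint (fun t => `|U 0%N t - u t|) (eps * (p / eps) + 0) (eps * (q / eps) + 0).
  by rewrite !EX; apply: iint_norm; apply: iintB => //; exact: chain_iint ch pq' _.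
have [di' dE] := ig_affine ep0 di; rewrite !EX in dE.
pose F := scaled eps U.
have dist : ig (fun t => `|F 0%N t - w t|) (p / eps) (q / eps) <= eps^-1 * (m / 2).
  rewrite (@igE _ _ (fun t => `|U 0%N (eps * t + 0) - u (eps * t + 0)|)); last first.
    by move=> t _; rewrite /F /scaled expr0 mul1r.
  by rewrite dE ler_wpM2l// invr_ge0 ltW.
have epV : 0 < eps^-1 by rewrite invr_gt0.
have mass s : s = 1 \/ s = -1 ->
    eps^-1 * m <= ig (fun t => (1 + s * w t) / 2) (p / eps) (q / eps).
  move=> hs; have i1 := iint_cst (1 : R) (p / eps) (q / eps).
  have i2 : iint (fun t => s * w t) (p / eps) (q / eps) by exact: iintZ.
  rewrite (@igE _ _ (fun t => 2^-1 * (cst 1 t + s * w t))); last by move=> t _; rewrite mulrC.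
  rewrite igZ; last exact: iintD.
  rewrite ig_add// igZ// (ig_cst _ (ltW pqe)) wE mul1r -mulrBl -/I.
  have -> : 2^-1 * ((q - p) / eps + s * (eps^-1 * I)) = eps^-1 * ((q - p + s * I) / 2) by ring.
  apply: ler_wpM2l; first exact: ltW.
  by case: hs => ->; rewrite ?mul1r ?mulN1r.
have find s : s = 1 \/ s = -1 -> exists2 k, (k < K)%N &
    forall t, p / eps + k%:R * tau <= t <= p / eps + k.+1%:R * tau -> near_state n sg s F t.
  move=> hs; apply: (find_state sg0 sg2 hs eta0 good k1 k2 (w := w) (C := C)) => //; rewrite -?EQ//.
  apply: (@lt_le_trans _ _ (eps^-1 * m - eps^-1 * (m / 2))); last first.
    by apply: lerB => //; exact: mass.
  have -> : eps^-1 * m - eps^-1 * (m / 2) = m / 2 / eps by field; rewrite gt_eqF.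
  rewrite ltr_pdivlMr//.
  have : eps * (4 * C) < m * eta by rewrite -ltr_pdivlMr// mulr_gt0.
  move=> h; have -> : 2 / eta * C * eps = (eps * (4 * C)) / (2 * eta) by field; rewrite gt_eqF.
  rewrite ltr_pdivrMr ?mulr_gt0//; lra.
have tl i j : (i <= j)%N -> p / eps + i%:R * tau <= p / eps + j%:R * tau.
  by move=> ij; rewrite lerD2l ler_wpM2r// ler_nat.
have pos i j : (i <= j)%N -> (j <= K)%N ->
    0 <= ig (dens F) (p / eps + i%:R * tau) (p / eps + j%:R * tau).
  move=> ij jK.
  have Ej : p / eps + j%:R * tau = p / eps + i%:R * tau + (j - i)%:R * tau.
    by rewrite natrB//; ring.
  rewrite Ej; apply: dens_pos_cells => //; rewrite -Ej.
  apply: chain_sub ch' _ _; first by rewrite lerDl mulr_ge0.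
  by rewrite [leRHS]EQ tl.
(* The profile is built from the end of cell i to the beginning of cell j. The rest, cells 0 to i
   and j to K - 1, consists of whole cells and has nonnegative energy. *)
have fin s i j : s = 1 \/ s = -1 -> (i < j)%N -> (j < K)%N ->
    (forall t, p / eps + i%:R * tau <= t <= p / eps + i.+1%:R * tau -> near_state n sg s F t) ->
    (forall t, p / eps + j%:R * tau <= t <= p / eps + j.+1%:R * tau -> near_state n sg (- s) F t) ->
    exists T G, profile n T G /\
      ig (dens G) (- T) T <= ig (dens_eps n W lam eps U) p q + kap.
  move=> hs ij jK ni nj.
  have ii : (i <= i.+1)%N by []; have jj : (j <= j.+1)%N by [].
  have {}ni := ni _ (introT andP (conj (tl _ _ ii) (lexx _))).
  have {}nj := nj _ (introT andP (conj (lexx _) (tl _ _ jj))).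
  have nle s' t : near_state n sg s' F t -> near_state n sg' s' F t.
    move=> [h0 hj]; split; first exact: le_trans sg1.
    by move=> l l0 ln; apply: le_trans (hj l l0 ln) sg1.
  have [|T [G [pG hG]]] := conn s F _ _ hs (tl _ _ ij) _ (nle _ _ ni) (nle _ _ nj).
    apply: chain_sub ch' _ _; first by rewrite lerDl mulr_ge0.
    by rewrite [leRHS]EQ tl// ltnW.
  exists T, G; split => //; apply: le_trans hG _; rewrite lerD2r -E.
  have dF := iint_dens lam hn cW ch' (ltW pqe).
  have p0 := pos 0%N i.+1 isT ltac:(exact: ltn_trans jK).
  have pK := pos j K (ltnW jK) (leqnn K).
  rewrite mul0r addr0 in p0; rewrite -EQ in pK.
  have q1 : p / eps <= p / eps + i.+1%:R * tau by rewrite lerDl mulr_ge0.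
  have q2 : p / eps + j%:R * tau <= q / eps by rewrite [leRHS]EQ tl// ltnW.
  rewrite (@igD _ (dens (scaled eps U))
    (p / eps + i.+1%:R * tau) (p / eps) (q / eps))//; last first.
    exact: le_trans (tl _ _ ij) q2.
  rewrite (@igD _ (dens (scaled eps U))
    (p / eps + j%:R * tau) (p / eps + i.+1%:R * tau) (q / eps))//; last 2 first.
  - exact: iintS dF _ _.
  - exact: tl.
  rewrite -/F; lra.
have [k kK nk] := find 1 (or_introl erefl).
have [k' kK' nk'] := find (-1) (or_intror erefl).
have [kk|kk|kk] := ltngtP k k'.
- by apply: (fin 1 k k') => //; left.
- by apply: (fin (-1) k' k) => //; [right|rewrite opprK].
(* One cell cannot be near both wells: they are at distance 2, and 2 sg <= 1. *)
- exfalso; rewrite -kk in nk'.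
  have hx := introT andP (conj (lexx (p / eps + k%:R * tau)) (tl _ _ (leqnSn k))).
  have [h1 _] := nk _ hx; have [h2 _] := nk' _ hx.
  move: h1 h2 sg2; rewrite !ler_norml; move: (F 0%N _) => z; lra.
Qed.

(* For u with values 1 and -1, the bounds on ig u p t say that both values have
   positive measure in ]p, t[. *)
Fixpoint oscillates u N p q : Prop :=
  if N is N'.+1 then
    exists t, [/\ p < t, - (t - p) < ig u p t, ig u p t < t - p & oscillates u N' t q]
  else p <= q.

Lemma oscillates_le u N p q : oscillates u N p q -> p <= q.
Proof. by elim: N p => [//|N IH] p [t [pt _ _ /IH]]; exact/le_trans/ltW. Qed.

(** Each mixed interval pays for one profile by [transition]. The remaining interval has nonnegative
    energy once eps is small enough for it to be cut into cells. Half of kap is spent at each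
    induction step. *)
Lemma lower_bound u N p q C kap : oscillates u N p q -> iint u p q ->
  (forall t, u t = 1 \/ u t = -1) -> 0 < C -> 0 < kap ->
  exists eps0 th, [/\ 0 < eps0, 0 < th & forall eps U, 0 < eps -> eps < eps0 ->
    chain n p q U -> ig (fun t => `|U 0%N t - u t|) p q <= th ->
    ig (coer (scaled eps U)) (p / eps) (q / eps) <= C ->
    (N%:R%:E * transition_cost n W lam <= (ig (dens_eps n W lam eps U) p q + kap)%:E)%E].
Proof.
move=> + + u1 C0; elim: N p kap => [|N IH] p kap /=.
  move=> pq ui k0; have [L0 L00 H] := long_coercive.
  move: pq; rewrite le_eqVlt => /predU1P[->|pq].
    exists 1, 1; split => // eps U _ _ _ _ _.
    by rewrite mul0e igxx add0r lee_fin ltW.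
  exists ((q - p) / L0), 1; split => //; first by rewrite divr_gt0 ?subr_gt0.
  move=> eps U ep0 ep1 ch _ _; rewrite mul0e lee_fin.
  have [ch' <-] := ig_dens_scaled lam hn cW ep0 (ltW pq) ch.
  apply: addr_ge0; last exact: ltW.
  apply: le_trans (H _ _ _ _ ch'); first apply: mulr_ge0; first exact: ltW.
by apply: ig_ge0 => t _; exact: coer_ge0.
  by rewrite -mulrBl ler_pdivlMr// mulrC -ler_pdivlMr// ltW.
move=> [t [pt um up osc]] ui k0; have k2 : 0 < kap / 2 by lra.
have tq := oscillates_le osc.
have ptl := ltW pt; have pq := le_trans ptl tq.
have ui1 := iintS ui (lexx p) tq; have ui2 := iintS ui ptl (lexx q).
have [ea [ta [ea0 ta0 Ha]]] := transition pt ui1 u1 um up C0 k2.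
have [eb [tb [eb0 tb0 Hb]]] := IH t (kap / 2) osc ui2 k2.
exists (Num.min ea eb), (Num.min ta tb).
split; [by rewrite lt_min ea0 eb0|by rewrite lt_min ta0 tb0|].
move=> eps U ep0; rewrite lt_min le_min => /andP[epa epb] ch /andP[tha thb] hC.
have ch1 := chain_sub ch (lexx p) tq; have ch2 := chain_sub ch ptl (lexx q).
have Ui := chain_iint ch pq (leq0n n).
have di : iint (fun t => `|U 0%N t - u t|) p q by apply: iint_norm; exact: iintB.
have [ch' _] := ig_dens_scaled lam hn cW ep0 pq ch.
have epV : 0 < eps^-1 by rewrite invr_gt0.
have x1 : p / eps <= t / eps by rewrite ler_pM2r.
have x2 : t / eps <= q / eps by rewrite ler_pM2r.
have [||T [G [pG hG]]] := Ha eps U ep0 epa ch1.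
- by apply: le_trans tha; apply: le_igS.
- exact: le_trans (coer_sub hn cW W0 ch' (lexx _) x1 x2) hC.
have hd : ig (fun t => `|U 0%N t - u t|) t q <= tb.
  by apply: le_trans thb; apply: le_igS.
have hN := Hb eps U ep0 epb ch2 hd (le_trans (coer_sub hn cW W0 ch' x1 x2 (lexx _)) hC).
have W1 : W 1 = 0 by apply: Ws; left.
have WN1 : W (-1) = 0 by apply: Ws; right.
have hT := profile_transition_cost lam hn cW W1 WN1 pG.
(* The cost is an extended real here; distributing the product over N + 1 uses nonnegativity of the
   two coefficients. *)
have TC0 := ltW transition_cost_gt0.
rewrite -natr1 EFinD ge0_muleDl ?lee_fin// mul1e.
have de' := iint_dens_eps lam hn cW eps ch pq.
rewrite (igD de' ptl tq).
apply: le_trans (leeD hN hT) _; rewrite -EFinD lee_fin; lra.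
Qed.

End transitions.

(** * Functions of bounded variation with values 1 and -1 *)

Section piecewise_constant.
Context {R : realType}.
Implicit Types (u : R -> R) (ts : seq R) (p q s t x y : R).
Local Notation mu := (@lebesgue_measure R).

Lemma sign_ig u p q : (forall t, u t = 1 \/ u t = -1) -> iint u p q -> p <= q ->
  `|ig u p q| <= q - p.
Proof.
move=> pmu iu pq; apply: (le_trans (ig_norm iu)).
rewrite (@igE _ _ (cst 1)) ?ig_cst// ?mul1r// => t _.
by case: (pmu t) => ->; rewrite /cst ?normrN normr1.
Qed.

Lemma ig_norm_eq0 u p q : iint u p q -> ig (fun t => `|u t|) p q = 0 ->
  \forall t \ae mu, `]p, q[%classic t -> u t = 0.
Proof.
move=> iu u0; apply: weak_zero => // n x px xq.
have [M M0 HM] := cont_bounded p q (@cont_kern R n x).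
have ik := iintM_cont iu (@cont_kern R n x).
by have := ig_le_bound iu ik HM; rewrite u0 mulr0 normr_le0 => /eqP.
Qed.

(** For u with values 1 and -1 the integral over [p, q] takes this extreme value exactly when u = s
    almost everywhere there. In this form the property is additive in the interval. *)
Definition const_on u s p q := ig u p q = s * (q - p).

Lemma const_onS u s p q p' q' : (forall t, u t = 1 \/ u t = -1) -> s = 1 \/ s = -1 ->
  iint u p q -> p <= p' -> p' <= q' -> q' <= q -> const_on u s p q -> const_on u s p' q'.
Proof.
move=> pmu hs iu pp pq qq; rewrite /const_on => h.
have iu1 : iint u p p' by apply: iintS iu _ _; lra.
have iu2 : iint u p' q' by apply: iintS iu _ _; lra.
have iu3 : iint u q' q by apply: iintS iu _ _; lra.
have iu4 : iint u p' q by apply: iintS iu _ _; lra.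
have := sign_ig pmu iu1 pp; have := sign_ig pmu iu2 pq; have := sign_ig pmu iu3 qq.
move: h; rewrite (igD iu pp (le_trans pq qq)) (igD iu4 pq qq).
by rewrite !ler_norml => h /andP[? ?] /andP[? ?] /andP[? ?]; case: hs h => ->; lra.
Qed.

Lemma const_on_ae u s p q : (forall t, u t = 1 \/ u t = -1) -> s = 1 \/ s = -1 ->
  iint u p q -> p <= q -> const_on u s p q ->
  \forall t \ae mu, `]p, q[%classic t -> u t = s.
Proof.
move=> pmu hs iu pq cs.
have is0 : iint (cst s) p q by apply: iint_cst.
have isu : iint (fun t => s - u t) p q by apply: (@iintB _ (cst s)).
have sus t : `|s - u t| = 1 - s * u t.
  by case: hs => ->; case: (pmu t) => ->; case: ger0P; lra.
suff : \forall t \ae mu, `]p, q[%classic t -> s - u t = 0.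
  by apply: aeS => t h /h; lra.
apply: ig_norm_eq0 => //.
rewrite (@igE _ (fun t => `|s - u t|) (fun t => cst 1 t - s * u t)); last by move=> t _; exact: sus.
rewrite ig_sub; [|exact: iint_cst|exact: iintZ].
by rewrite ig_cst// igZ// cs; case: hs => ->; lra.
Qed.

(** Passage to a supremum of right endpoints: stopping at r, with t - r at most e / 2, changes the
    integral and s (t - p) by at most e / 2 each. *)
Lemma const_on_head u s p q t : (forall t, u t = 1 \/ u t = -1) -> s = 1 \/ s = -1 ->
  iint u p q -> p <= t -> t <= q -> (forall r, p < r -> r < t -> const_on u s p r) ->
  const_on u s p t.
Proof.
move=> pmu hs iu pt tq h; case: (ltgtP p t) pt => // [pt _|<- _]; last first.
  by rewrite /const_on igxx subrr mulr0.
apply/eqP; rewrite -subr_eq0 -normr_le0; apply/ler_addgt0Pl => e e0; rewrite addr0.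
pose r := Num.max ((p + t) / 2) (t - e / 2).
have [pr rt re] : [/\ p < r, r < t & t - e / 2 <= r].
  rewrite /r lt_max gt_max le_max lexx orbT.
  by split; [apply/orP; left; lra|apply/andP; split; lra|].
have iut : iint u p t by apply: iintS iu _ _; lra.
have iur : iint u r t by apply: iintS iut _ _; lra.
have := sign_ig pmu iur (ltW rt); have := h _ pr rt; rewrite /const_on.
rewrite (igD iut (ltW pr) (ltW rt)) => ->; rewrite !ler_norml => /andP[? ?].
by apply/andP; split; case: hs => ->; lra.
Qed.

Definition mixed u p q := - (q - p) < ig u p q /\ ig u p q < q - p.

Lemma mixedP u p q : (forall t, u t = 1 \/ u t = -1) -> iint u p q -> p <= q ->
  ~ mixed u p q -> const_on u 1 p q \/ const_on u (-1) p q.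
Proof.
move=> pmu iu pq nm; have := sign_ig pmu iu pq; rewrite ler_norml /const_on => /andP[h1 h2].
have [?|h3] := ltP (- (q - p)) (ig u p q); last by right; lra.
have [?|h4] := ltP (ig u p q) (q - p); last by left; lra.
by case: nm.
Qed.

Lemma mixedS u p q p' q' : (forall t, u t = 1 \/ u t = -1) ->
  iint u p q -> p <= p' -> p' <= q' -> q' <= q -> mixed u p' q' -> mixed u p q.
Proof.
move=> pmu iu pp pq qq [h1 h2].
have iu1 : iint u p p' by apply: iintS iu _ _; lra.
have iu3 : iint u q' q by apply: iintS iu _ _; lra.
have iu4 : iint u p' q by apply: iintS iu _ _; lra.
have := sign_ig pmu iu1 pp; have := sign_ig pmu iu3 qq.
rewrite /mixed (igD iu pp (le_trans pq qq)) (igD iu4 pq qq).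
by rewrite !ler_norml => /andP[? ?] /andP[? ?]; split; lra.
Qed.

(** Moving the left end by g / 4, where g is the gap in the strict inequalities, changes both the
    integral and the length by at most g / 4. *)
Lemma mixed_shift u p q : (forall t, u t = 1 \/ u t = -1) ->
  iint u p q -> p < q -> mixed u p q -> exists p', [/\ p < p', p' < q & mixed u p' q].
Proof.
move=> pmu iu pq [h1 h2].
pose g := (q - p) - `|ig u p q|.
have g0 : 0 < g by rewrite /g subr_gt0 ltr_norml h1.
have gq : g <= q - p by rewrite /g; have := normr_ge0 (ig u p q); lra.
have [i1 i2] : - (q - p - g) <= ig u p q /\ ig u p q <= q - p - g.
  by apply/andP; rewrite -ler_norml /g; lra.
exists (p + g / 4); split; [lra|lra|].
have iu1 : iint u p (p + g / 4) by apply: iintS iu _ _; lra.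
have pp : p <= p + g / 4 by lra.
have pp' : p + g / 4 <= q by lra.
have := sign_ig pmu iu1 pp; move: i1 i2; rewrite /mixed (igD iu pp pp').
by rewrite ler_norml => ? ? /andP[? ?]; split; lra.
Qed.

Lemma oscillatesS u N p q p' q' : (forall t, u t = 1 \/ u t = -1) ->
  iint u p q -> p <= p' -> q' <= q -> oscillates u N p' q' -> oscillates u N p q.
Proof.
move=> pmu; elim: N p p' => [|N IH] p p' iu pp qq /=; first by move=> h; lra.
move=> [t [pt h1 h2 ho]]; have tq := oscillates_le ho.
exists t; have iut : iint u p t by apply: iintS iu _ _; lra.
have [m1 m2] := mixedS pmu iut pp (ltW pt) (lexx t) (conj h1 h2).
split=> //; first lra.
by apply: (IH t t) ho => //; apply: iintS iu _ _; lra.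
Qed.

Lemma oscillates_shift u N p q : (forall t, u t = 1 \/ u t = -1) ->
  iint u p q -> p < q -> oscillates u N p q ->
  exists p', [/\ p < p', p' < q & oscillates u N p' q].
Proof.
move=> pmu iu pq; case: N => [_|N /= [t [pt h1 h2 ho]]].
  by exists ((p + q) / 2); split=> /=; lra.
have tq := oscillates_le ho.
have iut : iint u p t by apply: iintS iu _ _; lra.
have [p' [pp pt' [m1 m2]]] := mixed_shift pmu iut pt (conj h1 h2).
by exists p'; split=> //; [lra|exists t].
Qed.

(** Oscillations accumulate at p: each new mixed interval is placed between p and those already
    found, its left end being moved off p by [mixed_shift] to leave room for the next. *)
Lemma mixed_oscillates u N p q : (forall t, u t = 1 \/ u t = -1) ->
  iint u p q -> p < q -> (forall t, p < t -> t <= q -> mixed u p t) ->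
  oscillates u N p q.
Proof.
move=> pmu iu pq hm.
suff [p' [pp _ ho]] : exists p', [/\ p < p', p' < q & oscillates u N p' q].
  exact: oscillatesS iu (ltW pp) (lexx q) ho.
elim: N => [|N [p' [pp pq' ho]]]; first by exists ((p + q) / 2); split=> /=; lra.
have iup : iint u p p' by apply: iintS iu _ _; lra.
have [p2 [p2p p2p' [m1 m2]]] := mixed_shift pmu iup pp (hm _ pp (ltW pq')).
by exists p2; split=> //; [lra|exists p'].
Qed.

(** The signs alternate, so every element of [ts] is a true jump and [size ts] is the number of
    jumps. *)
Fixpoint pieces u ts p q s : Prop :=
  if ts is t :: ts' then [/\ p < t, const_on u s p t & pieces u ts' t q (- s)]
  else p < q /\ const_on u s p q.

Lemma pieces_head u ts p q s : pieces u ts p q s ->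
  [/\ p < head q ts, head q ts <= q & const_on u s p (head q ts)].
Proof.
elim: ts p s => [|t ts IH] p s /=; first by move=> [? ?]; split.
by move=> [pt c /IH[h1 h2 _]]; split=> //; lra.
Qed.

(* The first piece ends at the supremum t1 of the t such that u is constant on
   ]p, t[; u oscillates once before any t > t1, hence at most N times after t1. *)
Lemma oscillates_pieces u N p q : (forall t, u t = 1 \/ u t = -1) ->
  iint u p q -> p < q -> ~ oscillates u N p q ->
  exists ts s, (s = 1 \/ s = -1) /\ pieces u ts p q s.
Proof.
move=> pmu; elim: N p => [|N IH] p iu pq no; first by case: no => /=; lra.
(* Otherwise u would be mixed on every interval starting at p, and [mixed_oscillates] would give any
   number of oscillations. *)
have [t0 [pt0 t0q nm]] : exists t0, [/\ p < t0, t0 <= q & ~ mixed u p t0].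
  apply: contrapT => h; apply: no; apply: mixed_oscillates => // t pt tq.
  by apply: contrapT => nm; apply: h; exists t.
have iu0 : iint u p t0 by apply: iintS iu _ _; lra.
have [s [hs cs]] : exists s, (s = 1 \/ s = -1) /\ const_on u s p t0.
  by case: (mixedP pmu iu0 (ltW pt0) nm) => ?; [exists 1|exists (-1)]; split=> //; [left|right].
pose E := [set t | p < t /\ t <= q /\ const_on u s p t].
have hE : has_sup E.
  by split; [exists t0; split|exists q => t [_ []]].
have Et0 : E t0 by split.
set t1 := sup E.
have t01 : t0 <= t1 by apply: sup_upper_bound.
have t1q : t1 <= q by apply: ge_sup; [exists t0|move=> t [_ []]].
have c1 : const_on u s p t1.
  apply: (const_on_head pmu hs iu) => //; first lra.
  move=> r pr rt1.
  have [t [pt [tq ct]] rt] : exists2 t, E t & r < t by apply: sup_gt => //; exists t0.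
  have iut : iint u p t by apply: iintS iu _ _; lra.
  by apply: (const_onS pmu hs iut (lexx p)) ct; lra.
have [t1q'|qt1] := ltP t1 q; last first.
  have e : t1 = q by lra.
  by exists [::], s; split=> //=; rewrite -e; split=> //; lra.
have max1 t : t1 < t -> t <= q -> ~ const_on u s p t.
  move=> tt tq ct; have : t <= t1 by apply: sup_upper_bound => //; split=> //; lra.
  lra.
have noN : ~ oscillates u N t1 q.
  move=> ho; have iu1 : iint u t1 q by apply: iintS iu _ _; lra.
  have [t [t1t tq ht]] := oscillates_shift pmu iu1 t1q' ho.
  apply: no => /=; exists t.
  have iut : iint u p t by apply: iintS iu _ _; lra.
  suff [? ?] : mixed u p t by split=> //; lra.
  apply: contrapT => /(mixedP pmu iut) => /(_ ltac:(lra)) h.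
  have [s' [hs' cs']] : exists s', (s' = 1 \/ s' = -1) /\ const_on u s' p t.
    by case: h => ?; [exists 1|exists (-1)]; split=> //; [left|right].
  apply: (max1 t) => //; first lra.
  suff -> : s = s' by [].
  have : const_on u s' p t0 by apply: (const_onS pmu hs' iut (lexx p)) cs'; lra.
  rewrite /const_on cs => /eqP; rewrite -subr_eq0 -mulrBl mulf_eq0 => /orP[|] /eqP; lra.
have iu1 : iint u t1 q by apply: iintS iu _ _; lra.
have [ts [s' [hs' ps']]] := IH t1 iu1 t1q' noN.
have [h1 h2 h3] := pieces_head ps'.
(* With equal signs the first piece would extend beyond the supremum t1. *)
have es : s' = - s.
  suff ns : s' <> s by case: hs hs' ns => -> [] -> //; rewrite ?opprK.
  move=> es; apply: (max1 (head q ts)) => //.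
  have iuh : iint u p (head q ts) by apply: iintS iu _ _; lra.
  by move: h3 c1; rewrite es /const_on (@igD _ _ t1 p (head q ts))//;
    [move=> -> ->; lra|lra|lra].
by exists (t1 :: ts), s; split=> //=; rewrite -es; split=> //; lra.
Qed.

(** The intervals end at the midpoint m between a jump and the next one, so each contains exactly
    one jump. For the induction the left end p' must be free to lie anywhere in the first piece. *)
Lemma pieces_oscillates u ts p q s : (forall t, u t = 1 \/ u t = -1) -> s = 1 \/ s = -1 ->
  iint u p q -> pieces u ts p q s -> oscillates u (size ts) p q.
Proof.
move=> pmu hs iu hp; have [+ _ _] := pieces_head hp; have := lexx p.
move: {2 3 4}p => p' pp p'h; move: p' p'h pp.
elim: ts p s hs iu hp => [|t ts IH] p s hs iu /=.
  by move=> _ p' ? ?; lra.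
move=> [pt c hp] p' p't pp.
have [h1 h2 h3] := pieces_head hp.
have iut : iint u t q by apply: iintS iu _ _; lra.
have hs' : - s = 1 \/ - s = -1 by case: hs => ->; rewrite ?opprK; [right|left].
set m := (t + head q ts) / 2.
have tm : t < m by rewrite /m; lra.
have mh : m < head q ts by rewrite /m; lra.
suff [? ?] : mixed u p' m.
  by exists m; split=> //; [lra|exact: (IH t (- s) hs' iut hp m mh (ltW tm))].
have iu1 : iint u p t by apply: iintS iu _ _; lra.
have iu2 : iint u t (head q ts) by apply: iintS iu _ _; lra.
have iu3 : iint u p' m by apply: iintS iu _ _; lra.
have := const_onS pmu hs iu1 pp (ltW p't) (lexx t) c.
have := const_onS pmu hs' iu2 (lexx t) (ltW tm) (ltW mh) h3.
rewrite /mixed /const_on (@igD _ _ t p' m)//; [|lra|lra].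
by move=> -> ->; case: hs => ->; split; lra.
Qed.

(** On each piece the integral of u f' is, up to sign, a difference of two values of f, hence at
    most 2 in modulus. The bound is crude and serves to show finite variation. *)
Lemma pieces_variation u ts p q s f f' : (forall t, u t = 1 \/ u t = -1) -> s = 1 \/ s = -1 ->
  iint u p q -> pieces u ts p q s -> (forall t : R, is_derive t (1 : R) f (f' t)) ->
  continuous f' -> (forall t, `|f t| <= 1) ->
  `|ig (fun t => u t * f' t) p q| <= 2 * (size ts).+1%:R.
Proof.
move=> pmu hs iu + df cf f1.
have block s' x y : s' = 1 \/ s' = -1 -> iint u x y -> x < y -> const_on u s' x y ->
    `|ig (fun t => u t * f' t) x y| <= 2.
  move=> hs' iuxy xy c.
  have iuf : iint (fun t => u t * f' t) x y by apply: iintM_cont.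
  have isf : iint (fun t => s' * f' t) x y by apply: iintZ; exact: iint_cont.
  have mo g : iint g x y -> measurable_fun `]x, y[ g.
    move=> /iint_measurable; apply: measurable_funS => //.
    exact: subset_itv_oo_cc.
  rewrite (@ig_ae _ _ (fun t => s' * f' t)); [|  | exact: mo| exact: mo].
    rewrite igZ; [|exact: iint_cont].
    rewrite (FTC (ltW xy) df cf) normrM.
    have -> : `|s'| = 1 by case: hs' => ->; rewrite ?normrN normr1.
    by rewrite mul1r (le_trans (ler_normB _ _))//; have := f1 x; have := f1 y; lra.
  by have := const_on_ae pmu hs' iuxy (ltW xy) c; apply: aeS => t h /h ->.
elim: ts p s hs iu => [|t ts IH] p s hs iu /=.
  by move=> [pq c]; rewrite mulr1; exact: block hs iu pq c.
move=> [pt c hp]; have [h1 h2 _] := pieces_head hp.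
have iu1 : iint u p t by apply: iintS iu _ _; lra.
have iu2 : iint u t q by apply: iintS iu _ _; lra.
have hs' : - s = 1 \/ - s = -1 by case: hs => ->; rewrite ?opprK; [right|left].
rewrite (@igD _ _ t); [|exact: iintM_cont|lra|lra].
rewrite (le_trans (ler_normD _ _))//.
have := block _ _ _ hs iu1 pt c; have := IH _ _ hs' iu2 hp.
by rewrite -[(size ts).+2]addn1 natrD; lra.
Qed.

Lemma mixed_values u p q s : (forall t, u t = 1 \/ u t = -1) -> s = 1 \/ s = -1 ->
  iint u p q -> p < q -> mixed u p q -> exists x, [/\ p < x, x < q, mollifies u p q x & u x = s].
Proof.
move=> pmu hs iu pq [m1 m2]; apply: contrapT => no.
have ae1 : \forall t \ae mu, `]p, q[%classic t -> u t = - s.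
  apply: (aeS _ (mollifies_ae iu)) => t h tpq.
  move: (tpq); rewrite /= in_itv /= => /andP[pt tq].
  have us : u t <> s by move=> us; apply: no; exists t; split=> //; exact: h.
  by case: (pmu t) us => ->; case: hs => ->; rewrite ?opprK.
have mo g : iint g p q -> measurable_fun `]p, q[ g.
  by move=> /iint_measurable; apply: measurable_funS => //; exact: subset_itv_oo_cc.
have := @ig_ae _ u (cst (- s)) p q ae1 (mo _ iu) (mo _ (iint_cst _ _ _)).
by rewrite (ig_cst _ (ltW pq)) => h; case: hs h => ->; lra.
Qed.

Definition test_pair p q (f f' : R -> R) := [/\ forall t : R, is_derive t (1 : R) f (f' t),
  continuous f', forall t, `|f t| <= 1 &
  exists c d, [/\ p < c, d < q & forall t, (t <= c) || (d <= t) -> f t = 0 /\ f' t = 0]].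

(* Each oscillation contributes the difference of two ramps, placed at Lebesgue
   points where u = 1 and u = -1. *)
Lemma oscillates_test u N p q : (forall t, u t = 1 \/ u t = -1) ->
  iint u p q -> oscillates u N p q ->
  exists f f', test_pair p q f f' /\ N%:R <= ig (fun t => u t * f' t) p q.
Proof.
move=> pmu; elim: N p => [|N IH] p iu /=.
  move=> pq; exists (cst 0), (cst 0); split.
    split; [by move=> t; exact: is_derive_cst|exact: cst_continuous| |].
      by move=> t; rewrite normr0.
    by exists (p + 1), (q - 1); split=> //; lra.
  by apply: ig_ge0 => t _; rewrite mulr0.
move=> [r [pr m1 m2 ho]]; have rq := oscillates_le ho.
have iu1 : iint u p r by apply: iintS iu _ _; lra.
have iu2 : iint u r q by apply: iintS iu _ _; lra.
have [f2 [g2 [[d2 cg2 f21 [c2 [e2 [rc2 e2q o2]]]] hN]]] := IH r iu2 ho.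
have [x [px xr mx ux]] := mixed_values pmu (or_introl erefl) iu1 pr (conj m1 m2).
have [y [py yr my uy]] := mixed_values pmu (or_intror erefl) iu1 pr (conj m1 m2).
(* The mollified values at x and y are at least 3/4 and at most -3/4, so their difference exceeds
   1. *)
have h4 : 0 < 4^-1 :> R by rewrite invr_gt0.
have [n1 hn1] := mx _ h4; have [n2 hn2] := my _ h4.
pose n := maxn n1 n2.
have [xn hx] := hn1 n (leq_maxl _ _); have [yn hy] := hn2 n (leq_maxr _ _).
have V0 : 0 < n.+1%:R^-1 :> R by rewrite invr_gt0.
pose f1 t := ramp n x t - ramp n y t; pose g1 t := kern n x t - kern n y t.
pose c1 := Num.min x y; pose e1 := Num.max x y + n.+1%:R^-1.
have pc1 : p < c1 by rewrite /c1 lt_min px.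
have e1r : e1 < r.
  by rewrite /e1; case: (leP x y) => _.
have c1r : c1 < r by rewrite /c1 gt_min xr.
have o1 t : (t <= c1) || (e1 <= t) -> f1 t = 0 /\ g1 t = 0.
  rewrite /f1 /g1 /c1 /e1 le_min => /orP[/andP[tx ty]|tt].
    by rewrite !ramp0// !kern_out ?tx ?ty// subrr.
  have tx : x + n.+1%:R^-1 <= t by apply: le_trans tt; rewrite lerD2r le_max lexx.
  have ty : y + n.+1%:R^-1 <= t by apply: le_trans tt; rewrite lerD2r le_max lexx orbT.
  by rewrite !ramp1// !kern_out ?tx ?ty ?orbT// !subrr.
have cg1 : continuous g1 by move=> t; apply: cvgB; exact: cont_kern.
have d1 (t : R) : is_derive t (1 : R) f1 (g1 t).
  exact: is_deriveB (ramp_derive n x t) (ramp_derive n y t).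
exists (fun t => f1 t + f2 t), (fun t => g1 t + g2 t); split.
  split.
  - by move=> t; exact: is_deriveD (d1 t) (d2 t).
  - by move=> t; apply: cvgD; [exact: cg1|exact: cg2].
  (* The supports of the two summands lie on either side of r, so the bound by 1 survives the
     addition. *)
  - move=> t; have [tr|rt] := leP t r.
      have [-> _] : f2 t = 0 /\ g2 t = 0 by apply: o2; apply/orP; left; lra.
      rewrite addr0 /f1; have /andP[? ?] := ramp01 n x t; have /andP[? ?] := ramp01 n y t.
      by rewrite ler_norml; apply/andP; split; lra.
    have [-> _] : f1 t = 0 /\ g1 t = 0 by apply: o1; apply/orP; right; lra.
    by rewrite add0r.
  - exists (Num.min c1 c2), (Num.max e1 e2); split.
    + by rewrite lt_min pc1; lra.
    + by rewrite gt_max e2q andbT; lra.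
    + move=> t; rewrite le_min ge_max => ht.
      have [-> ->] : f1 t = 0 /\ g1 t = 0.
        by apply: o1; case/orP: ht => /andP[-> ?] //; rewrite orbT.
      have [-> ->] : f2 t = 0 /\ g2 t = 0.
        by apply: o2; case/orP: ht => /andP[? ->] //; rewrite orbT.
      by rewrite addr0.
have cg t : g1 t + g2 t @[t --> t] --> g1 t + g2 t by apply: cvgD; [exact: cg1|exact: cg2].
rewrite (@igD _ _ r); [|exact: iintM_cont|lra|lra].
rewrite (@igE _ _ (fun t => u t * kern n x t - u t * kern n y t) p r); last first.
  move=> t /andP[_ tr]; have [_ ->] : f2 t = 0 /\ g2 t = 0 by apply: o2; apply/orP; left; lra.
  by rewrite addr0 /g1 mulrBr.
rewrite (@igE _ _ (fun t => u t * g2 t) r q); last first.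
  move=> t /andP[rt _]; have [_ ->] : f1 t = 0 /\ g1 t = 0 by apply: o1; apply/orP; right; lra.
  by rewrite add0r.
rewrite ig_sub; [|by apply: iintM_cont => //; exact: cont_kern..].
move: hx hy; rewrite ux uy !ler_norml => /andP[? ?] /andP[? ?].
by move: hN; rewrite -[N.+1]addn1 natrD; lra.
Qed.

End piecewise_constant.

(** * Right-continuous step functions, their jumps and the link with bounded variation *)

Section step_functions.
Context {R : realType}.
Implicit Types (u v : R -> R) (ts : seq R) (a b p q s t x y : R).
Local Notation mu := (@lebesgue_measure R).

(** The strict comparison makes the function right-continuous, as [is_pc_representative] demands. *)
Fixpoint stepf ts s x : R :=
  if ts is t :: ts' then if x < t then s else stepf ts' (- s) x else s.

Lemma stepf_sign ts s x : s = 1 \/ s = -1 -> stepf ts s x = 1 \/ stepf ts s x = -1.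
Proof.
elim: ts s => [//|t ts IH] s hs /=; case: ifP => // _; apply: IH.
by case: hs => ->; rewrite ?opprK; [right|left].
Qed.

Lemma stepf_right ts s x : exists2 r, 0 < r & forall y, x <= y -> y < x + r ->
  stepf ts s y = stepf ts s x.
Proof.
elim: ts s => [|t ts IH] s /=; first by exists 1.
have [xt|tx] := ltP x t.
  by exists (t - x) => [|y xy yt]; [lra|have -> : y < t by lra].
have [r r0 h] := IH (- s); exists r => // y xy yr.
have -> : (y < t) = false by apply/negbTE; rewrite -leNgt; lra.
exact: h.
Qed.

Lemma stepf_left ts s x : x \notin ts -> exists2 r, 0 < r & forall y, x - r < y -> y <= x ->
  stepf ts s y = stepf ts s x.
Proof.
elim: ts s => [|t ts IH] s /=; first by exists 1.
rewrite inE negb_or => /andP[xt /IH h]; case: (ltgtP x t) xt => // xt _.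
  by exists 1 => // y _ yx; have -> : y < t by lra.
have [r r0 hr] := h (- s); exists (Num.min r (x - t)); first by rewrite lt_min r0; lra.
move=> y yr yx; have [r1 r2] : x - y < r /\ x - y < x - t.
  by apply/andP; rewrite -lt_min; lra.
have -> : (y < t) = false by apply/negbTE; rewrite -leNgt; lra.
by apply: hr; lra.
Qed.

Lemma pieces_sorted u ts p q s : pieces u ts p q s -> path <%R p (rcons ts q).
Proof.
elim: ts p s => [|t ts IH] p s /=; first by move=> [-> _].
by move=> [-> _ /IH ->].
Qed.

Lemma stepf_jump ts s p q x : path <%R p (rcons ts q) -> x \in ts -> exists2 r, 0 < r &
  forall y, x - r < y -> y < x -> stepf ts s y = - stepf ts s x.
Proof.
elim: ts s p => [//|t ts IH] s p /= /andP[pt hp].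
rewrite inE; have [xt _|xt /= xts] := eqVneq x t.
  exists 1 => // y _; rewrite xt => ->; rewrite ltxx.
  case: ts hp {IH} => [|t' ts'] /=; first by rewrite opprK.
  by move=> /andP[-> _]; rewrite opprK.
have tx : t < x.
  have := order_path_min lt_trans hp; move/allP => /(_ x); apply.
  by rewrite mem_rcons inE xts orbT.
have [r r0 hr] := IH (- s) _ hp xts.
exists (Num.min r (x - t)); first by rewrite lt_min r0; lra.
move=> y yr yx; have [r1 r2] : x - y < r /\ x - y < x - t.
  by apply/andP; rewrite -lt_min; lra.
have -> : (y < t) = false by apply/negbTE; rewrite -leNgt; lra.
have -> : (x < t) = false by apply/negbTE; rewrite -leNgt; lra.
by apply: hr; lra.
Qed.

Lemma stepf_cvg_right ts s x : stepf ts s y @[y --> x^'+] --> stepf ts s x.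
Proof.
have [r r0 hr] := stepf_right ts s x.
apply: cvg_near_cst; near=> y; apply: hr; first by apply/ltW; near: y; exact: nbhs_right_gt.
by near: y; apply: nbhs_right_lt; lra.
Unshelve. all: by end_near.
Qed.

Lemma stepf_continuous ts s x : x \notin ts -> {for x, continuous (stepf ts s)}.
Proof.
move=> xts; have [r r0 hr] := stepf_right ts s x; have [l l0 hl] := stepf_left s xts.
apply: cvg_near_cst; near=> y.
have : `|x - y| < Num.min r l.
  near: y; apply: (@cvgr_dist_lt _ _ _ (nbhs x) _ id x) => //.
  by rewrite lt_min r0.
rewrite lt_min !ltr_norml => /andP[/andP[? ?] /andP[? ?]].
by case: (leP x y) => xy; [apply: hr|apply: hl]; lra.
Unshelve. all: by end_near.
Qed.

Lemma stepf_discontinuous ts s p q x : s = 1 \/ s = -1 -> path <%R p (rcons ts q) ->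
  x \in ts -> ~ {for x, continuous (stepf ts s)}.
Proof.
move=> hs hp xts cx; have [r r0 hr] := stepf_jump s hp xts.
have : \forall y \near x, `|stepf ts s x - stepf ts s y| < 1.
  by move/cvgr_dist_lt: cx; apply.
case/nbhs_ballP => e /= e0 he.
pose y := x - Num.min r e / 2.
have m0 : 0 < Num.min r e by rewrite lt_min r0.
have [m1 m2] : Num.min r e <= r /\ Num.min r e <= e by rewrite !ge_min !lexx orbT.
have /he : ball x e y by rewrite /ball /= /y opprD opprK addrA subrr add0r gtr0_norm; lra.
rewrite (hr y); [|rewrite /y; lra|rewrite /y; lra].
by case: (stepf_sign ts x hs) => ->; rewrite ltr_norml => /andP[]; lra.
Qed.

Lemma ae_neq t : \forall x \ae mu, x != t.
Proof.
exists [set t]; split; [exact: measurable_set1|exact: lebesgue_measure_set1|].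
by move=> x /= /negP; rewrite negbK => /eqP.
Qed.

Lemma pieces_ae u ts p q s : (forall t, u t = 1 \/ u t = -1) -> s = 1 \/ s = -1 ->
  iint u p q -> pieces u ts p q s ->
  \forall x \ae mu, `]p, q[%classic x -> u x = stepf ts s x.
Proof.
move=> pmu; elim: ts p s => [|t ts IH] p s hs iu /=.
  by move=> [pq c]; exact: const_on_ae pmu hs iu (ltW pq) c.
move=> [pt c hp]; have [h1 h2 _] := pieces_head hp.
have iu1 : iint u p t by apply: iintS iu _ _; lra.
have iu2 : iint u t q by apply: iintS iu _ _; lra.
have hs' : - s = 1 \/ - s = -1 by case: hs => ->; rewrite ?opprK; [right|left].
apply: (aeS _ (aeI (const_on_ae pmu hs iu1 (ltW pt) c) (aeI (IH t _ hs' iu2 hp) (ae_neq t)))).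
move=> x [hx1 [hx2 xt]] /=; rewrite in_itv /= => /andP[px xq].
case: (ltgtP x t) xt => // xt _.
  by apply: hx1; rewrite /= in_itv /= px.
by apply: hx2; rewrite /= in_itv /= xt.
Qed.

Lemma path_bounds ts a b x : path <%R a (rcons ts b) -> x \in ts -> a < x < b.
Proof.
move=> hp xts; apply/andP; split.
  have := order_path_min lt_trans hp; move/allP => /(_ x); apply.
  by rewrite mem_rcons inE xts orbT.
elim: ts a hp xts => [//|t ts IH] a /= /andP[at_ hp].
rewrite inE => /orP[/eqP ->|h]; last exact: IH hp h.
have := order_path_min lt_trans hp; move/allP => /(_ b); apply.
by rewrite mem_rcons inE eqxx.
Qed.

Lemma stepf_pc_representative ts s a b u : s = 1 \/ s = -1 ->
  path <%R a (rcons ts b) ->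
  (\forall x \ae mu, `]a, b[%classic x -> u x = stepf ts s x) ->
  is_pc_representative `]a, b[ u (stepf ts s).
Proof.
move=> hs hp hae; split.
- by move=> x _; exact: stepf_sign.
- exact: hae.
- apply: (@sub_finite_set _ _ [set` ts]); last exact: finite_seq.
  move=> x [_ nc] /=; apply: contrapT => /negP xts; exact/nc/stepf_continuous.
- by move=> x _; exact: stepf_cvg_right.
Qed.

(** Both agree with u almost everywhere, hence at points arbitrarily close to x on its right;
    right-continuity carries the equality to x. *)
Lemma pc_representative_unique a b u v w :
  is_pc_representative `]a, b[ u v -> is_pc_representative `]a, b[ u w ->
  forall x, `]a, b[%classic x -> v x = w x.
Proof.
move=> [_ vu _ cv] [_ wu _ cw] x xab; move: (xab); rewrite /= in_itv /= => /andP[ax xb].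
have c : v y - w y @[y --> x^'+] --> v x - w x by apply: cvgB; [exact: cv|exact: cw].
apply/eqP; rewrite -subr_eq0 -normr_le0; apply/ler_addgt0Pl => e e0; rewrite addr0.
have : \forall y \near x^'+, `|(v x - w x) - (v y - w y)| < e.
  by move/cvgr_dist_lt: c; apply.
rewrite near_withinE => /nbhs_ballP[r /= r0 hr].
have xr : x < Num.min (x + r) b by rewrite lt_min xb andbT; lra.
have [y /andP[xy yr] [vy wy]] := ae_ex xr (aeI vu wu).
move: yr; rewrite lt_min => /andP[yr yb].
have yab : `]a, b[%classic y by rewrite /= in_itv /= yb andbT; lra.
have := hr y; rewrite /ball /= ltr_norml => /(_ ltac:(apply/andP; split; lra) xy).
by rewrite -(vy yab) -(wy yab) subrr subr0 => /ltW.
Qed.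

Lemma eq_discontinuities a b v w : (forall x, `]a, b[%classic x -> v x = w x) ->
  discontinuities `]a, b[ v = discontinuities `]a, b[ w.
Proof.
move=> h; suff H v' w' : (forall x, `]a, b[%classic x -> v' x = w' x) ->
    discontinuities `]a, b[ v' `<=` discontinuities `]a, b[ w'.
  by apply/seteqP; split; apply: H => // x xab; rewrite h.
move=> e x [xab nc]; split=> // cw; apply: nc.
rewrite /prop_for /continuous_at (e x xab); apply: cvg_trans cw.
apply: near_eq_cvg; move: xab; rewrite /= in_itv /= => /near_in_itvoo.
by apply: filterS => y /e.
Qed.

Lemma stepf_discontinuities ts s a b : s = 1 \/ s = -1 -> path <%R a (rcons ts b) ->
  discontinuities `]a, b[ (stepf ts s) = [set` ts].
Proof.
move=> hs hp; apply/seteqP; split=> x /=.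
  by move=> [_ nc]; apply: contrapT => /negP xts; exact/nc/stepf_continuous.
move=> xts; split; first by rewrite /= in_itv /=; exact: path_bounds hp xts.
exact: stepf_discontinuous hs hp xts.
Qed.

Lemma counting_jump_set ts s a b u : s = 1 \/ s = -1 ->
  path <%R a (rcons ts b) ->
  (\forall x \ae mu, `]a, b[%classic x -> u x = stepf ts s x) ->
  counting (jump_set `]a, b[ u) = (size ts)%:R%:E :> \bar R.
Proof.
move=> hs hp hae; have hpc := stepf_pc_representative hs hp hae.
have -> : jump_set `]a, b[ u = [set` ts].
  rewrite -(stepf_discontinuities hs hp); apply: eq_discontinuities.
  apply: pc_representative_unique (hpc); rewrite /pc_representative.
  by apply: (@xgetPex _ (cst 0) [set v | is_pc_representative `]a, b[ u v]); exists (stepf ts s).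
have uts : uniq ts.
  apply: (@subseq_uniq _ _ (rcons ts b)); first exact: subseq_rcons.
  by have /= := path_sorted hp; exact: (sorted_uniq lt_trans (@ltxx _ _)).
rewrite /counting asboolT; last exact: finite_seq.
congr (_%:R%:E); apply: perm_size; apply: uniq_perm => [||x]; [|exact: uts|].
  exact: finmap.fset_uniq.
by rewrite in_fset_set; [apply/idP/idP; rewrite inE|exact: finite_seq].
Qed.

(** The arguments on oscillations take a function with values 1 and -1 at every real number, not
    only almost everywhere on ]a, b[. *)
Lemma sign_representative u a b : iint u a b ->
  (\forall x \ae mu, `]a, b[%classic x -> u x = 1 \/ u x = -1) ->
  exists w, [/\ forall t, w t = 1 \/ w t = -1, iint w a b &
    \forall x \ae mu, `]a, b[%classic x -> u x = w x].
Proof.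
move=> iu hu; pose w t : R := if 0 < u t then 1 else -1.
have pmw t : w t = 1 \/ w t = -1 by rewrite /w; case: ifP; [left|right].
exists w; split=> //.
  apply: (@iint_bounded _ _ _ _ 1); last first.
    by move=> t _; case: (pmw t) => ->; rewrite ?normrN normr1.
  have := @measurable_fun_if _ _ (measurableTypeR R) (measurableTypeR R) (cst 1) (cst (-1))
    `[a, b]%classic (measurable_itv _) (fun t => 0 < u t); apply; try exact: measurable_cst.
  by apply: measurable_fun_ltr; [exact: measurable_cst|exact: iint_measurable].
apply: aeS hu => t h /h; rewrite /w => -[] ->; first by rewrite ltr01.
by rewrite ltr0N1.
Qed.

(** N oscillations yield a test function witnessing variation at least N, so finite variation bounds
    N and [oscillates_pieces] applies. *)
Lemma BV_pieces u a b : a < b -> BV_pm1 `]a, b[ u ->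
  exists ts s w, [/\ s = 1 \/ s = -1, forall t, w t = 1 \/ w t = -1, iint w a b,
    \forall x \ae mu, `]a, b[%classic x -> u x = w x & pieces w ts a b s].
Proof.
move=> ab [/iint_open iu fin hu].
have [w [pmw iw uw]] := sign_representative iu hu.
suff [N noN] : exists N, ~ oscillates w N a b.
  by have [ts [s [hs hp]]] := oscillates_pieces pmw iw ab noN; exists ts, s, w.
apply: contrapT => no; have osc N : oscillates w N a b by apply: contrapT => h; apply: no; exists N.
have [M hM] : exists M : R, (Defs.variation `]a, b[ u <= M%:E)%E.
  move: fin; case: (Defs.variation _ _) => [M _|//|_];
    [by exists M; rewrite lexx|by exists 0; rewrite leNye].
have [N hN] : exists N : nat, M < N%:R.
  by exists (Num.truncn M).+1; exact: truncnS_gt.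
have [f [f' [[df cf f1 [c [d [ac db out]]]] hi]]] := oscillates_test pmw iw (osc N).
have e1 : derive1 f = f' by apply/funext => t; rewrite derive1E; apply: derive_val.
suff : (N%:R%:E <= M%:E :> \bar R)%E by rewrite lee_fin leNgt hN.
apply: le_trans hM.
apply: (@le_trans _ _ (ig (fun t => w t * f' t) a b)%:E); first by rewrite lee_fin.
have iwf := iintM_cont iw cf; have iuf := iintM_cont iu cf.
have mo g : iint g a b -> measurable_fun `]a, b[ g.
  by move=> /iint_measurable; apply: measurable_funS => //; exact: subset_itv_oo_cc.
apply: ereal_sup_ubound; exists f.
  split=> //; split.
  - by move=> t; have := df t.
  - by rewrite e1.
  - exists `[c, d]%classic; split; first exact: segment_compact.
      by move=> t /=; rewrite !in_itv /= => /andP[? ?]; apply/andP; split; lra.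
    move=> t /=; rewrite in_itv /= => /negP; rewrite negb_and -!ltNge => /orP[h|h].
      by apply (out t); apply/orP; left; lra.
    by apply (out t); apply/orP; right; lra.
rewrite e1 -ig_open//; congr (_%:E).
apply: ig_ae; [|exact: mo..].
by apply: aeS uw => t h /h ->.
Qed.

Lemma pieces_BV u w ts a b s : a < b -> L1 `]a, b[ u -> s = 1 \/ s = -1 ->
  (forall t, w t = 1 \/ w t = -1) -> iint w a b ->
  (\forall x \ae mu, `]a, b[%classic x -> u x = w x) -> pieces w ts a b s ->
  BV_pm1 `]a, b[ u.
Proof.
move=> ab Lu hs pmw iw uw hp; split=> //; last by apply: aeS uw => t h /h ->.
have iu := iint_open Lu.
apply: (@le_lt_trans _ _ (2 * (size ts).+1%:R)%:E); last exact: ltry.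
apply: ge_ereal_sup => _ [f [[df cf _] f1] ->].
have df' (t : R) : is_derive t (1 : R) f (derive1 f t).
  by rewrite derive1E; apply: derivableP; exact: df.
have iwf := iintM_cont iw cf; have iuf := iintM_cont iu cf.
have mo g : iint g a b -> measurable_fun `]a, b[ g.
  by move=> /iint_measurable; apply: measurable_funS => //; exact: subset_itv_oo_cc.
rewrite lee_fin -ig_open// (@ig_ae _ _ (fun t => w t * derive1 f t)); [|  | exact: mo|exact: mo].
  by apply: le_trans (pieces_variation pmw hs iw hp df' cf f1); exact: ler_norm.
by apply: aeS uw => t h /h ->.
Qed.

End step_functions.

(** * Gamma-convergence *)

Section recovery.
Context {R : realType} (n : nat) (W : R -> R) (lam : R).
Hypothesis hn : (2 <= n)%N.
Hypothesis cW : continuous W.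
Hypothesis W2' : forall t, W t = 0 <-> t = 1 \/ t = -1.
Implicit Types (F U H : nat -> R -> R) (ts : seq R) (c d p q s t x eps : R) (j : nat).
Local Notation mu := (@lebesgue_measure R).
Local Notation dens := (dens n W lam).
Local Notation dens_eps := (dens_eps n W lam).

Lemma measurable_stepf ts s : measurable_fun setT (stepf ts s).
Proof.
elim: ts s => [|t ts IH] s; first exact: measurable_cst.
have := @measurable_fun_ifT _ _ (measurableTypeR R) (measurableTypeR R) (cst s)
  (stepf ts (- s)) (fun x => x < t); apply; [|exact: measurable_cst|exact: IH].
by apply: measurable_fun_ltr; [exact: measurable_id|exact: measurable_cst].
Qed.

Lemma iint_stepf ts s p q : s = 1 \/ s = -1 -> iint (stepf ts s) p q.
Proof.
move=> hs; apply: (@iint_bounded _ _ _ _ 1) => [|t _].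
  by apply: measurable_funTS; exact: measurable_stepf.
by case: (stepf_sign ts t hs) => ->; rewrite ?normrN normr1.
Qed.

Lemma scale_const_chain s j t t' (k : R) : k ^+ j * const_chain s j t = const_chain s j t'.
Proof. by case: j => [|j] /=; rewrite ?expr0 ?mul1r ?mulr0. Qed.

Section layers.
Variables (T : R) (G : nat -> R -> R).
Hypothesis pG : profile n T G.

Lemma oriented_profile s : s = 1 \/ s = -1 -> exists H, [/\ gchain n H,
  forall j t, (j <= n)%N -> T <= t -> H j t = const_chain s j t,
  forall j t, (j <= n)%N -> t <= - T -> H j t = const_chain (- s) j t &
  ig (dens H) (- T) T = ig (dens G) (- T) T].
Proof.
have [T0 gG G1 GN1] := pG; case=> ->; first by exists G.
exists (refl_chain G); split.
- by move=> c d cd; apply: chain_refl (ltW cd) _; apply: gG; rewrite ltrN2.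
- by move=> j t jn tT; rewrite -refl_const /refl_chain GN1 ?lerN2.
- by move=> j t jn tT; rewrite opprK -refl_const /refl_chain G1// lerNr.
- rewrite (@ig_dens_refl _ n W lam hn cW); [by rewrite opprK|lra|].
  by rewrite opprK; apply: gG; lra.
Qed.

(** The profile contracted by eps around t0. It is constant near c and d, so its energy is exactly
    that of the profile, not merely close to it, and layers can be glued. The profile is oriented to
    end at -s, its value on the right. *)
Lemma layer s c t0 d : s = 1 \/ s = -1 -> c < t0 -> t0 < d ->
  exists eps0 K, [/\ 0 < eps0, 0 <= K & forall eps, 0 < eps -> eps < eps0 ->
  exists U, [/\ chain n c d U,
    forall j, (j <= n)%N -> U j c = const_chain s j c,
    forall j, (j <= n)%N -> U j d = const_chain (- s) j d,
    ig (dens_eps eps U) c d = ig (dens G) (- T) T &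
    ig (fun t => `|U 0%N t - stepf [:: t0] s t|) c d <= K * eps]].
Proof.
move=> hs ct td; have [T0 _ _ _] := pG.
have hs' : - s = 1 \/ - s = -1 by case: hs => ->; rewrite ?opprK; [right|left].
have [H [gH H1 H2 EH]] := oriented_profile hs'.
rewrite opprK in H2.
have TT : - T < T by lra.
have n0 : (0 < n)%N by lia.
have [M M0 HM] := within_cont_bounded (chain_cont (gH _ _ TT) (ltW TT) n0).
have bH t : `|H 0%N t| <= M + 1.
  have [h1|h1] := leP t (- T).
    by rewrite H2//=; case: hs => ->; rewrite ?normrN normr1; lra.
  have [h2|h2] := leP T t; first by rewrite H1//=; case: hs' => ->; rewrite ?normrN normr1; lra.
  by apply: le_trans (HM t _) _; [apply/andP; split; lra|lra].
(* The first bound makes [t0 - eps T, t0 + eps T] fit into [c, d]. Only there does the layer differ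
   from the step, by at most (M + 1) + 1, on a length 2 eps T. *)
exists (Num.min (t0 - c) (d - t0) / T), (2 * T * (M + 2)); split.
- by rewrite divr_gt0// lt_min; apply/andP; split; lra.
- by rewrite !mulr_ge0//; lra.
move=> eps ep0; rewrite ltr_pdivlMr// lt_min => /andP[ec ed].
have ei0 : 0 < eps^-1 by rewrite invr_gt0.
have ee : eps^-1 * eps = 1 by rewrite mulVf// gt_eqF.
pose be := - (eps^-1 * t0).
have xle t y : eps^-1 * t + be <= y = (t <= t0 + eps * y).
  rewrite /be -mulrBr mulrC ler_pdivrMr// lerBlDl mulrC.
  by [].
have xge t y : y <= eps^-1 * t + be = (t0 + eps * y <= t).
  rewrite /be -mulrBr mulrC ler_pdivlMr// lerBrDl mulrC.
  by [].
pose U j t := eps^-1 ^+ j * H j (eps^-1 * t + be).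
have cd : c < d by lra.
have chU : chain n c d U.
  apply: chain_affine => //; first exact: ltW.
  by apply: gH; rewrite ltrD2r ltr_pM2l.
have Ul j t : (j <= n)%N -> t <= t0 - eps * T -> U j t = const_chain s j t.
  by move=> jn tt; rewrite /U H2 ?(scale_const_chain _ _ _ t)// xle; lra.
have Ur j t : (j <= n)%N -> t0 + eps * T <= t -> U j t = const_chain (- s) j t.
  by move=> jn tt; rewrite /U H1 ?(scale_const_chain _ _ _ t)// xge; lra.
exists U; split => //.
- by move=> j jn; apply: Ul => //; lra.
- by move=> j jn; apply: Ur => //; lra.
- have [chs <-] := ig_dens_scaled lam hn cW ep0 (ltW cd) chU.
  have e1 : eps * eps^-1 = 1 by rewrite mulrC.
  have sc j t : scaled eps U j t = H j (1 * t + be).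
    rewrite /scaled /U addr0 mulrA -exprMn e1 expr1n mul1r.
    by rewrite mulrA ee !mul1r.
  have hc : 1 * (c / eps) + be <= - T.
    by rewrite mul1r [c / eps]mulrC xle; lra.
  have hd : T <= 1 * (d / eps) + be.
    by rewrite mul1r [d / eps]mulrC xge; lra.
  set c' := 1 * (c / eps) + be in hc *; set d' := 1 * (d / eps) + be in hd *.
  have c'd' : c' < d' by lra.
  have iH : iint (dens H) c' d' := iint_dens lam hn cW (gH _ _ c'd') (ltW c'd').
  have := ig_affine (be := be) ltr01 iH; rewrite invr1 mul1r => -[_ eq1].
  rewrite (@igE _ _ (fun t => dens H (1 * t + be))); last first.
    by move=> t _; rewrite /dens !sc.
  rewrite [LHS]eq1 -EH (@igD _ _ (- T) c' d')//; [|lra].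
  rewrite (@igD _ _ T (- T) d')//; [|by apply: iintS iH _ _; lra|lra].
  have chH x y : x <= y -> chain n x y H.
    move=> xy; have := gH x (y + 1) ltac:(lra) => h; apply: chain_sub h _ _; lra.
  rewrite (@ig_dens_const _ n W lam hn W2' H s c')//; [|exact: chH|]; last first.
    by move=> j t jn /andP[_ tT]; apply: H2 => //; exact: ltW.
  rewrite (@ig_dens_const _ n W lam hn W2' H (- s) T d')//; [|exact: chH|]; last first.
    by move=> j t jn /andP[tT _]; apply: H1 => //; exact: ltW.
  by rewrite addr0 add0r.
have iU := chain_iint chU (ltW cd) (leq0n n).
have iS := iint_stepf [:: t0] c d hs.
set f := fun t => `|_|; have If : iint f c d by apply: iint_norm; exact: iintB.
have eT : 0 < eps * T by rewrite mulr_gt0.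
rewrite (@igD _ _ (t0 - eps * T) c d)//; [|lra|lra].
have If2 : iint f (t0 - eps * T) d by apply: iintS If _ _; lra.
rewrite (@igD _ _ (t0 + eps * T) _ d)//; [|lra|lra].
have If3 : iint f (t0 - eps * T) (t0 + eps * T) by apply: iintS If2 _ _; lra.
rewrite (@igE _ f (cst 0) c); last first.
  move=> t /andP[_ tt]; rewrite /f Ul//=.
  have -> : t < t0 by lra.
  by rewrite subrr normr0.
rewrite (@igE _ f (cst 0) _ d); last first.
  move=> t /andP[tt _]; rewrite /f Ur//=.
  by have -> : (t < t0) = false; [apply/negbTE; rewrite -leNgt; lra|rewrite subrr normr0].
rewrite !ig_cst; [|lra|lra].
have : ig f (t0 - eps * T) (t0 + eps * T) <= ig (cst (M + 2)) (t0 - eps * T) (t0 + eps * T).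
  apply: le_ig => //; first exact: iint_cst.
  move=> t _; rewrite /f /cst (le_trans (ler_normB _ _))//.
  have := bH (eps^-1 * t + be); rewrite /U expr0 mul1r.
  by case: (stepf_sign [:: t0] t hs) => ->; rewrite ?normrN normr1; lra.
rewrite ig_cst; last by lra.
by move=> h; rewrite !mul0r add0r addr0 (le_trans h)//; lra.
Qed.

(** Layers are glued at midpoints between consecutive jumps, where both sides are constant; the
    condition at p in the conclusion is what the gluing on the left requires. *)
Lemma recovery ts s p q : s = 1 \/ s = -1 -> path <%R p (rcons ts q) ->
  exists eps0 K, [/\ 0 < eps0, 0 <= K & forall eps, 0 < eps -> eps < eps0 ->
  exists U, [/\ chain n p q U,
    forall j, (j <= n)%N -> U j p = const_chain s j p,
    ig (dens_eps eps U) p q = (size ts)%:R * ig (dens G) (- T) T &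
    ig (fun t => `|U 0%N t - stepf ts s t|) p q <= K * eps]].
Proof.
elim: ts s p => [|t ts IH] s p hs /=.
  rewrite andbT => pq; exists 1, 0; split => // eps ep0 _.
  exists (const_chain s); split => //; first exact: chain_const.
    have [ch <-] := ig_dens_scaled lam hn cW ep0 (ltW pq) (chain_const n s p q).
    rewrite mul0r (@ig_dens_const _ n W lam hn W2' _ s)//.
      by rewrite ler_pM2r ?invr_gt0// ltW.
    by move=> j x _ _; exact: scale_const_chain.
  rewrite (@igE _ _ (cst 0)); last by move=> x _; rewrite /= subrr normr0.
  by rewrite (ig_cst _ (ltW pq)) !mul0r.
move=> /andP[pt hp].
have hs' : - s = 1 \/ - s = -1 by case: hs => ->; rewrite ?opprK; [right|left].
have th : t < head q ts by case: ts hp {IH} => [|t' ts] /= /andP[].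
pose m := (t + head q ts) / 2.
have tm : t < m by rewrite /m; lra.
have mh : m < head q ts by rewrite /m; lra.
have hpm : path <%R m (rcons ts q).
  by move: hp mh; case: (ts) => [|t' ts'] /= => [_ ->//|/andP[_ ->] ->].
have mq : m < q.
  have := order_path_min lt_trans hpm; move/allP => /(_ q); apply.
  by rewrite mem_rcons inE eqxx.
have [e1 [K1 [e10 K10 h1]]] := layer hs pt tm.
have [e2 [K2 [e20 K20 h2]]] := IH (- s) m hs' hpm.
exists (Num.min e1 e2), (K1 + K2); split; [by rewrite lt_min e10|exact: addr_ge0|].
move=> eps ep0; rewrite lt_min => /andP[ep1 ep2].
have [U1 [c1 l1 r1 E1 D1]] := h1 eps ep0 ep1.
have [U2 [c2 l2 E2 D2]] := h2 eps ep0 ep2.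
have pm : p <= m by lra.
have chU : chain n p q (glue m U1 U2).
  apply: chain_glue (ltW mq) c1 c2 _ => // j jn.
  by rewrite (r1 j (ltnW jn)) (l2 j (ltnW jn)).
exists (glue m U1 U2); split => //.
- by move=> j jn; rewrite /glue pm l1.
- have id := iint_dens_eps lam hn cW eps chU (le_trans pm (ltW mq)).
  rewrite (@igD _ _ m)//; last exact: ltW.
  rewrite (@igE _ _ (dens_eps eps U1) p); last first.
    by move=> x /andP[_ xm]; rewrite /dens_eps /glue xm.
  have [||_ e] := @igE_oo _ (dens_eps eps (glue m U1 U2)) (dens_eps eps U2) m q.
  + by move=> x /andP[mx _]; rewrite /dens_eps /glue leNgt mx.
  + by apply: iintS id _ _ => //.
  + by rewrite e E1 E2 -[(size ts).+1%:R]natr1; lra.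
- have iU := chain_iint chU (le_trans pm (ltW mq)) (leq0n n).
  have iS := iint_stepf (t :: ts) p q hs.
  set f := fun t => `|_|; have If : iint f p q by apply: iint_norm; exact: iintB.
  rewrite (@igD _ _ m)//; last exact: ltW.
  rewrite (@igE _ _ (fun t0 => `|U1 0%N t0 - stepf [:: t] s t0|) p); last first.
    move=> x /andP[_ xm]; rewrite /f /glue xm /=; case: ifP => // _.
    by case: (ts) mh => [//|t' ts'] /= mt'; have -> : x < t' by lra.
  rewrite (@igE _ _ (fun t => `|U2 0%N t - stepf ts (- s) t|) m); last first.
    move=> x /andP[mx _]; rewrite /f /glue /=.
    have -> : (x < t) = false by apply/negbTE; rewrite -leNgt; lra.
    case: leP => // xm; have -> : x = m by apply/eqP; rewrite eq_le xm.
    by rewrite r1// l2.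
  by lra.
Qed.

End layers.
End recovery.

(** * Lower and upper limits in the extended reals; diagonal choice *)

Section sequences_of_extended_reals.
Context {R : realType}.
Implicit Types (f : nat -> \bar R) (c : \bar R).

Lemma limn_esup_le f c : (\forall m \near \oo, (f m <= c)%E) -> (limn_esup f <= c)%E.
Proof.
move=> h; apply: (@le_trans _ _ (ereal_sup [set f m | m in [set m | (f m <= c)%E]])).
  by apply: ereal_inf_lbound; exists [set m | (f m <= c)%E].
by apply: ge_ereal_sup => _ [m hm <-].
Qed.

Lemma limn_einf_ge f c : (\forall m \near \oo, (c <= f m)%E) -> (c <= limn_einf f)%E.
Proof.
move=> h; rewrite /limn_einf leeNr; apply: limn_esup_le.
by apply: filterS h => m; rewrite leeN2.
Qed.

Lemma limn_einf_frequently f c (P : nat -> Prop) : (limn_einf f < c)%E ->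
  (\forall m \near \oo, P m) -> exists m, P m /\ (f m < c)%E.
Proof.
move=> fc hP; apply: contrapT => no; move: fc; rewrite ltNge => /negP; apply.
apply: limn_einf_ge; apply: filterS hP => m Pm; rewrite leNgt; apply/negP => fm.
by apply: no; exists m.
Qed.

Lemma ereal_between (x y : \bar R) : (x < y)%E -> exists c : R, (x < c%:E)%E /\ (c%:E < y)%E.
Proof.
case: x y => [r| |] [r'| |] //=; rewrite ?ltNyr ?ltry ?lte_fin => rr.
- by exists ((r + r') / 2); rewrite !lte_fin; split; lra.
- by exists (r + 1); rewrite ltry lte_fin; split=> //; lra.
- by exists (r' - 1); rewrite ltNyr lte_fin; split=> //; lra.
- by exists 0; rewrite ltNyr ltry.
Qed.

(** For each m an element is taken that satisfies every attainable level k <= m: since levels are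
    nested, the highest attainable one suffices, and [x0] is the default when there is none. Each
    fixed k is eventually both attainable and at most m. *)
Lemma diagonal (T : Type) (D : T -> Prop) (P : nat -> nat -> T -> Prop) (x0 : T) : D x0 ->
  (forall m k x, P m k x -> D x) ->
  (forall m k k' x, (k' <= k)%N -> P m k x -> P m k' x) ->
  (forall k, \forall m \near \oo, exists x, P m k x) ->
  exists x : nat -> T, (forall m, D (x m)) /\ forall k, \forall m \near \oo, P m k (x m).
Proof.
move=> D0 PD Pm Pn.
have best m : exists x, D x /\ forall k, (k <= m)%N -> (exists y, P m k y) -> P m k x.
  suff H j : exists x, D x /\ forall k, (k <= j)%N -> (exists y, P m k y) -> P m k x by exact: H.
  elim: j => [|j [x [Dx hx]]].
    have [[y hy]|ny] := pselect (exists y, P m 0%N y).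
      by exists y; split=> [|k]; [exact: PD hy|rewrite leqn0 => /eqP ->].
    by exists x0; split=> // k; rewrite leqn0 => /eqP -> /ny.
  have [[y hy]|ny] := pselect (exists y, P m j.+1 y).
    by exists y; split=> [|k kj _]; [exact: PD hy|exact: Pm kj hy].
  exists x; split=> // k; rewrite leq_eqVlt => /orP[/eqP -> /ny //|]; exact: hx.
have [x hx] := choice best; exists x; split=> [m|k]; first by have [] := hx m.
near=> m; have [_] := hx m; apply; first by near: m; exact: nbhs_infty_ge.
by near: m; exact: Pn.
Unshelve. all: by end_near.
Qed.

End sequences_of_extended_reals.

(** * Convergence in L^1 on a bounded interval and the wells *)

Section convergence.
Context {R : realType} (a b : R).
Hypothesis ab : a < b.
Implicit Types (u : R -> R) (v : nat -> R -> R).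
Local Notation mu := (@lebesgue_measure R).

Lemma L1_distance u w : iint u a b -> iint w a b ->
  (\int[mu]_(x in `]a, b[) `|w x - u x|%:E)%E = (ig (fun x => `|w x - u x|) a b)%:E.
Proof. by move=> iu iw; apply: integral_ig; apply: iint_norm; exact: iintB. Qed.

Lemma L1_cvgP u v : iint u a b -> (forall m, iint (v m) a b) -> L1_cvg `]a, b[ v u <->
  (forall e, 0 < e -> \forall m \near \oo, ig (fun x => `|v m x - u x|) a b <= e).
Proof.
move=> iu iv; rewrite /L1_cvg.
have -> : (fun m => \int[mu]_(x in `]a, b[) `|v m x - u x|%:E)%E =
    EFin \o (fun m => ig (fun x => `|v m x - u x|) a b).
  by apply/funext => m; rewrite L1_distance.
have d0 m : 0 <= ig (fun x => `|v m x - u x|) a b by apply: ig_ge0.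
split=> [/fine_cvgP[_ /cvgr0Pnorm_le h] e e0|h].
  by apply: filterS (h e e0) => m /=; rewrite ger0_norm.
apply/fine_cvgP; split; first by apply: nearW.
apply/cvgr0Pnorm_le => e e0; apply: filterS (h e e0) => m /=.
by rewrite ger0_norm.
Qed.

Lemma iint_L1 u : iint u a b -> L1 `]a, b[ u.
Proof. by move=> iu; apply: integrableS iu => //; exact: subset_itv_oo_cc. Qed.

Lemma iint_open_measurable u : iint u a b -> measurable_fun `]a, b[ u.
Proof.
by move=> /iint_measurable; apply: measurable_funS => //; exact: subset_itv_oo_cc.
Qed.

Lemma ig_distance_ae u u' w w' : iint u a b -> iint u' a b -> iint w a b -> iint w' a b ->
  u = u' %[ae mu in `]a, b[%classic] -> w = w' %[ae mu in `]a, b[%classic] ->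
  ig (fun x => `|w x - u x|) a b = ig (fun x => `|w' x - u' x|) a b.
Proof.
move=> iu iu' iw iw' uu ww; apply: ig_ae.
- by apply: (aeS _ (aeI uu ww)) => x [h1 h2] hx; rewrite h1// h2.
- by apply: iint_open_measurable; apply: iint_norm; exact: iintB.
- by apply: iint_open_measurable; apply: iint_norm; exact: iintB.
Qed.

(* The distance to the wells 1 and -1. *)
Definition defect u t : R := `| `|u t| - 1 |.

Lemma iint_defect u : iint u a b -> iint (defect u) a b.
Proof.
move=> iu; apply: iint_norm; apply: (@iintB _ _ (cst 1)); first exact: iint_norm.
exact: iint_cst.
Qed.

(** The defect is 1-Lipschitz in the value of the function, so the defect of u is bounded by that of
    w plus the L^1 distance, and vanishes in the limit. *)
Lemma limit_pm1 u : iint u a b ->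
  (forall e, 0 < e -> exists w, [/\ iint w a b, ig (fun x => `|w x - u x|) a b <= e &
    ig (defect w) a b <= e]) ->
  \forall x \ae mu, `]a, b[%classic x -> u x = 1 \/ u x = -1.
Proof.
move=> iu h.
have d0 : ig (defect u) a b = 0.
  have D0 : 0 <= ig (defect u) a b by apply: ig_ge0 => t _; exact: normr_ge0.
  apply/eqP; rewrite eq_le D0 andbT; apply/ler_addgt0Pl => e e0; rewrite addr0.
  have e2 : 0 < e / 2 by lra.
  have [w [iw h1 h2]] := h _ e2.
  have iwu : iint (fun x => `|w x - u x|) a b by apply: iint_norm; exact: iintB.
  apply: (@le_trans _ _ (ig (fun x => `|w x - u x| + defect w x) a b)).
    apply: le_ig; [exact: iint_defect|by apply: iintD => //; exact: iint_defect|].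
    move=> t _; rewrite /defect.
    have := ler_dist_dist (u t) (w t); rewrite distrC.
    have := ler_distD (`|w t|) (`|u t|) 1.
    lra.
  rewrite ig_add//; [lra|exact: iint_defect].
have iabs : iint (fun t => `|u t| - 1) a b.
  by apply: (@iintB _ _ (cst 1)); [exact: iint_norm|exact: iint_cst].
apply: aeS (ig_norm_eq0 iabs d0) => t ht /ht /eqP; rewrite subr_eq0 => /eqP.
by case: (ger0P (u t)) => _ e; [left|right]; lra.
Qed.

End convergence.

(** * The two inequalities *)

Section liminf_limsup.
Context {R : realType} (n : nat) (W : R -> R) (lam a b : R).
Hypothesis hn : (2 <= n)%N.
Hypothesis cW : continuous W.
Hypothesis W0 : forall t, 0 <= W t.
Hypothesis lam0 : 0 < lam.
Hypothesis W2' : forall t, W t = 0 <-> t = 1 \/ t = -1.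
Hypothesis W3' : W3 W.
Hypothesis ab : a < b.
Implicit Types (u v : R -> R) (F U : nat -> R -> R).
Local Notation mu := (@lebesgue_measure R).
Local Notation dens := (dens n W lam).
Local Notation coer := (coer n W).
Local Notation G := (G_eps n W lam `]a, b[).
Local Notation cost := (transition_cost n W lam).

(** With y the defect, y <= eta + y^2 / eta and L y^2 <= W; undoing the rescaling, the integral of W
    is at most eps C. *)
Lemma defect_le_energy : exists2 K, 0 <= K & forall eps C eta F, 0 < eps -> 0 < eta ->
  chain n a b F -> ig (coer (scaled eps F)) (a / eps) (b / eps) <= C ->
  ig (defect (F 0%N)) a b <= eta * (b - a) + K * (eps * C) / eta.
Proof.
have [L L0 hL] := quadratic_well W0 W2' W3'.
exists L^-1; first by rewrite invr_ge0 ltW.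
move=> eps C eta F ep0 eta0 ch hC.
have [chs _] := ig_dens_scaled lam hn cW ep0 (ltW ab) ch.
have epV : 0 < eps^-1 by rewrite invr_gt0.
have abe : a / eps <= b / eps by rewrite ler_pM2r// ltW.
have iW := chain_iint_W hn cW ch (ltW ab).
have iF : iint (F 0%N) a b := chain_iint ch (ltW ab) (leq0n n).
have eW : ig (fun t => W (F 0%N t)) a b <= eps * C.
  have e1 x : eps * (x / eps) + 0 = x by rewrite addr0 mulrC divfK// gt_eqF.
  have iW' : iint (fun t => W (F 0%N t)) (eps * (a / eps) + 0) (eps * (b / eps) + 0).
    by rewrite !e1.
  have [iWs] := ig_affine ep0 iW'; rewrite !e1 => e2.
  rewrite -ler_pdivrMl//.
  rewrite -e2; apply: le_trans hC; apply: le_ig => //.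
    exact: (iint_coer hn cW chs abe).
  by move=> t _; rewrite /coer /scaled expr0 mul1r lerDl sqr_ge0.
apply: (@le_trans _ _ (ig (fun t => cst eta t + (L^-1 / eta) * W (F 0%N t)) a b)).
  apply: le_ig; first exact: iint_defect.
    by apply: iintD; [exact: iint_cst|exact: iintZ].
  move=> t _; rewrite /defect /cst.
  have [s hs hw] := hL (F 0%N t); set x := F 0%N t in hw *.
  have d1 : `| `|x| - 1 | <= `|x - s|.
    by have := ler_dist_dist x s; case: hs => ->; rewrite ?normrN normr1.
  have d0 : 0 <= `| `|x| - 1 | by [].
  have d2 : `|x - s| ^+ 2 <= L^-1 * W x by rewrite real_normK ?num_real// ler_pdivlMl.
  set y := `| `|x| - 1 | in d0 d1 *.
  have y2 : y ^+ 2 <= L^-1 * W x by apply: le_trans d2; rewrite ler_sqr ?nnegrE.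
  have [ye|ey] := leP y eta.
    rewrite -[y]addr0 lerD// mulr_ge0// divr_ge0 ?invr_ge0 ?ltW//.
  rewrite mulrAC -[y]add0r lerD ?(ltW eta0)// ler_pdivlMr//.
  by apply: le_trans y2; rewrite expr2 ler_wpM2l// ltW.
rewrite ig_add; [|exact: iint_cst|exact: iintZ].
rewrite (ig_cst _ (ltW ab)) (igZ _ iW) lerD2l.
rewrite mulrAC ler_pM2r ?invr_gt0// ler_pM2l ?invr_gt0//.
Qed.

Context (de e : R).
Hypothesis de0 : 0 < de.
Hypothesis e0 : 0 < e.
Hypothesis e1 : e <= 1.
Hypothesis cellc : forall c d F, 1 <= d - c -> d - c <= 1 + e ->
  chain n c d F -> de * ig (coer F) c d <= ig (dens F) c d.

Lemma low_energy_chain (c : R) : exists eps0 C, [/\ 0 < eps0, 0 < C & forall eps v,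
  0 < eps -> eps < eps0 -> (G eps v < c%:E)%E -> exists F, [/\ chain n a b F,
    v = F 0%N %[ae mu in `]a, b[%classic],
    G eps v = (ig (dens_eps n W lam eps F) a b)%:E &
    ig (coer (scaled eps F)) (a / eps) (b / eps) <= C]].
Proof.
have [L0 L00 H] := long_coercive hn cW e0 cellc.
(* For eps below the first value the rescaled interval is long enough for coercivity; the summand 1
   keeps the energy bound positive. *)
exists ((b - a) / L0), ((`|c| + 1) / de); split.
- by rewrite divr_gt0// subr_gt0.
- by rewrite divr_gt0// ltr_wpDl.
move=> eps v ep0 epL Gc.
have sv : sobolev n `]a, b[ v.
  by apply: contrapT => ns; move: Gc; rewrite /G_eps asboolF.
have [F [ch vF]] := sobolev_chain ab sv.
have eG := G_eps_chain lam hn cW eps ab ch (proj1 sv) vF.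
exists F; split => //.
have [chs es] := ig_dens_scaled lam hn cW ep0 (ltW ab) ch.
have := H _ _ _ _ chs; rewrite es -mulrBl ler_pdivlMr// mulrC -ler_pdivlMr//.
move=> /(_ (ltW epL)) h; rewrite ler_pdivlMr// mulrC (le_trans h)//.
move: Gc; rewrite eG lte_fin => /ltW /le_trans; apply.
by rewrite (le_trans (ler_norm c))// lerDl.
Qed.

Lemma liminf_inequality u (w : nat -> R -> R) (eps : nat -> R) :
  (forall m, 0 < eps m) -> eps m @[m --> \oo] --> (0 : R) ->
  L1 `]a, b[ u -> (forall m, L1 `]a, b[ (w m)) -> L1_cvg `]a, b[ w u ->
  (G_lim n W lam `]a, b[ u <= limn_einf (fun m => G (eps m) (w m)))%E.
Proof.
move=> eps_gt0 eps_cvg Lu Lw cvg_w.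
(* If the inequality failed, a real c would lie strictly between the two sides. Energies below c
   then occur for arbitrarily large m, and [sel] picks such an m with eps m and the distance to u as
   small as desired. *)
rewrite leNgt; apply/negP => /ereal_between[c [hfreq hc]].
have iu := iint_open Lu; have iw m := iint_open (Lw m).
have near_w := (L1_cvgP iu iw).1 cvg_w.
have [eps0 [C [eps00 C0 hlow]]] := low_energy_chain c.
have cost0 : (0 < cost)%E := transition_cost_gt0 hn cW W0 W2' W3' de0 e0 e1 cellc.
have sel r th : 0 < r -> 0 < th -> exists m F, [/\ eps m < r, chain n a b F,
    ig (fun x => `|F 0%N x - u x|) a b <= th,
    ig (dens_eps n W lam (eps m) F) a b < c &
    ig (coer (scaled (eps m) F)) (a / eps m) (b / eps m) <= C].
  move=> r0 th0.
  have rr : 0 < Num.min r eps0 by rewrite lt_min r0.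
  have := limn_einf_frequently hfreq (filterI (cvgr_lt _ eps_cvg _ rr) (near_w th th0)).
  move=> [m [[em dm] Gm]]; move: em; rewrite lt_min => /andP[em em'].
  have [F [ch wF eG hC]] := hlow _ _ (eps_gt0 m) em' Gm.
  exists m, F; split => //; last by rewrite -lte_fin -eG.
  have iF := chain_iint ch (ltW ab) (leq0n n).
  rewrite -(ig_distance_ae iu iu (iw m) iF _ wF)//.
  by apply: aeW => x.
have [K K0 hdef] := defect_le_energy.
have upm : \forall x \ae mu, `]a, b[%classic x -> u x = 1 \/ u x = -1.
  apply: limit_pm1 => // d d0.
  have ba : 0 < b - a by rewrite subr_gt0.
  (* eta and then r are chosen so that each of the two terms of [defect_le_energy] is at most d /
     2. *)
  pose eta := d / 2 / (b - a).
  have eta0 : 0 < eta by rewrite !divr_gt0.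
  pose r := d / 2 * eta / (K * C + 1).
  have KC : 0 < K * C + 1 by rewrite ltr_wpDl// mulr_ge0// ltW.
  have r0 : 0 < r by rewrite divr_gt0// mulr_gt0//; lra.
  have [m [F [em ch dF _ hC]]] := sel r d r0 d0.
  exists (F 0%N); split => //; first exact: chain_iint ch (ltW ab) (leq0n n).
  have := hdef _ _ _ _ (eps_gt0 m) eta0 ch hC.
  have -> : eta * (b - a) = d / 2 by rewrite /eta divfK// gt_eqF.
  have h : K * (eps m * C) / eta <= d / 2.
    rewrite ler_pdivrMr//; apply: (@le_trans _ _ (eps m * (K * C + 1))).
      have := eps_gt0 m; lra.
    by rewrite -ler_pdivlMr// ltW.
  lra.
have [z [pmz iz uz]] := sign_representative iu upm.
have bound N : oscillates z N a b -> (N%:R%:E * cost <= c%:E)%E.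
  move=> ho; apply/lee_addgt0Pr => kap kap0.
  have [r [th [r0 th0 hb]]] := lower_bound hn cW W0 lam0 W2' W3' de0 e0 e1 cellc ho iz pmz C0 kap0.
  have [m [F [em ch dF hc' hC]]] := sel r th r0 th0.
  have iF := chain_iint ch (ltW ab) (leq0n n).
  apply: (@le_trans _ _ (ig (dens_eps n W lam (eps m) F) a b + kap)%:E).
    apply: hb => //; rewrite (ig_distance_ae iz iu iF iF) => //.
      by apply: aeS uz => x h hx; rewrite h.
    by apply: aeW => x.
  by rewrite -EFinD lee_fin lerD2r ltW.
have [N noN] : exists N, ~ oscillates z N a b.
  apply: contrapT => no.
  have osc N : oscillates z N a b by apply: contrapT => h; apply: no; exists N.
  (* The case N = 1 excludes an infinite cost; for a finite positive cost r, N r <= c cannot hold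
     for all N. *)
  have := bound 1%N (osc _); rewrite mul1e.
  move: cost0 bound; case: cost => [r| |] //; rewrite lte_fin => r0 bound _.
  have := bound _ (osc (Num.truncn (c / r)).+1).
  rewrite -EFinM lee_fin -ler_pdivlMr// leNgt => /negP; apply.
  exact: truncnS_gt.
have [ts [s [hs hp]]] := oscillates_pieces pmz iz ab noN.
have uBV := pieces_BV ab Lu hs pmz iz uz hp.
have ust : \forall x \ae mu, `]a, b[%classic x -> u x = stepf ts s x.
  by apply: (aeS _ (aeI uz (pieces_ae pmz hs iz hp))) => x [h1 h2] hx; rewrite h1// h2.
move: hc; rewrite /G_lim asboolT// (counting_jump_set hs (pieces_sorted hp) ust).
by rewrite muleC ltNge bound//; exact: pieces_oscillates pmz hs iz hp.
Qed.

(** The cost is a real number, being positive and bounded above by the energy of any profile, so the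
    infimum can be approached within d. *)
Lemma near_optimal_profile (d : R) : 0 < d -> exists T P r, [/\ profile n T P,
  cost = r%:E & ig (dens P) (- T) T <= r + d].
Proof.
move=> d0; have W1 : W 1 = 0 by apply/W2'; left.
have WN1 : W (-1) = 0 by apply/W2'; right.
have [T0 [P0 pP0]] := profile_exists W hn lam0.
have cost0 : (0 < cost)%E := transition_cost_gt0 hn cW W0 W2' W3' de0 e0 e1 cellc.
have := profile_transition_cost lam hn cW W1 WN1 pP0.
move: cost0; case Ec : cost => [r| |] // _ _.
have fc : ereal_inf [set cost_of n W lam f | f in admissible n] \is a fin_num.
  by rewrite -transition_costE Ec.
have [_ [f af <-]] := lb_ereal_inf_adherent d0 fc.
have [T [P [pP ->]]] := admissible_profile lam hn cW W1 WN1 af.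
by rewrite -transition_costE Ec -EFinD lte_fin => h; exists T, P, r; split=> //; exact: ltW.
Qed.

Lemma limsup_inequality u (eps : nat -> R) :
  (forall m, 0 < eps m) -> eps m @[m --> \oo] --> (0 : R) -> L1 `]a, b[ u ->
  exists v : nat -> R -> R, [/\ forall m, L1 `]a, b[ (v m), L1_cvg `]a, b[ v u &
    (limn_esup (fun m => G (eps m) (v m)) <= G_lim n W lam `]a, b[ u)%E].
Proof.
move=> eps_gt0 eps_cvg Lu; have iu := iint_open Lu.
(* Outside BV the limit energy is infinite and the constant sequence serves. *)
have [uBV|nBV] := pselect (BV_pm1 `]a, b[ u); last first.
  exists (fun _ => u); split => //; last by rewrite /G_lim asboolF// leey.
  apply/(L1_cvgP iu (fun _ => iu)) => d d0; apply: nearW => _.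
  rewrite (@igE _ _ (cst 0)); first by rewrite (ig_cst _ (ltW ab)) mul0r ltW.
  by move=> t _; rewrite subrr normr0.
have [ts [s [z [hs pmz iz uz hp]]]] := BV_pieces ab uBV.
have ust : \forall x \ae mu, `]a, b[%classic x -> u x = stepf ts s x.
  by apply: (aeS _ (aeI uz (pieces_ae pmz hs iz hp))) => x [h1 h2] hx; rewrite h1// h2.
rewrite /G_lim asboolT// (counting_jump_set hs (pieces_sorted hp) ust).
set Glim := (cost * _)%E.
(* Quality 1 / (k + 1) at index m, both for the distance and for the energy. Each quality is
   attained for all large m, with a profile that depends on k, and [diagonal] lets k grow with m. *)
pose P m k v := [/\ L1 `]a, b[ v, ig (fun x => `|v x - u x|) a b <= k.+1%:R^-1 &
  (G (eps m) v <= Glim + (k.+1%:R^-1)%:E)%E].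
have ik k : 0 < k.+1%:R^-1 :> R by rewrite invr_gt0 ltr0n.
have mono k k' : (k' <= k)%N -> k.+1%:R^-1 <= k'.+1%:R^-1 :> R.
  by move=> kk; rewrite lef_pV2 ?posrE ?ltr0n// ler_nat.
have [| | | |v [Lv hv]] := @diagonal _ (L1 `]a, b[) P u.
- exact: Lu.
- by move=> m k v [].
- move=> m k k' v kk [Lv d1 d2]; split => //; first exact: le_trans d1 (mono _ _ kk).
  by apply: le_trans d2 _; rewrite leeD2l// lee_fin mono.
(* The error 1 / (k + 1) is shared among the layers; the successor of the number of jumps is a valid
   denominator even when there is no jump. *)
- move=> k; pose N : R := (size ts).+1%:R.
  have N0 : 0 < N by rewrite ltr0n.
  have [T [Q [r [pQ Er hQ]]]] := near_optimal_profile (divr_gt0 (ik k) N0).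
  have [r1 [K [r10 K0 hrec]]] := recovery lam hn cW W2' pQ hs (pieces_sorted hp).
  have r20 : 0 < Num.min r1 (k.+1%:R^-1 / (K + 1)).
    by rewrite lt_min r10 divr_gt0// ltr_wpDl.
  apply: filterS (cvgr_lt _ eps_cvg _ r20) => m.
  rewrite lt_min => /andP[em em']; have [U [ch _ EU DU]] := hrec _ (eps_gt0 m) em.
  have iU := chain_iint ch (ltW ab) (leq0n n).
  exists (U 0%N); split; first exact: iint_L1.
    rewrite (ig_distance_ae iu (iint_stepf ts a b hs) iU iU ust); last by apply: aeW => x.
    apply: le_trans DU _; move: em'; rewrite ltr_pdivlMr; last by rewrite ltr_wpDl.
    have := eps_gt0 m; set i := _^-1; lra.
  rewrite (G_eps_chain lam hn cW (eps m) ab ch (chain_L2 ab ch (leq0n n))); last by apply: aeW => x.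
  rewrite EU /Glim Er -EFinM -EFinD lee_fin.
  apply: (@le_trans _ _ ((size ts)%:R * (r + k.+1%:R^-1 / N))); first by rewrite ler_wpM2l.
  rewrite mulrDr mulrC lerD2l mulrA ler_pdivrMr// mulrC.
  by apply: ler_wpM2l; [exact: ltW|rewrite ler_nat].
exists v; split => //.
  apply/L1_cvgP => // [m|d d0]; first exact: iint_open (Lv m).
  have [k hk] := invn_lt d0; have kd := hk k (leqnn k).
  by apply: filterS (hv k) => m [_ h _]; apply: le_trans h (ltW kd).
apply/lee_addgt0Pr => d d0; have [k hk] := invn_lt d0; have kd := hk k (leqnn k).
apply: limn_esup_le; apply: filterS (hv k) => m [_ _ h]; apply: le_trans h _.
by rewrite leeD2l// lee_fin ltW.
Qed.

End liminf_limsup.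

Theorem theorem2p4 (R : realType) (n : nat) (W : R -> R) (lambda a b : R)
    (hn : (2 <= n)%N) (hW1 : W1 W) (hW2 : W2 W) (hW3 : W3 W)
    (hlambda : 0 < lambda < optimal_constant n W) (hab : a < b)
    (eps : nat -> R) (eps_gt0 : forall m, 0 < eps m)
    (eps_cvg : eps m @[m --> \oo] --> (0 : R)) :
  (forall (u : R -> R) (v : nat -> R -> R),
      L1 `]a, b[ u -> (forall m, L1 `]a, b[ (v m)) -> L1_cvg `]a, b[ v u ->
      (G_lim n W lambda `]a, b[ u <=
       limn_einf (fun m => G_eps n W lambda `]a, b[ (eps m) (v m)))%E) /\
  (forall u : R -> R, L1 `]a, b[ u ->
      exists v : nat -> R -> R,
        [/\ forall m, L1 `]a, b[ (v m), L1_cvg `]a, b[ v u &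
            (limn_esup (fun m => G_eps n W lambda `]a, b[ (eps m) (v m)) <=
             G_lim n W lambda `]a, b[ u)%E]).
Proof.
have [cW W0] := hW1; have /andP[lam0 lamS] := hlambda.
(* The supremum of an empty or unbounded set is 0 by convention, which 0 < lambda <
   [optimal_constant n W] rules out. *)
have hS : has_sup [set l | interpolation_inequality n W l].
  by apply: contrapT => /sup_out h; move: lamS; rewrite /optimal_constant h; lra.
have gap : 0 < optimal_constant n W - lambda by lra.
(* An l above lambda for which the interpolation inequality holds; the whole proof uses the constant
   only through this l. *)
have [l hl] := sup_adherent gap hS; rewrite subKr => ll.
have [de [e [de0 e0 e1 cellc]]] := cell_coercive hn cW W0 lam0 ll hl.
split=> [u v|u].
  exact: (liminf_inequality hn cW W0 lam0 hW2 hW3 hab de0 e0 e1 cellc eps_gt0 eps_cvg).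
exact: (limsup_inequality hn cW W0 lam0 hW2 hW3 hab de0 e0 e1 cellc eps_gt0 eps_cvg).
Qed.
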